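(* Let $w^*=(x^*,y^*,z^* )$ be a KKT triple, and consider the sequences $\{w_k\}$, $\{\mu_k\}$ of the algorithm described in the context. Suppose that: (A1) $w^*$ satisfies strict complementarity, LICQ and SOSC; (A2) there are constants $0<\underline\kappa_\bullet<1<\overline\kappa_\bullet$ ($\bullet\in\{L,c,e\}$) such that $\underline\kappa_\bullet\mu_k\le\varphi_\bullet(\mu_k)\le\overline\kappa_\bullet\mu_k$ for all $k\in\{0,1,2,\dots\}$; (A3) $\mu_k^2=o(\mu_{k+1})$; (A4) $\mu_{k+1}\le\mu_k$ for all sufficiently large $k$; (A5) the retraction $R$ is second order; (A6) for every $\theta\in\{f,g_1,\dots,g_m,h_1,\dots,h_p\}$ there is $L_\theta>0$ such that, for all $x\in\mathcal M$ sufficiently close to $x^*$ and all sufficiently small $\xi\in T_x\mathcal M$, $\|\mathrm{Hess}(\theta\circ R_x)(\xi)-\mathrm{Hess}(\theta\circ R_x)(0_x)\|_{\rm op}\le L_\theta\|\xi\|_x$; (A7) the inputs $w_0$ and $\mu_{-1}>0$ are sufficiently close to $w^*$ and sufficiently small, respectively, and $w_0$ satisfies the stopping conditions with parameter $\mu_{-1}$; (A8) $\mu_{k+1}=o(\mu_k)$. Then the sequence $\{w_k\}$ converges to $w^*$, and the convergence rate is superlinear. Moreover, $\{w_k\}$ converges near-quadratically if the barrier parameters are updated by $\mu_{k+1}\leftarrow c\,\mu_k^{1+r}$ with $0<c<1$, $0<r<1$ and $0<\mu_0\le1$; that is, for any given $r\in(0,1)$, the sequence generated with this update converges to $w^*$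 with order at least $1+r$.
   Context: **Problem.** $\mathcal M$ is an $n$-dimensional connected complete Riemannian manifold with metric $\langle\cdot,\cdot\rangle_x$ and norm $\|\cdot\|_x$; $f,g_i\ (i\in\mathcal I=\{1,\dots,m\}),\ h_j\ (j\in\mathcal E=\{1,\dots,p\}):\mathcal M\to\mathbb R$ are twice continuously differentiable. The problem is to minimize $f(x)$ over $x\in\mathcal M$ subject to $g_i(x)\ge0$ $(i\in\mathcal I)$, $h_j(x)=0$ $(j\in\mathcal E)$. Write $w=(x,y,z)\in\mathcal M\times\mathbb R^m\times\mathbb R^p$, $\mathcal L(w)=f(x)-y^\top g(x)+z^\top h(x)$; $\mathrm{grad}_x,\mathrm{Hess}_x$ are the Riemannian gradient and Hessian in $x$; $G(x)=\mathrm{diag}(g(x))$; $\mathbf 1$ is the all-ones vector. **KKT.** $F(w)=[\mathrm{grad}_x\mathcal L(w);\,G(x)y;\,h(x)]$ and $F(w;\mu)=F(w)-\mu[0_x;\mathbf 1;0]$. A KKT triple $w^*$ satisfies $F(w^* )=0$, $g(x^* )\ge0$, $y^*\ge0$. $\mathcal A(x^* )=\{i:g_i(x^* )=0\}$. Strict complementarity: for every $i\in\mathcal I$ exactly one of $y_i^*,g_i(x^* )$ is zero. LICQ: $\{\mathrm{grad}\,g_i(x^* )\}_{i\in\mathcal A(x^* )}\cup\{\mathrm{grad}\,h_j(x^* )\}_{j\in\mathcal E}$ is linearly independent in $T_{x^*}\mathcal M$. SOSC: $\langle\mathrm{Hess}_x\mathcal L(w^* )[\xi],\xi\rangle_{x^*}>0$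 for all nonzero $\xi\in T_{x^*}\mathcal M$ with $\langle\mathrm{grad}\,g_i(x^* ),\xi\rangle=0$ for $i\in\mathcal A(x^* )$ with $y_i^*>0$, $\langle\mathrm{grad}\,g_i(x^* ),\xi\rangle\ge0$ for $i\in\mathcal A(x^* )$ with $y^*_i=0$, and $\langle\mathrm{grad}\,h_j(x^* ),\xi\rangle=0$ for $j\in\mathcal E$. **Jacobian.** $J_F(w)$ is the linear operator on $T_x\mathcal M\times\mathbb R^m\times\mathbb R^p$ mapping $(d_x,d_y,d_z)$ to $[\mathrm{Hess}_x\mathcal L(w)[d_x]-\sum_i (d_y)_i\,\mathrm{grad}\,g_i(x)+\sum_j(d_z)_j\,\mathrm{grad}\,h_j(x);\ (y_i\langle\mathrm{grad}\,g_i(x),d_x\rangle_x+g_i(x)(d_y)_i)_{i};\ (\langle\mathrm{grad}\,h_j(x),d_x\rangle_x)_{j}]$. **Retraction.** $R:T\mathcal M\to\mathcal M$ is smooth with $R_x(0_x)=x$, $\mathrm DR_x(0_x)=\mathrm{id}$. It is second order if for all $x,\xi$ the curve $t\mapsto R_x(t\xi)$ has zero acceleration at $t=0$. $\mathrm{Hess}(\theta\circ R_x)$ is the Hessian on the Euclidean space $T_x\mathcal M$. **Algorithm.** A forcing function is a continuous $\varphi:[0,\infty)\to[0,\infty)$ with $\varphi(\mu)=0$ iff $\mu=0$; $\varphi_L,\varphi_c,\varphi_e$ are given forcing functions. Let $\mathcal F^\circ=\{x:g(x)>0\}$. A point $w=(x,y,z)$ satisfies the stopping conditions with parameter $\mu$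 if $\|\mathrm{grad}_x\mathcal L(w)\|_x\le\varphi_L(\mu)$, $\|G(x)y-\mu\mathbf 1\|\le\varphi_c(\mu)$, $\|h(x)\|\le\varphi_e(\mu)$, $g(x)>0$, $y>0$. Input: $w_0\in\mathcal F^\circ\times\mathbb R^m_{++}\times\mathbb R^p$, $\mu_{-1}>0$. For $k=0,1,\dots$: set $\mu_k>0$ so that $\lim_{k\to\infty}\mu_k=0$; compute the initial point $w_{k+1}^{\rm init}=(R_{x_k}(d_x),\,y_k+d_y,\,z_k+d_z)$ with $(d_x,d_y,d_z)=-J_F(w_k)^{-1}F(w_k;\mu_k)$ (this definition is used at any iteration where $J_F(w_k)$ is nonsingular and the point lies in $\mathcal F^\circ\times\mathbb R^m_{++}\times\mathbb R^p$); then compute $w_{k+1}\in\mathcal F^\circ\times\mathbb R^m_{++}\times\mathbb R^p$ satisfying the stopping conditions with parameter $\mu_k$ using an (arbitrary) inner iteration started from $w^{\rm init}_{k+1}$. If $w_{k+1}^{\rm init}$ already satisfies these conditions, no further inner iterations are required, so $w_{k+1}=w_{k+1}^{\rm init}$. **Notation.** $a=o(b)$ means $a/b\to0$. **Rates.** Let $(\mathcal O,\psi)$ be a chart of $\mathcal M$ with $x^*\in\mathcal O$ and $\hat w=(\psi(x),y,z)$. A sequence $w_k\to w^*$ converges superlinearly if $\|\hat w_{k+1}-\hat w^*\|/\|\hat w_k-\hat w^*\|\to0$, and with order at least $q>0$ if there are $C\ge0$, $K\ge0$ with $\|\hat w_{k+1}-\hat w^*\|\le C\|\hat w_k-\hat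 w^*\|^q$ for all $k\ge K$. *)

(* Defs.v *)
From HB Require Import structures.
From mathcomp Require Import all_boot all_order all_algebra.
From mathcomp Require Import all_classical all_reals all_analysis.

Set Implicit Arguments.
Unset Strict Implicit.
Unset Printing Implicit Defensive.

Import Order.TTheory GRing.Theory Num.Theory.
Import numFieldNormedType.Exports.

Local Open Scope classical_set_scope.
Local Open Scope ring_scope.

Definition basis_vec (R : realType) (n : nat) (i : 'I_n) : 'rV[R]_n :=
  delta_mx 0 i.

(* The norm of 'rV[R]_k in the library is the sup norm. *)
Definition enorm (R : realType) (k : nat) (v : 'rV[R]_k) : R :=
  Num.sqrt (\sum_(i < k) v 0 i ^+ 2).

(* Class C^k on the open set U; f is total, its values off U are irrelevant. *)
Fixpoint Ck (R : realType) (n : nat) (W : normedModType R) (k : nat)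
    (U : set 'rV[R]_n) (f : 'rV[R]_n -> W) : Prop :=
  match k with
  | 0%N => forall x, U x -> {for x, continuous f}
  | k'.+1 => (forall x, U x -> differentiable f x) /\
      forall i : 'I_n, Ck k' U (fun x => 'D_(basis_vec R i) f x)
  end.

Definition Coo (R : realType) (n : nat) (W : normedModType R)
    (U : set 'rV[R]_n) (f : 'rV[R]_n -> W) : Prop :=
  forall k, Ck k U f.

(* [cinv] is the inverse of [cmap] on [cran]; both functions are total and
   meaningless off [cdom] and [cran] respectively. *)
Record chart (R : realType) (n : nat) (M : topologicalType) := Chart {
  cdom : set M;
  cmap : M -> 'rV[R]_n;
  cinv : 'rV[R]_n -> M
}.

Definition cran (R : realType) (n : nat) (M : topologicalType)
    (c : chart R n M) : set 'rV[R]_n :=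
  cmap c @` cdom c.

Definition is_chart (R : realType) (n : nat) (M : topologicalType)
    (c : chart R n M) : Prop :=
  [/\ open (cdom c), open (cran c),
      forall x, cdom c x -> cinv c (cmap c x) = x,
      forall x, cdom c x -> {for x, continuous (cmap c)} &
      forall z, cran c z -> {for z, continuous (cinv c)}].

Definition compatible (R : realType) (n : nat) (M : topologicalType)
    (c d : chart R n M) : Prop :=
  Coo (cmap c @` (cdom c `&` cdom d)) (cmap d \o cinv c) /\
  Coo (cmap d @` (cdom c `&` cdom d)) (cmap c \o cinv d).

(* [atlas] is a maximal atlas, so "a chart of M" is any member of it.
   [chart_at x] is an arbitrary choice of a chart around x.  As a set, the
   tangent space at x is 'rV[R]_n: a tangent vector is represented by its
   components in [chart_at x].  No regularity in x is asked of this choice;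
   regularity is always expressed through [tvec] below. *)
Record manifold (R : realType) (n : nat) (M : topologicalType) := Manifold {
  atlas : set (chart R n M);
  chart_at : M -> chart R n M;
  atlas_chart : forall c, atlas c -> is_chart c;
  atlas_compat : forall c d, atlas c -> atlas d -> compatible c d;
  atlas_max : forall c, is_chart c ->
    (forall d, atlas d -> compatible c d) -> atlas c;
  chart_at_atlas : forall x, atlas (chart_at x);
  chart_at_dom : forall x, cdom (chart_at x) x;
  manifold_hausdorff : hausdorff_space M;
  manifold_second_countable : @second_countable M
}.

Definition pcoord (R : realType) (n : nat) (M : topologicalType)
    (A : manifold R n M) (x : M) : 'rV[R]_n :=
  cmap (chart_at A x) x.

(* The element of the tangent space at [cinv c z] whose components in the chart
   c are v. *)
Definition tvec (R : realType) (n : nat) (M : topologicalType)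
    (A : manifold R n M) (c : chart R n M) (z v : 'rV[R]_n) : 'rV[R]_n :=
  'D_v (cmap (chart_at A (cinv c z)) \o cinv c) z.

Definition CkM (R : realType) (n : nat) (M : topologicalType)
    (A : manifold R n M) (k : nat) (f : M -> R) : Prop :=
  forall c, atlas A c -> Ck k (cran c) (f \o cinv c).

Definition bilin (R : realType) (n : nat) (B : 'M[R]_n) (u v : 'rV[R]_n) : R :=
  (u *m B *m v^T) 0 0.

(* Gram matrix at z, in the chart c, of a field of bilinear forms on the tangent
   spaces. *)
Definition gram_of (R : realType) (n : nat) (M : topologicalType)
    (A : manifold R n M) (B : M -> 'M[R]_n) (c : chart R n M)
    (z : 'rV[R]_n) : 'M[R]_n :=
  \matrix_(i, j) bilin (B (cinv c z))
    (tvec A c z (basis_vec R i)) (tvec A c z (basis_vec R j)).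

Record riemannian (R : realType) (n : nat) (M : topologicalType)
    (A : manifold R n M) := Riemannian {
  metric : M -> 'M[R]_n;
  metric_sym : forall x, (metric x)^T = metric x;
  metric_posdef : forall x v, v != 0 -> 0 < bilin (metric x) v v;
  metric_smooth : forall c, atlas A c -> Coo (cran c) (gram_of A metric c)
}.

Section Riemannian.

Context (R : realType) (n : nat) (M : topologicalType) (A : manifold R n M).
Context (G : riemannian A).

Definition ip (x : M) (u v : 'rV[R]_n) : R := bilin (metric G x) u v.

Definition tnorm (x : M) (u : 'rV[R]_n) : R := Num.sqrt (ip x u u).

Definition gram (c : chart R n M) (z : 'rV[R]_n) : 'M[R]_n :=
  gram_of A (metric G) c z.

(* Components in the chart c of the Riemannian gradient at [cinv c z]. *)
Definition grad_in (c : chart R n M) (f : M -> R) (z : 'rV[R]_n) : 'rV[R]_n :=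
  (\row_i 'D_(basis_vec R i) (f \o cinv c) z) *m invmx (gram c z).

Definition grad (f : M -> R) (x : M) : 'rV[R]_n :=
  grad_in (chart_at A x) f (pcoord A x).

(* Christoffel symbols Gamma^k_{ij} of the Levi-Civita connection. *)
Definition christoffel (c : chart R n M) (z : 'rV[R]_n) (i j k : 'I_n) : R :=
  2^-1 * \sum_(l < n) (invmx (gram c z)) k l *
    ('D_(basis_vec R i) (fun t => gram c t j l) z
     + 'D_(basis_vec R j) (fun t => gram c t i l) z
     - 'D_(basis_vec R l) (fun t => gram c t i j) z).

Definition christoffel_app (c : chart R n M) (z u v : 'rV[R]_n) : 'rV[R]_n :=
  \row_k \sum_(i < n) \sum_(j < n) christoffel c z i j k * u 0 i * v 0 j.

(* Covariant derivative along xi of the vector field with components V in c. *)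
Definition covd (c : chart R n M) (V : 'rV[R]_n -> 'rV[R]_n)
    (z xi : 'rV[R]_n) : 'rV[R]_n :=
  'D_xi V z + christoffel_app c z xi (V z).

Definition hess (f : M -> R) (x : M) (xi : 'rV[R]_n) : 'rV[R]_n :=
  covd (chart_at A x) (grad_in (chart_at A x) f) (pcoord A x) xi.

Definition smooth_curve (gam : R -> M) : Prop :=
  continuous gam /\
  forall c, atlas A c -> forall k t, cdom c (gam t) ->
    derivable (derive1n k (cmap c \o gam)) t 1.

Definition velocity (gam : R -> M) (t : R) : 'rV[R]_n :=
  derive1 (cmap (chart_at A (gam t)) \o gam) t.

Definition acceleration (gam : R -> M) (t : R) : 'rV[R]_n :=
  derive1n 2 (cmap (chart_at A (gam t)) \o gam) t
  + christoffel_app (chart_at A (gam t)) (pcoord A (gam t))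
      (velocity gam t) (velocity gam t).

Definition geodesic (gam : R -> M) : Prop :=
  smooth_curve gam /\ forall t, acceleration gam t = 0.

(* Geodesic completeness. *)
Definition complete_metric : Prop :=
  forall (x : M) (v : 'rV[R]_n), exists gam : R -> M,
    [/\ geodesic gam, gam 0 = x & velocity gam 0 = v].

Definition egrad (x : M) (F : 'rV[R]_n -> R) (xi : 'rV[R]_n) : 'rV[R]_n :=
  (\row_i 'D_(basis_vec R i) F xi) *m invmx (metric G x).

Definition ehess (x : M) (F : 'rV[R]_n -> R) (xi u : 'rV[R]_n) : 'rV[R]_n :=
  'D_u (egrad x F) xi.

Definition opnorm (x : M) (T : 'rV[R]_n -> 'rV[R]_n) : R :=
  sup [set tnorm x (T u) | u in [set u | tnorm x u <= 1]].

End Riemannian.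

(* Smoothness on the tangent bundle is read in the bundle charts
   (z, v) |-> (cinv c z, tvec A c z v), with (z, v) stored as a row of length
   n + n. *)
Definition retr_in (R : realType) (n : nat) (M : topologicalType)
    (A : manifold R n M) (Rt : M -> 'rV[R]_n -> M) (c : chart R n M)
    (u : 'rV[R]_(n + n)) : M :=
  Rt (cinv c (lsubmx u)) (tvec A c (lsubmx u) (rsubmx u)).

Definition retr_dom (R : realType) (n : nat) (M : topologicalType)
    (A : manifold R n M) (Rt : M -> 'rV[R]_n -> M) (c d : chart R n M) :
    set 'rV[R]_(n + n) :=
  [set u | cran c (lsubmx u) /\ cdom d (retr_in A Rt c u)].

Record retraction (R : realType) (n : nat) (M : topologicalType)
    (A : manifold R n M) := Retraction {
  retr :> M -> 'rV[R]_n -> M;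
  retr_smooth : forall c d, atlas A c -> atlas A d ->
    open (retr_dom A retr c d) /\
    Coo (retr_dom A retr c d) (cmap d \o retr_in A retr c);
  retr0 : forall x, retr x 0 = x;
  Dretr0 : forall x v, 'D_v (cmap (chart_at A x) \o retr x) 0 = v
}.

Definition second_order (R : realType) (n : nat) (M : topologicalType)
    (A : manifold R n M) (G : riemannian A) (Rt : retraction A) : Prop :=
  forall (x : M) (xi : 'rV[R]_n),
    acceleration G (fun t : R => Rt x (t *: xi)) 0 = 0.

Definition pullback_hess_lipschitz (R : realType) (n : nat)
    (M : topologicalType) (A : manifold R n M) (G : riemannian A)
    (Rt : retraction A) (theta : M -> R) (xs : M) : Prop :=
  exists L : R, 0 < L /\ exists rho : R, 0 < rho /\
    \forall x \near xs, forall xi : 'rV[R]_n, tnorm G x xi < rho ->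
      opnorm G x (fun u => ehess G x (theta \o Rt x) xi u
                           - ehess G x (theta \o Rt x) 0 u)
      <= L * tnorm G x xi.

(* Minimize [obj] subject to [ineq i >= 0] and [eqc j = 0]. *)
Record nlp (R : realType) (M : topologicalType) (m p : nat) := Nlp {
  obj : M -> R;
  ineq : 'I_m -> M -> R;
  eqc : 'I_p -> M -> R
}.

Definition C2_nlp (R : realType) (n m p : nat) (M : topologicalType)
    (A : manifold R n M) (P : nlp R M m p) : Prop :=
  [/\ CkM A 2 (obj P), forall i, CkM A 2 (ineq P i)
    & forall j, CkM A 2 (eqc P j)].

(* Triples w = (x, y, z), and increments (d_x, d_y, d_z) with d_x tangent. *)
Definition pdpoint (R : realType) (M : topologicalType) (m p : nat) :=
  (M * 'rV[R]_m * 'rV[R]_p)%type.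

Definition incr (R : realType) (n m p : nat) :=
  ('rV[R]_n * 'rV[R]_m * 'rV[R]_p)%type.

Section Problem.

Context (R : realType) (n m p : nat) (M : topologicalType).
Context (A : manifold R n M) (G : riemannian A) (P : nlp R M m p).

Definition lagrangian (y : 'rV[R]_m) (z : 'rV[R]_p) (x : M) : R :=
  obj P x - \sum_(i < m) y 0 i * ineq P i x + \sum_(j < p) z 0 j * eqc P j x.

Definition grad_lag (w : pdpoint R M m p) : 'rV[R]_n :=
  let: (x, y, z) := w in grad G (lagrangian y z) x.

Definition hess_lag (w : pdpoint R M m p) (xi : 'rV[R]_n) : 'rV[R]_n :=
  let: (x, y, z) := w in hess G (lagrangian y z) x xi.

Definition KKT_map (mu : R) (w : pdpoint R M m p) : incr R n m p :=
  let: (x, y, z) := w in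
  (grad_lag w, \row_i (ineq P i x * y 0 i - mu), \row_j eqc P j x).

Definition KKT (w : pdpoint R M m p) : Prop :=
  let: (x, y, z) := w in
  [/\ KKT_map 0 w = 0, forall i, 0 <= ineq P i x & forall i, 0 <= y 0 i].

Definition active (x : M) : {set 'I_m} := [set i | ineq P i x == 0].

Definition strict_complementarity (w : pdpoint R M m p) : Prop :=
  let: (x, y, z) := w in
  forall i : 'I_m, (y 0 i == 0) (+) (ineq P i x == 0).

Definition LICQ (x : M) : Prop :=
  free ([seq grad G (ineq P i) x | i in active x]
        ++ [seq grad G (eqc P j) x | j : 'I_p]).

Definition SOSC (w : pdpoint R M m p) : Prop :=
  let: (x, y, z) := w in
  forall xi : 'rV[R]_n, xi != 0 ->
    (forall i, i \in active x -> 0 < y 0 i ->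
       ip G x (grad G (ineq P i) x) xi = 0) ->
    (forall i, i \in active x -> y 0 i = 0 ->
       0 <= ip G x (grad G (ineq P i) x) xi) ->
    (forall j, ip G x (grad G (eqc P j) x) xi = 0) ->
    0 < ip G x (hess_lag w xi) xi.

Definition jacF (w : pdpoint R M m p) (d : incr R n m p) : incr R n m p :=
  let: (x, y, z) := w in
  let: (dx, dy, dz) := d in
  (hess_lag w dx - \sum_(i < m) dy 0 i *: grad G (ineq P i) x
     + \sum_(j < p) dz 0 j *: grad G (eqc P j) x,
   \row_i (y 0 i * ip G x (grad G (ineq P i) x) dx + ineq P i x * dy 0 i),
   \row_j ip G x (grad G (eqc P j) x) dx).

Definition stopping (phiL phic phie : R -> R) (mu : R) (w : pdpoint R M m p) :
    Prop :=
  let: (x, y, z) := w in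
  [/\ tnorm G x (grad_lag w) <= phiL mu,
      enorm (\row_i (ineq P i x * y 0 i - mu)) <= phic mu,
      enorm (\row_j eqc P j x) <= phie mu,
      forall i, 0 < ineq P i x & forall i, 0 < y 0 i].

Definition step (Rt : retraction A) (w : pdpoint R M m p) (d : incr R n m p) :
    pdpoint R M m p :=
  let: (x, y, z) := w in
  let: (dx, dy, dz) := d in (Rt x dx, y + dy, z + dz).

(* w is a sequence of iterates generated with barrier parameters
   mu_0, mu_1, ...: the inner solver is only constrained by the stopping
   conditions, except that it returns its starting point w_{k+1}^init whenever
   that point is defined and already meets them ([stopping] contains strict
   feasibility and y > 0). *)
Definition generated (Rt : retraction A) (phiL phic phie : R -> R)
    (mu : nat -> R) (w : nat -> pdpoint R M m p) : Prop :=
  forall k : nat,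
    stopping phiL phic phie (mu k) (w k.+1) /\
    forall d : incr R n m p,
      bijective (jacF (w k)) -> jacF (w k) d = - KKT_map (mu k) (w k) ->
      stopping phiL phic phie (mu k) (step Rt (w k) d) ->
      w k.+1 = step Rt (w k) d.

End Problem.

Definition forcing (R : realType) (phi : R -> R) : Prop :=
  [/\ {within `[0, +oo[, continuous phi},
      forall t, 0 <= t -> 0 <= phi t &
      forall t, 0 <= t -> (phi t = 0 <-> t = 0)].

Definition chart_dist (R : realType) (n m p : nat) (M : topologicalType)
    (c : chart R n M) (w w' : pdpoint R M m p) : R :=
  let: (x, y, z) := w in
  let: (x', y', z') := w' in
  Num.sqrt (enorm (cmap c x - cmap c x') ^+ 2 + enorm (y - y') ^+ 2
            + enorm (z - z') ^+ 2).

Definition forcing_comparable (R : realType) (phi : R -> R) (mu : nat -> R) :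
    Prop :=
  exists kl ku : R, [/\ 0 < kl < 1, 1 < ku &
    forall k, kl * mu k <= phi (mu k) <= ku * mu k].

(* In the library a / 0 = 0: the first clause keeps a zero
   denominator from making the ratio small. *)
Definition superlinear (R : realType) (n m p : nat) (M : topologicalType)
    (A : manifold R n M) (w : nat -> pdpoint R M m p) (ws : pdpoint R M m p) :
    Prop :=
  forall c, atlas A c -> cdom c ws.1.1 ->
    (\forall k \near \oo, chart_dist c (w k) ws = 0 ->
                          chart_dist c (w k.+1) ws = 0) /\
    (chart_dist c (w k.+1) ws / chart_dist c (w k) ws) @[k --> \oo] --> 0.

Definition order_at_least (R : realType) (n m p : nat) (M : topologicalType)
    (A : manifold R n M) (q : R) (w : nat -> pdpoint R M m p)
    (ws : pdpoint R M m p) : Prop :=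
  forall c, atlas A c -> cdom c ws.1.1 ->
    exists (C : R) (K : nat), 0 <= C /\ forall k, (K <= k)%N ->
      chart_dist c (w k.+1) ws <= C * chart_dist c (w k) ws `^ q.

(* Main.v *)
(* Fix the chart at x*.  As R is second order, Hess theta(x) is the Hessian at 0
   of theta o R_x, so a Newton step d is a Newton step for the functions
   theta o R_x on the tangent space, and by (A6) it leaves a residual
   |F(w^init; mu)| <= C |d|^2.  The Jacobian is injective at w* (SOSC, LICQ, strict
   complementarity), hence bounded below nearby, and |F(w)| is equivalent to
   the distance e from w to w*.  The stopping conditions and (A2) give
   e_k + |d| = O(mu_{k-1}), so the residual is O(mu_{k-1}^2) = o(mu_k) by (A3): the
   point w^init meets the stopping conditions and is the next iterate.  Then
   e_{k+1} <= C (e_k^2 + mu_k) and mu_k <= C e_{k+1}; with mu_k <= eps_k mu_{k-1}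
   this is the superlinear rate, with mu_k = c mu_{k-1}^(1+r) the order 1+r. *)
Require Import Defs.
From HB Require Import structures.
From mathcomp Require Import all_boot all_order all_algebra.
From mathcomp Require Import all_classical all_reals all_analysis.
From mathcomp Require Import ring lra.

Import Order.TTheory GRing.Theory Num.Theory.
Import numFieldNormedType.Exports.

Set Implicit Arguments.
Unset Strict Implicit.
Unset Printing Implicit Defensive.

Local Open Scope classical_set_scope.
Local Open Scope ring_scope.

(** * Calculus in normed spaces *)

(** The objective and the constraints are only twice continuously differentiable, so a quadratic
    remainder has to come from (A6), which compares second derivatives of one pullback at ξ and at
    0, on one tangent space. The Newton system is therefore written with the second derivative [Hf]
    of the pullback at 0, and not with the derivative of the chart expression of the KKT map; the
    two agree at the solution, and only there is the KKT map itself expanded.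

    Pullbacks give the derivative of the Lagrangian at the new point along the images of vectors v
    under the derivative of the retraction, not along v. That derivative is within 1/2 of the
    identity, so the passage to all v costs a factor 2.

    As [chart_at] is an arbitrary choice in x, nothing stored in it is continuous in x; continuity
    is obtained in a fixed chart around x*, and for norms through the Gram matrix.

    The iterates stay in a ball around the solution without any contraction argument: error and step
    are both bounded by a multiple of the previous barrier parameter, and those parameters stay
    below a threshold. *)

Section NormedCalculus.
Context (R : realType) (V W : normedModType R).
Implicit Types (f g : V -> W).

(** The ε-form, with any continuous linear map in the place of the differential, can be checked on
    nearby points only. It lets differentiability pass between functions that agree near x, as
    expressions in different charts do. *)
Lemma differentiable_epsP f x :
  differentiable f x <-> exists L : {linear V -> W}, continuous L /\
    forall e : R, 0 < e -> \forall y \near x,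
      `|f y - f x - L (y - x)| <= e * `|y - x|.
Proof.
split=> [df|[L [Lc HL]]].
  exists ('d f x : {linear V -> W}); split; first exact: diff_continuous.
  move=> e e0; have /diff_locallyP[_ H] := df.
  move/eqaddoP : H => /(_ e e0) H2.
  have T : (y - x) @[y --> x] --> (0 : V).
    by rewrite -[X in _ --> X](subrr x); apply: cvgB; [exact: cvg_id|exact: cvg_cst].
  have H3 : \forall y \near x, `|(f \o shift x - (cst (f x) + 'd f x)) (y - x)|
      <= e * `|y - x| by exact: (T _ H2).
  by apply: filterS H3 => y; rewrite !fctE /= subrK opprD addrA.
suff E : f \o shift x = cst (f x) + L +o_ (0 : V) id.
  have := diff_unique Lc E => E2.
  by apply/diff_locallyP; rewrite E2; split.
apply/eqaddoP => e e0; have := HL e e0.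
move=> H2.
have T : (h + x) @[h --> (0 : V)] --> x.
  by rewrite -[X in _ --> X](add0r x); apply: cvgD; [exact: cvg_id|exact: cvg_cst].
have H3 : \forall h \near (0 : V), `|f (h + x) - f x - L (h + x - x)|
    <= e * `|h + x - x| by exact: (T _ H2).
by apply: filterS H3 => h; rewrite !fctE /= addrK opprD addrA.
Qed.

Lemma near_eq_differentiable f g x :
  (\forall y \near x, f y = g y) -> differentiable f x -> differentiable g x.
Proof.
move=> fg /differentiable_epsP[L [Lc HL]]; apply/differentiable_epsP.
exists L; split=> // e e0.
have fgx := nbhs_singleton fg.
by apply: filterS2 (HL e e0) fg => y; rewrite fgx => + fgy; rewrite fgy.
Qed.

Lemma differentiable_lipschitz_at f x : differentiable f x ->
  exists K : R, 0 < K /\ \forall y \near x, `|f y - f x| <= K * `|y - x|.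
Proof.
move=> /differentiable_epsP[L [Lc HL]].
have [k k0 Hk] := linear_lipschitz Lc.
exists (k + 1); split; first by rewrite addr_gt0.
apply: filterS (HL 1 ltr01) => y Hy.
rewrite -[f y - f x](subrK (L (y - x))) (le_trans (ler_normD _ _))//.
by rewrite mulrDl addrC lerD// Hk.
Qed.

Lemma derivable_diff_linear f x u v a : differentiable f x ->
  'D_(a *: u + v) f x = a *: 'D_u f x + 'D_v f x.
Proof. by move=> df; rewrite !deriveE// linearP. Qed.

Lemma derive_scale f x u a : differentiable f x -> 'D_(a *: u) f x = a *: 'D_u f x.
Proof. by move=> df; rewrite !deriveE// linearZ. Qed.

(** The two difference quotients are equal as functions of the increment, so both sides are the same
    limit. *)
Lemma derive_line f (x u : V) (t : R) :
  'D_1 (fun s : R => f (x + s *: u)) t = 'D_u f (x + t *: u).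
Proof.
rewrite /derive.
set F := (X in lim (X @ _)); set G := (X in _ = lim (X @ _)).
suff -> : F = G by [].
apply/funext => h /=; rewrite /F /G /=.
by rewrite [h%:A]mulr1 scalerDl addrCA.
Qed.

Lemma derivable_line f (x u : V) (t : R) :
  derivable f (x + t *: u) u -> derivable (fun s : R => f (x + s *: u)) t 1.
Proof.
rewrite /derivable.
set F := (X in cvg (X @ _)); set G := (X in _ -> cvg (X @ _)).
suff -> : F = G by [].
apply/funext => h /=; rewrite /F /G /=.
by rewrite [h%:A]mulr1 scalerDl addrCA.
Qed.

End NormedCalculus.

Section Sums.
Context (R : realType) (V W : normedModType R) (I : finType).
Implicit Types (f : I -> V -> W).

Lemma sum_fctE (T : Type) (U : zmodType) (P : pred I) (f : I -> T -> U) :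
  (fun x => \sum_(i | P i) f i x) = \sum_(i | P i) f i.
Proof. by apply/funext => x; rewrite fct_sumE. Qed.

Lemma differentiable_fsum f x : (forall i, differentiable (f i) x) ->
  differentiable (fun y => \sum_i f i y) x.
Proof.
move=> df; rewrite sum_fctE.
elim/big_ind: _ => [||i _]; [|move=> *; exact: differentiableD|exact: df].
exact: (@differentiable_cst _ _ _ (0 : W)).
Qed.

Lemma derive_fsum f x v : (forall i, derivable (f i) x v) ->
  'D_v (fun y => \sum_i f i y) x = \sum_i 'D_v (f i) x.
Proof.
move=> df; rewrite sum_fctE.
suff : is_derive x v (\sum_i f i) (\sum_i 'D_v (f i) x) by move=> H; exact: derive_val.
elim/big_ind2: _ => [||i _]; [|move=> *; exact: is_deriveD|exact: derivableP].
exact: (@is_derive_cst _ _ _ (0 : W)).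
Qed.

End Sums.

Section Rows.
Context (R : realType).

Lemma row_basis n (v : 'rV[R]_n) : v = \sum_i v 0 i *: basis_vec R i.
Proof. exact: row_sum_delta. Qed.

Lemma norm_coord_le n (v : 'rV[R]_n) i : `|v 0 i| <= `|v|.
Proof.
rewrite [leRHS]/Num.Def.normr/= mx_normrE.
exact: (le_bigmax _ (fun ij => `|v ij.1 ij.2|) (0, i)).
Qed.

Lemma norm_row_le n (v : 'rV[R]_n) (B : R) : 0 <= B ->
  (forall i, `|v 0 i| <= B) -> `|v| <= B.
Proof.
move=> B0 H; rewrite [leLHS]/Num.Def.normr/= mx_normrE; apply: bigmax_le => //=.
by move=> [i j] _ /=; rewrite ord1.
Qed.

Lemma norm_row_lt n (v : 'rV[R]_n) (B : R) : 0 < B ->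
  (forall i, `|v 0 i| < B) -> `|v| < B.
Proof.
move=> B0 H; rewrite [ltLHS]/Num.Def.normr/= mx_normrE; apply: bigmax_lt => //=.
by move=> [i j] _ /=; rewrite ord1.
Qed.

Lemma norm_basis_vec n (i : 'I_n) : `|basis_vec R i| <= 1.
Proof.
apply: norm_row_le => // j; rewrite mxE eqxx /=.
by case: (j == i); rewrite ?normr1 ?normr0.
Qed.

Lemma linear_row_bounded n (W : normedModType R) (f : 'rV[R]_n -> W) (v : 'rV[R]_n) :
  linear f -> `|f v| <= (\sum_i `|f (basis_vec R i)|) * `|v|.
Proof.
move=> lf; pose fM := GRing.isLinear.Build _ _ _ _ _ lf.
pose fL : {linear _ -> _} := HB.pack f fM.
have -> : f = fL by [].
rewrite {1}[v]row_basis linear_sum mulr_suml (le_trans (ler_norm_sum _ _ _))//.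
apply: ler_sum => i _; rewrite linearZ normrZ mulrC ler_wpM2l//.
exact: norm_coord_le.
Qed.

Lemma linear_row_continuous n (W : normedModType R) (f : {linear 'rV[R]_n -> W}) :
  continuous f.
Proof.
apply/linear_bounded_continuous/ex_bound.
exists (\sum_i `|f (basis_vec R i)|); near=> v.
rewrite /= (le_trans (linear_row_bounded v (linearP f)))//.
rewrite ler_piMr//; first by apply: sumr_ge0.
Unshelve. all: by end_near. Qed.

Lemma derive_row_basis n (W : normedModType R) (f : 'rV[R]_n -> W) x v :
  differentiable f x -> 'D_v f x = \sum_i v 0 i *: 'D_(basis_vec R i) f x.
Proof.
move=> df; rewrite deriveE// {1}[v]row_basis linear_sum; apply: eq_bigr => i _.
by rewrite linearZ/= deriveE.
Qed.

Lemma derive_coord n (V : normedModType R) (f : V -> 'rV[R]_n) x v i :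
  derivable f x v -> 'D_v (fun y => f y 0 i) x = ('D_v f x) 0 i.
Proof. by move=> df; rewrite derive_mx// mxE. Qed.

Lemma differentiable_rowE n (V : normedModType R) (f : V -> 'rV[R]_n) x i :
  differentiable f x -> differentiable (fun y => f y 0 i) x.
Proof.
move=> df; apply: (@differentiable_comp _ _ _ _ f (fun v : 'rV_n => v 0 i)) => //.
exact: differentiable_coord.
Qed.

Lemma norm_row_mx n m (u : 'rV[R]_n) (v : 'rV[R]_m) (B : R) :
  0 < B -> `|u| < B -> `|v| < B -> `|row_mx u v| < B.
Proof.
move=> B0 uB vB; apply: norm_row_lt => // i; rewrite mxE.
case: (fintype.split i) => j.
  exact: le_lt_trans (norm_coord_le _ _) uB.
exact: le_lt_trans (norm_coord_le _ _) vB.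
Qed.

Lemma derive_comp n (V : normedModType R) (W : normedModType R) (f : 'rV[R]_n -> W)
    (g : V -> 'rV[R]_n) x v :
  differentiable g x -> differentiable f (g x) ->
  'D_v (f \o g) x = 'D_('D_v g x) f (g x).
Proof.
move=> dg df; rewrite !deriveE//; last exact: differentiable_comp.
by rewrite diff_comp.
Qed.

Lemma mean_value_line (V : normedModType R) (f : V -> R) x u :
  (forall t : R, 0 <= t <= 1 -> differentiable f (x + t *: u)) ->
  exists2 t : R, 0 < t < 1 & f (x + u) - f x = 'D_u f (x + t *: u).
Proof.
move=> df; pose g (s : R) := f (x + s *: u).
have dg (s : R) : 0 <= s <= 1 -> derivable g s 1.
  by move=> s01; apply: derivable_line; apply: diff_derivable; exact: df.
have [||t] := @MVT _ g (fun s => 'D_1 g s) 0 1 ltr01.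
- move=> s; rewrite in_itv/= => /andP[s0 s1]; apply: derivableP.
  by apply: dg; rewrite !ltW.
- apply: derivable_within_continuous => s; rewrite in_itv/= => s01; exact: dg.
rewrite in_itv/= => t01; rewrite subr0 mulr1 /g scale1r scale0r addr0 derive_line.
by exists t.
Qed.

End Rows.

Lemma near_eq_continuous (T U : topologicalType) (f g : T -> U) (x : T) :
  (\forall y \near x, f y = g y) -> {for x, continuous f} -> {for x, continuous g}.
Proof.
move=> fg fc; rewrite /prop_for /continuous_at -(nbhs_singleton fg).
apply: cvg_trans fc; apply: near_eq_cvg.
by apply: filterS fg => y ->.
Qed.

Lemma continuous_fsum (R : realType) (T : topologicalType) (W : normedModType R)
    (I : finType) (f : I -> T -> W) x :
  (forall i, {for x, continuous (f i)}) -> {for x, continuous (fun y => \sum_i f i y)}.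
Proof.
move=> H; rewrite sum_fctE; elim/big_ind: _ => [|g h cg ch|i _]; last exact: H.
  exact: (@cst_continuous _ _ (0 : W)).
exact: continuousD.
Qed.

Lemma addrBK3 (V : zmodType) (x a b : V) : x + a + b - x = a + b.
Proof. by rewrite addrC !addrA addNr add0r. Qed.

Section NearBall.
Context (R : realType) (V : normedModType R).

Lemma near_ball (x : V) (P : V -> Prop) : (\forall y \near x, P y) ->
  exists d : R, 0 < d /\ forall y, `|y - x| < d -> P y.
Proof.
move=> /nbhs_ballP[d /= d0 H]; exists d; split=> // y yd; apply: H.
by rewrite -ball_normE /= distrC.
Qed.

Lemma ball_near (x : V) (d : R) (P : V -> Prop) : 0 < d ->
  (forall y, `|y - x| < d -> P y) -> \forall y \near x, P y.
Proof.
move=> d0 H; apply/nbhs_ballP; exists d => //= y; rewrite -ball_normE /= distrC => yd.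
exact: H.
Qed.

End NearBall.

Lemma dist_half (R : realType) (a b c e : R) :
  `|a - c| <= e / 2 -> `|b - c| <= e / 2 -> `|a - b| <= e.
Proof.
move=> ac bc; rewrite (le_trans (ler_distD c _ _))// [leRHS]splitr lerD//.
by rewrite distrC.
Qed.

(** A second difference does not depend on the order of its two increments. [a] and [a'] are the
    value at the opposite corner, reached by the two orders of addition. *)
Lemma second_difference_swap (R : realType) (a a' b c d K1 K2 : R) : a' = a ->
  a - b - (c - d) = K1 -> a' - c - (b - d) = K2 -> K1 = K2.
Proof. by move=> -> <- <-; ring. Qed.

(** * Twice continuously differentiable maps: chain rule and symmetry *)

Section C2.
Context (R : realType).

(** Arbitrary directions, where [Ck] has basis vectors only: the chain rule produces directions such
    as ['D_v g x]. *)
Definition C2on n (W : normedModType R) (U : set 'rV[R]_n) (f : 'rV[R]_n -> W) : Prop :=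
  [/\ forall x, U x -> differentiable f x,
      forall v x, U x -> differentiable ('D_v f) x &
      forall u v x, U x -> {for x, continuous ('D_u ('D_v f))}].

Lemma near_open (T : topologicalType) (U : set T) (P : T -> Prop) x :
  open U -> U x -> (forall y, U y -> P y) -> \forall y \near x, P y.
Proof. by move=> oU Ux H; apply: filterS H _; exact: open_nbhs_nbhs. Qed.

(** On the open set U every directional derivative is a fixed linear combination of partial
    derivatives, and this identity, valid near each point, can be differentiated again. *)
Lemma Ck2_C2on n (W : normedModType R) (U : set 'rV[R]_n) (f : 'rV[R]_n -> W) :
  open U -> Ck 2 U f -> C2on U f.
Proof.
move=> oU [df H].
have d2 i x : U x -> differentiable ('D_(basis_vec R i) f) x by have [h _] := H i; exact: h.
have Dv (v : 'rV[R]_n) x : U x -> \sum_i v 0 i *: 'D_(basis_vec R i) f x = 'D_v f x.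
  by move=> Ux; rewrite (derive_row_basis v) //; exact: df.
have dD (v : 'rV[R]_n) x : U x -> differentiable ('D_v f) x.
  move=> Ux; apply: near_eq_differentiable (near_open oU Ux (Dv v)) _.
  by apply: differentiable_fsum => i; apply: differentiableZ; exact: d2.
split=> // u v x Ux.
have E y : U y -> \sum_i v 0 i *: (\sum_j u 0 j *:
    'D_(basis_vec R j) ('D_(basis_vec R i) f) y) = 'D_u ('D_v f) y.
  move=> Uy; rewrite -(near_eq_derive _ (near_open oU Uy (Dv v))) derive_fsum; last first.
    by move=> i; apply: derivableZ; apply: diff_derivable; exact: d2.
  apply: eq_bigr => i _; rewrite deriveZ; last by apply: diff_derivable; exact: d2.
  by congr (_ *: _); rewrite (derive_row_basis u)//; exact: d2.
apply: near_eq_continuous (near_open oU Ux E) _.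
apply: continuous_fsum => i; apply: continuousZr; apply: continuous_fsum => j.
apply: continuousZr; have [_ h] := H i; exact: h.
Qed.

Lemma derive2_bilinear n (W : normedModType R) (U : set 'rV[R]_n) (f : 'rV[R]_n -> W) x u v :
  open U -> C2on U f -> U x -> 'D_u ('D_v f) x =
  \sum_i v 0 i *: 'D_u ('D_(basis_vec R i) f) x.
Proof.
move=> oU [df d2 _] Ux.
have Dv y : U y -> \sum_i v 0 i *: 'D_(basis_vec R i) f y = 'D_v f y.
  by move=> Uy; rewrite (derive_row_basis v) //; exact: df.
rewrite -(near_eq_derive _ (near_open oU Ux Dv)) derive_fsum; last first.
  by move=> i; apply: derivableZ; apply: diff_derivable; exact: d2.
by apply: eq_bigr => i _; rewrite deriveZ//; apply: diff_derivable; exact: d2.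
Qed.

Section Comp2.
Context (k n : nat) (U : set 'rV[R]_k) (U' : set 'rV[R]_n).
Context (g : 'rV[R]_k -> 'rV[R]_n) (f : 'rV[R]_n -> R).
Hypotheses (oU : open U) (oU' : open U') (Cg : C2on U g) (Cf : C2on U' f).
Hypothesis gU : forall x, U x -> U' (g x).

Lemma differentiable_comp2 x : U x -> differentiable (f \o g) x.
Proof.
move=> Ux; have [dg _ _] := Cg; have [df _ _] := Cf.
by apply: differentiable_comp; [exact: dg|exact/df/gU].
Qed.

Let DvE v x : U x -> \sum_i ('D_v g x) 0 i * 'D_(basis_vec R i) f (g x) = 'D_v (f \o g) x.
Proof.
move=> Ux; have [dg _ _] := Cg; have [df _ _] := Cf.
rewrite (@derive_comp _ _ _ _ _ g); try exact: dg; try exact/df/gU.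
by rewrite (derive_row_basis ('D_v g x))//; exact/df/gU.
Qed.

Let dterm v x i : U x ->
  differentiable (fun y => ('D_v g y) 0 i * 'D_(basis_vec R i) f (g y)) x.
Proof.
move=> Ux; have [dg d2g _] := Cg; have [df d2f _] := Cf.
apply: (@differentiableM _ _ (fun y => ('D_v g y) 0 i) ('D_(basis_vec R i) f \o g)).
  by apply: (differentiable_rowE (f := 'D_v g)); exact: d2g.
by apply: differentiable_comp; [exact: dg|exact/d2f/gU].
Qed.

Lemma differentiable_derive_comp v x : U x -> differentiable ('D_v (f \o g)) x.
Proof.
move=> Ux; apply: near_eq_differentiable (near_open oU Ux (DvE v)) _.
by apply: differentiable_fsum => i; exact: dterm.
Qed.

(** Product rule on the sum over i of the i-th entry of ['D_v g] times the i-th partial derivative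
    of f at g. The second term, which carries the curvature of g, is the one that a second-order
    retraction matches with the Christoffel symbols. *)
Lemma derive2_comp u v x : U x -> 'D_u ('D_v (f \o g)) x =
  'D_('D_u g x) ('D_('D_v g x) f) (g x) + 'D_('D_u ('D_v g) x) f (g x).
Proof.
move=> Ux; have [dg d2g _] := Cg; have [df d2f _] := Cf.
have Ugx := gU Ux.
rewrite -(near_eq_derive _ (near_open oU Ux (DvE v))) derive_fsum; last first.
  by move=> i; apply: diff_derivable; exact: dterm.
rewrite (derive2_bilinear _ _ oU' Cf Ugx).
rewrite (derive_row_basis ('D_u ('D_v g) x)); last exact: df.
rewrite -big_split; apply: eq_bigr => i _ /=.
have dgi : derivable (fun y => ('D_v g y) 0 i) x u.
  by apply: diff_derivable; apply: (differentiable_rowE (f := 'D_v g)); exact: d2g.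
have dfi : derivable ('D_(basis_vec R i) f \o g) x u.
  by apply: diff_derivable; apply: differentiable_comp; [exact: dg|exact/d2f/gU].
rewrite (deriveM dgi dfi).
rewrite (@derive_comp _ _ _ _ _ g); try exact: dg; try exact/d2f/gU.
rewrite (derive_coord (f := 'D_v g)); last by apply: diff_derivable; exact: d2g.
by congr (_ + _); exact: mulrC.
Qed.

End Comp2.

Lemma mixed_mean_value n (f : 'rV[R]_n -> R) x u v (h d : R) :
  0 < h -> h * (`|u| + `|v|) < d ->
  (forall y, `|y - x| < d -> differentiable f y /\ differentiable ('D_u f) y) ->
  exists2 q, `|q - x| < d &
    f (x + h *: u + h *: v) - f (x + h *: u) - (f (x + h *: v) - f x)
      = h ^+ 2 * 'D_v ('D_u f) q.
Proof.
move=> h0 hd H.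
have inball (s t : R) : 0 <= s <= 1 -> 0 <= t <= 1 ->
    `|x + (s * h) *: u + (t * h) *: v - x| < d.
  move=> /andP[s0 s1] /andP[t0 t1]; rewrite addrBK3.
  apply: le_lt_trans hd; rewrite (le_trans (ler_normD _ _))// !normrZ mulrDr.
  by rewrite !ger0_norm// ?(ltW h0)// lerD// ler_wpM2r// ler_piMl// ltW.
have z01 : 0 <= (0 : R) <= 1 by apply/andP; split; [exact: lexx|exact: ler01].
have o01 : 0 <= (1 : R) <= 1 by apply/andP; split; [exact: ler01|exact: lexx].
(* The second difference is an increment of [k] along [h *: u]; a second mean value theorem then
   acts on ['D_u f] along [h *: v]. *)
pose k y := f (y + h *: v) - f y.
have dsh y : `|y + h *: v - x| < d -> differentiable (fun y => f (y + h *: v)) y.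
  move=> yd; apply: (@differentiable_comp _ _ _ _ (fun y => y + h *: v) f); last first.
    by have [] := H _ yd.
  by apply: differentiableD.
have dshE w y : `|y + h *: v - x| < d ->
    'D_w (fun y => f (y + h *: v)) y = 'D_w f (y + h *: v).
  move=> yd; rewrite /derive.
  set F := (X in lim (X @ _)); set G := (X in _ = lim (X @ _)).
  suff -> : F = G by [].
  by apply/funext => s /=; rewrite /F /G /= addrA.
have dk (t : R) : 0 <= t <= 1 -> differentiable k (x + t *: (h *: u)).
  move=> t01; rewrite scalerA; apply: differentiableB.
    by apply: dsh; have := inball t 1 t01 o01; rewrite mul1r.
  by have := inball t 0 t01 z01; rewrite mul0r scale0r addr0 => /H[].
have [t t01 Et] := mean_value_line dk.
have t01' : 0 <= t <= 1 by case/andP: t01 => ? ?; rewrite !ltW.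
have bt1 : `|x + (t * h) *: u + h *: v - x| < d by have := inball t 1 t01' o01; rewrite mul1r.
have bt0 : `|x + (t * h) *: u - x| < d.
  by have := inball t 0 t01' z01; rewrite mul0r scale0r addr0.
have dl (s : R) : 0 <= s <= 1 ->
    differentiable ('D_u f) (x + (t * h) *: u + s *: (h *: v)).
  by move=> s01; rewrite scalerA; have /H[] := inball t s t01' s01.
have [s s01 Es] := mean_value_line dl.
have s01' : 0 <= s <= 1 by case/andP: s01 => ? ?; rewrite !ltW.
exists (x + (t * h) *: u + (s * h) *: v); first exact: inball.
transitivity (k (x + h *: u) - k x); first by [].
rewrite Et scalerA deriveB; last first.
- by apply: diff_derivable; have [] := H _ bt0.
- by apply: diff_derivable; exact: dsh.
have [df0 _] := H _ bt0; have [df1 _] := H _ bt1.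
rewrite dshE// (derive_scale _ _ df1) (derive_scale _ _ df0) -scalerBr Es scalerA.
have [_ d2] := H _ (inball t s t01' s01').
by rewrite derive_scale// scalerA.
Qed.

(** Schwarz's theorem: one second difference is the square of h times each of the two mixed
    derivatives, taken at points close to x, and both are continuous at x. *)
Lemma derive2_sym n (U : set 'rV[R]_n) (f : 'rV[R]_n -> R) x u v :
  open U -> C2on U f -> U x -> 'D_u ('D_v f) x = 'D_v ('D_u f) x.
Proof.
move=> oU [df d2 c2] Ux; apply/eqP; rewrite -subr_eq0 -normr_le0.
apply/ler_addgt0Pr => e e0; rewrite add0r.
have e20 : 0 < e / 2 by rewrite divr_gt0.
have /cvgrPdist_le/(_ _ e20) C1 := c2 u v x Ux.
have /cvgrPdist_le/(_ _ e20) C2 := c2 v u x Ux.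
have oUx : \forall y \near x, U y by exact: open_nbhs_nbhs.
have /near_ball[d [d0 Hd]] : \forall y \near x, U y /\
    (`|'D_u ('D_v f) x - 'D_u ('D_v f) y| <= e / 2 /\
     `|'D_v ('D_u f) x - 'D_v ('D_u f) y| <= e / 2).
  by apply: filterI oUx _; exact: filterI C1 C2.
(* Small enough for the parallelogram with sides [h *: u] and [h *: v] at x to lie in the ball; the
   summand 1 covers u = v = 0. *)
pose h := d / 2 / (`|u| + `|v| + 1).
have n0 : 0 < `|u| + `|v| + 1 by rewrite ltr_wpDl// addr_ge0.
have h0 : 0 < h by rewrite !divr_gt0.
have hd : h * (`|u| + `|v|) < d.
  rewrite /h mulrAC ltr_pdivrMr//; have := addr_ge0 (normr_ge0 u) (normr_ge0 v); nra.
have hd' : h * (`|v| + `|u|) < d by rewrite [`|v| + _]addrC.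
have Hd' y : `|y - x| < d -> [/\ U y, `|'D_u ('D_v f) x - 'D_u ('D_v f) y| <= e / 2 &
   `|'D_v ('D_u f) x - 'D_v ('D_u f) y| <= e / 2].
  by move=> yd; have [//|? []] := Hd y; split.
have reg w y : `|y - x| < d -> differentiable f y /\ differentiable ('D_w f) y.
  by move=> /Hd'[Uy _ _]; split; [exact: df|exact: d2].
have [q1 /Hd'[_ _ q1e] E1] := mixed_mean_value h0 hd (reg u).
have [q2 /Hd'[_ q2e _] E2] := mixed_mean_value h0 hd' (reg v).
have E : 'D_v ('D_u f) q1 = 'D_u ('D_v f) q2.
  apply: (@mulfI _ (h ^+ 2)); first by rewrite expf_neq0// gt_eqF.
  apply: second_difference_swap E1 E2.
  by congr (f _); exact: addrAC.
rewrite E in q1e.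
exact: dist_half q2e q1e.
Qed.

End C2.

(** * Charts and metric *)

Lemma basis_vecE (R : realType) n (i j : 'I_n) : basis_vec R i 0 j = (j == i)%:R.
Proof. by rewrite mxE eqxx. Qed.

Section Bilin.
Context (R : realType) (n : nat).
Implicit Types (B : 'M[R]_n) (u v w : 'rV[R]_n).

Lemma bilin_sumE B u v : bilin B u v = \sum_l (\sum_k u 0 k * B k l) * v 0 l.
Proof.
rewrite /bilin mxE; apply: eq_bigr => l _; rewrite !mxE; congr (_ * _).
Qed.

Lemma bilinPl B a u u' v : bilin B (a *: u + u') v = a * bilin B u v + bilin B u' v.
Proof. by rewrite /bilin !mulmxDl -!scalemxAl !mxE. Qed.

Lemma bilinPr B a u v v' : bilin B u (a *: v + v') = a * bilin B u v + bilin B u v'.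
Proof. by rewrite /bilin linearP mulmxDr -scalemxAr !mxE. Qed.

Lemma bilin0l B v : bilin B 0 v = 0.
Proof. by rewrite /bilin !mul0mx mxE. Qed.

Lemma bilin0r B v : bilin B v 0 = 0.
Proof. by rewrite /bilin trmx0 mulmx0 mxE. Qed.

Lemma bilinC B u v : B^T = B -> bilin B u v = bilin B v u.
Proof.
move=> sB; rewrite /bilin -[in LHS](trmxK (u *m B *m v^T)) [LHS]mxE.
by rewrite trmx_mul trmxK trmx_mul sB mulmxA.
Qed.

Lemma posdef_unitmx B : (forall v, v != 0 -> 0 < bilin B v v) -> B \in unitmx.
Proof.
move=> pB; rewrite -row_free_unit; apply/row_freeP.
have kB : kermx B = 0.
  apply/eqP/rowV0P => v /sub_kermxP vB; apply/eqP; apply: contraT => /pB.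
  by rewrite /bilin vB mul0mx mxE ltxx.
by apply/row_freeP; rewrite -kermx_eq0 kB.
Qed.

Lemma bilin_inv B u v : B \in unitmx -> bilin B (u *m invmx B) v = \sum_i u 0 i * v 0 i.
Proof.
move=> uB; rewrite /bilin mulmxKV// mxE; apply: eq_bigr => i _; by rewrite mxE.
Qed.

Lemma nondegenerate B u : B \in unitmx -> (forall v, bilin B u v = 0) -> u = 0.
Proof.
move=> uB H; have : u *m B = 0.
  apply/rowP => i; have := H (basis_vec R i); rewrite bilin_sumE (bigD1 i)//=.
  rewrite [X in _ + X]big1 => [|j ji]; last by rewrite basis_vecE (negbTE ji) mulr0.
  by rewrite !mxE !eqxx mulr1 addr0.
by move=> /(congr1 (mulmx^~ (invmx B))); rewrite mulmxK// mul0mx.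
Qed.

End Bilin.

Section Charts.
Context (R : realType) (n : nat) (M : topologicalType) (A : manifold R n M).
Implicit Types (c d : chart R n M) (x : M) (z u v w : 'rV[R]_n).

Lemma cdom_open c : atlas A c -> open (cdom c).
Proof. by move=> /atlas_chart[]. Qed.

Lemma cran_open c : atlas A c -> open (cran c).
Proof. by move=> /atlas_chart[]. Qed.

Lemma cmapK c x : atlas A c -> cdom c x -> cinv c (cmap c x) = x.
Proof. by move=> /atlas_chart[_ _ + _ _]; exact. Qed.

Lemma cran_cmap c x : cdom c x -> cran c (cmap c x).
Proof. by move=> cx; exists x. Qed.

Lemma cdom_cinv c z : atlas A c -> cran c z -> cdom c (cinv c z).
Proof. by move=> Ac [x cx <-]; rewrite cmapK. Qed.

Lemma cinvK c z : atlas A c -> cran c z -> cmap c (cinv c z) = z.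
Proof. by move=> Ac [x cx <-]; rewrite cmapK. Qed.

Lemma cinv_continuous c z : atlas A c -> cran c z -> {for z, continuous (cinv c)}.
Proof. by move=> /atlas_chart[_ _ _ _]; exact. Qed.

Lemma cmap_continuous c x : atlas A c -> cdom c x -> {for x, continuous (cmap c)}.
Proof. by move=> /atlas_chart[_ _ _ + _]; exact. Qed.

Lemma near_cran c z : atlas A c -> cran c z -> \forall t \near z, cran c t.
Proof. by move=> Ac cz; apply: open_nbhs_nbhs; split=> //; exact: cran_open. Qed.

Lemma near_cinv c z (U : set M) : atlas A c -> cran c z -> open U -> U (cinv c z) ->
  \forall t \near z, U (cinv c t).
Proof. by move=> Ac cz oU Uz; apply: (cinv_continuous Ac cz); exact: open_nbhs_nbhs. Qed.

Lemma trans_differentiable c d x : atlas A c -> atlas A d -> cdom c x -> cdom d x ->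
  differentiable (cmap d \o cinv c) (cmap c x).
Proof.
move=> Ac Ad cx dx; have [+ _] := atlas_compat Ac Ad.
by move=> /(_ 1%N)[+ _]; apply; exists x.
Qed.

(** The two transition maps compose to the identity near the point, so their derivatives are
    mutually inverse. *)
Lemma trans_derive_cancel c d x v : atlas A c -> atlas A d -> cdom c x -> cdom d x ->
  'D_('D_v (cmap d \o cinv c) (cmap c x)) (cmap c \o cinv d) (cmap d x) = v.
Proof.
move=> Ac Ad cx dx.
have dcd := trans_differentiable Ac Ad cx dx.
have ddc := trans_differentiable Ad Ac dx cx.
have E : (cmap d \o cinv c) (cmap c x) = cmap d x by rewrite /= cmapK.
rewrite -[X in 'D_ _ _ X]E -derive_comp//; last by rewrite E.
have cz := cran_cmap cx.
rewrite (near_eq_derive (g := id)) ?derive_id//.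
have dcx : cdom d (cinv c (cmap c x)) by rewrite cmapK.
apply: filterS2 (near_cran Ac cz) (near_cinv Ac cz (cdom_open Ad) dcx) => t ct dt /=.
by rewrite cmapK// cinvK.
Qed.

Lemma tvecE c x v : atlas A c -> cdom c x ->
  tvec A c (cmap c x) v = 'D_v (cmap (chart_at A x) \o cinv c) (cmap c x).
Proof. by move=> Ac cx; rewrite /tvec cmapK. Qed.

(** Inverse of [tvec A c (cmap c x)]: the components in c of a tangent vector stored in
    [chart_at A x]. *)
Definition tcov c x w := 'D_w (cmap c \o cinv (chart_at A x)) (pcoord A x).

Lemma tcovK c x v : atlas A c -> cdom c x -> tcov c x (tvec A c (cmap c x) v) = v.
Proof.
move=> Ac cx; rewrite tvecE// /tcov.
by apply: trans_derive_cancel => //; [exact: chart_at_atlas|exact: chart_at_dom].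
Qed.

Lemma tvecK c x w : atlas A c -> cdom c x -> tvec A c (cmap c x) (tcov c x w) = w.
Proof.
move=> Ac cx; rewrite tvecE// /tcov.
by apply: trans_derive_cancel => //; [exact: chart_at_atlas|exact: chart_at_dom].
Qed.

Lemma tvec_linear c x : atlas A c -> cdom c x -> linear (tvec A c (cmap c x)).
Proof.
move=> Ac cx a u v; rewrite !tvecE// derivable_diff_linear//.
by apply: trans_differentiable => //; [exact: chart_at_atlas|exact: chart_at_dom].
Qed.

Lemma tcov_linear c x : atlas A c -> cdom c x -> linear (tcov c x).
Proof.
move=> Ac cx a u v; rewrite /tcov derivable_diff_linear//.
by apply: trans_differentiable => //; [exact: chart_at_atlas|exact: chart_at_dom].
Qed.

Lemma tvec0 c z : tvec A c z 0 = 0.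
Proof. exact: derive0. Qed.

Lemma tvec_chart_at x v : tvec A (chart_at A x) (pcoord A x) v = v.
Proof.
rewrite /pcoord tvecE; [|exact: chart_at_atlas|exact: chart_at_dom].
rewrite (near_eq_derive (g := id)) ?derive_id//.
apply: filterS (near_cran (chart_at_atlas A x) (cran_cmap (chart_at_dom A x))) => t ct.
by rewrite /= cinvK//; exact: chart_at_atlas.
Qed.

Lemma CkM2_C2on c (f : M -> R) : atlas A c -> CkM A 2 f -> C2on (cran c) (f \o cinv c).
Proof. by move=> Ac /(_ c Ac); apply: Ck2_C2on; exact: cran_open. Qed.

End Charts.

Section Metric.
Context (R : realType) (n : nat) (M : topologicalType) (A : manifold R n M).
Context (G : riemannian A).
Implicit Types (c d : chart R n M) (x : M) (z u v w : 'rV[R]_n).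

Lemma metric_unit x : metric G x \in unitmx.
Proof. by apply: posdef_unitmx => v; exact: metric_posdef. Qed.

Lemma ipC x u v : ip G x u v = ip G x v u.
Proof. by rewrite /ip (bilinC _ _ (Defs.metric_sym G x)). Qed.

Lemma ip_ge0 x u : 0 <= ip G x u u.
Proof.
have [->|u0] := eqVneq u 0; first by rewrite /ip bilin0l.
by apply: ltW; exact: metric_posdef.
Qed.

Lemma ip_nondeg x u : (forall v, ip G x u v = 0) -> u = 0.
Proof. exact: nondegenerate (metric_unit x). Qed.

Lemma ip_CS x u v : `|ip G x u v| <= tnorm G x u * tnorm G x v.
Proof.
have H (t : R) : 0 <= t ^+ 2 * ip G x u u + 2 * t * ip G x u v + ip G x v v.
  have := ip_ge0 x (t *: u + v); rewrite /ip bilinPl !bilinPr -!/(ip _ _ _ _) (ipC x v u).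
  by apply: eq_rect; congr (0 <= _); ring.
rewrite /tnorm -sqrtrM ?ip_ge0// -sqrtr_sqr ler_sqrt; last by rewrite mulr_ge0// ip_ge0.
have [u0|u0] := eqVneq (ip G x u u) 0; last first.
  have up : 0 < ip G x u u by rewrite lt_def u0 ip_ge0.
  have := H (- (ip G x u v / ip G x u u)); move: (ip G x u v) (ip G x v v) => a b.
  have E : ip G x u u * (a / ip G x u u) = a by rewrite mulrC divfK.
  move: (a / ip G x u u) E => q E; move: (ip G x u u) up E => p p0 E; nra.
have uz : u = 0.
  by apply/eqP; apply: contraTT isT => /(metric_posdef G x); rewrite -/(ip G x u u) u0 ltxx.
by rewrite uz /ip !bilin0l expr0n mul0r.
Qed.

Lemma tnorm_ge0 x u : 0 <= tnorm G x u.
Proof. exact: sqrtr_ge0. Qed.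

Lemma tnorm_sqr x u : tnorm G x u ^+ 2 = ip G x u u.
Proof. by rewrite sqr_sqrtr// ip_ge0. Qed.

Lemma gram_bilin c x u v : atlas A c -> cdom c x ->
  bilin (gram G c (cmap c x)) u v =
  ip G x (tvec A c (cmap c x) u) (tvec A c (cmap c x) v).
Proof.
move=> Ac cx.
pose tM := GRing.isLinear.Build _ _ _ _ _ (tvec_linear Ac cx).
pose T : {linear 'rV[R]_n -> 'rV[R]_n} := HB.pack (tvec A c (cmap c x)) tM.
have TE w : tvec A c (cmap c x) w = \sum_i w 0 i *: tvec A c (cmap c x) (basis_vec R i).
  rewrite -[tvec A c (cmap c x)]/(T : _ -> _) {1}[w]row_basis linear_sum.
  by apply: eq_bigr => i _; rewrite linearZ.
have sl (f : 'I_n -> 'rV[R]_n) (b : 'I_n -> R) w :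
    ip G x (\sum_i b i *: f i) w = \sum_i b i * ip G x (f i) w.
  elim/big_ind2: _ => [|a1 a2 b1 b2 <- <-|i _]; first by rewrite /ip bilin0l.
    by rewrite -[a2]scale1r /ip bilinPl mul1r scale1r.
  by rewrite -[_ *: _]addr0 /ip bilinPl bilin0l addr0.
rewrite [in RHS](TE u) sl bilin_sumE.
under eq_bigr do rewrite mulr_suml.
rewrite exchange_big; apply: eq_bigr => i _ /=.
rewrite [in RHS](TE v) ipC sl mulr_sumr; apply: eq_bigr => j _.
rewrite mxE (cmapK Ac cx) -/(ip G x _ _) [in RHS]ipC; ring.
Qed.

Lemma gram_unit c z : atlas A c -> cran c z -> gram G c z \in unitmx.
Proof.
move=> Ac [x cx <-]; apply: posdef_unitmx => v v0; rewrite gram_bilin//.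
apply: metric_posdef; apply: contra_neq v0 => T0.
by rewrite -(tcovK v Ac cx) T0 /tcov derive0.
Qed.

Lemma gram_sym c z i j : gram G c z i j = gram G c z j i.
Proof. by rewrite !mxE (bilinC _ _ (Defs.metric_sym G _)). Qed.

Lemma gram_chart_at x : gram G (chart_at A x) (pcoord A x) = metric G x.
Proof.
apply/matrixP => i j; rewrite mxE !tvec_chart_at /pcoord.
rewrite (cmapK (chart_at_atlas A x) (chart_at_dom A x)).
rewrite bilin_sumE (bigD1 j)//= [X in _ + X]big1 ?addr0 => [|l lj]; last by rewrite basis_vecE (negbTE lj) mulr0.
rewrite basis_vecE eqxx mulr1 (bigD1 i)//= [X in _ + X]big1 ?addr0 => [|l li]; last first.
  by rewrite basis_vecE (negbTE li) mul0r.
by rewrite basis_vecE eqxx mul1r.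
Qed.

Lemma ip_grad_chart_at (f : M -> R) x w :
  differentiable (f \o cinv (chart_at A x)) (pcoord A x) ->
  ip G x (grad G f x) w = 'D_w (f \o cinv (chart_at A x)) (pcoord A x).
Proof.
move=> df; rewrite /grad /grad_in gram_chart_at /ip bilin_inv ?metric_unit//.
by rewrite (derive_row_basis w)//; apply: eq_bigr => i _; rewrite mxE mulrC.
Qed.

(** The Riesz characterization of the gradient holds in any chart, although [grad] is computed in
    [chart_at A x]. It is how gradients are used from here on, without inverse Gram matrices. *)
Lemma ip_grad (f : M -> R) c x v : atlas A c -> cdom c x ->
  differentiable (f \o cinv (chart_at A x)) (pcoord A x) ->
  ip G x (grad G f x) (tvec A c (cmap c x) v) = 'D_v (f \o cinv c) (cmap c x).
Proof.
move=> Ac cx df; rewrite ip_grad_chart_at// tvecE//.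
have Ad := chart_at_atlas A x; have dx := chart_at_dom A x.
have cz := cran_cmap cx.
have E : (cmap (chart_at A x) \o cinv c) (cmap c x) = pcoord A x by rewrite /= (cmapK Ac cx).
rewrite -E -derive_comp; last 2 first.
- exact: (trans_differentiable Ac Ad cx dx).
- by rewrite E.
apply: near_eq_derive.
have dcx : cdom (chart_at A x) (cinv c (cmap c x)) by rewrite (cmapK Ac cx).
by apply: filterS (near_cinv Ac cz (cdom_open Ad) dcx) => t dt /=; rewrite (cmapK Ad dt).
Qed.

End Metric.

(** * The Riemannian Hessian in a chart *)

Section DifferentiableInverse.
Context (R : realType) (V : normedModType R).

Lemma differentiable_fprod (I : finType) (P : pred I) (f : I -> V -> R) x :
  (forall i, differentiable (f i) x) -> differentiable (fun y => \prod_(i | P i) f i y) x.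
Proof.
move=> df; elim: (index_enum I) => [|i r IH].
  rewrite (_ : (fun _ => _) = cst 1); first exact: differentiable_cst.
  by apply/funext => y; rewrite big_nil.
have [Pi|Pi] := boolP (P i); last first.
  by under eq_fun do rewrite big_cons (negbTE Pi).
under eq_fun do rewrite big_cons Pi.
exact: (@differentiableM _ _ (f i)).
Qed.

Lemma differentiable_det n (B : V -> 'M[R]_n) x :
  (forall i j, differentiable (fun y => B y i j) x) ->
  differentiable (fun y => \det (B y)) x.
Proof.
move=> dB; rewrite /determinant; apply: differentiable_fsum => s.
apply: (@differentiableM _ _ (cst ((-1) ^+ perm.odd_perm s))); first exact: differentiable_cst.
exact: differentiable_fprod.
Qed.

(** Cramer's rule: near x the entry is a cofactor divided by the determinant. *)
Lemma differentiable_invmx n (B : V -> 'M[R]_n) x i j :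
  (forall i j, differentiable (fun y => B y i j) x) ->
  (\forall y \near x, B y \in unitmx) ->
  differentiable (fun y => invmx (B y) i j) x.
Proof.
move=> dB uB.
apply: (near_eq_differentiable (f := fun y => (\det (B y))^-1 *
    ((-1) ^+ (j + i) * \det (row' j (col' i (B y)))))).
  by apply: filterS uB => y uy; rewrite /invmx uy !mxE.
apply: (@differentiableM _ _ (fun y => (\det (B y))^-1)).
  apply: (@differentiableV _ _ (fun y => \det (B y))); first exact: differentiable_det.
  by have := nbhs_singleton uB; rewrite unitmxE unitfE.
apply: (@differentiableM _ _ (cst ((-1) ^+ (j + i)))); first exact: differentiable_cst.
apply: differentiable_det => k l.
by under eq_fun do rewrite !mxE.
Qed.

End DifferentiableInverse.

Section Hessian.
Context (R : realType) (n : nat) (M : topologicalType) (A : manifold R n M).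
Context (G : riemannian A).
Implicit Types (c d : chart R n M) (x : M) (z u v w : 'rV[R]_n).

Lemma gram_differentiable c z i j : atlas A c -> cran c z ->
  differentiable (fun t => gram G c t i j) z.
Proof.
move=> Ac cz; have [dg _] := metric_smooth G Ac 1%N.
apply: (@differentiable_comp _ _ _ _ (gram G c) (fun N : 'M[R]_n => N i j)).
  exact: dg.
exact: differentiable_coord.
Qed.

Section InChart.
Context (c : chart R n M) (Ac : atlas A c) (f : M -> R) (z : 'rV[R]_n) (cz : cran c z).
Context (Cf : C2on (cran c) (f \o cinv c)).
Let g := gram G c z.
Let V := grad_in G c f.
Let e i : 'rV[R]_n := basis_vec R i.
(** Twice the Christoffel symbol of the first kind. *)
Let C i j l := 'D_(e i) (fun t => gram G c t j l) z
     + 'D_(e j) (fun t => gram G c t i l) z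
     - 'D_(e l) (fun t => gram G c t i j) z.

Lemma grad_in_gram t l : cran c t ->
  \sum_j V t 0 j * gram G c t j l = 'D_(e l) (f \o cinv c) t.
Proof.
move=> ct; have uG := gram_unit G Ac ct.
transitivity ((V t *m gram G c t) 0 l); first by rewrite mxE.
by rewrite /V /grad_in mulmxKV// mxE.
Qed.

Let dV j : differentiable (fun t => V t 0 j) z.
Proof.
have [_ d2 _] := Cf.
have -> : (fun t => V t 0 j) =
    (fun t => \sum_l 'D_(e l) (f \o cinv c) t * invmx (gram G c t) l j).
  by apply/funext => t; rewrite mxE; apply: eq_bigr => l _; rewrite mxE.
apply: differentiable_fsum => l.
apply: (@differentiableM _ _ ('D_(e l) (f \o cinv c))); first exact: d2.
apply: differentiable_invmx => [i k|]; first exact: gram_differentiable.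
by apply: filterS (near_cran Ac cz) => t ct; exact: gram_unit.
Qed.

(** Obtained by differentiating the identity [grad_in_gram], so the derivative of the inverse Gram
    matrix is never computed. *)
Let derV xi l : \sum_j ('D_xi V z) 0 j * g j l =
  'D_xi ('D_(e l) (f \o cinv c)) z
  - \sum_j \sum_i V z 0 j * xi 0 i * 'D_(e i) (fun t => gram G c t j l) z.
Proof.
have dVz : derivable V z xi.
  by apply/derivable_mxP => i j; rewrite ord1; apply: diff_derivable; exact: dV.
have dg j : derivable (fun t => gram G c t j l) z xi.
  by apply: diff_derivable; exact: gram_differentiable.
have E : \forall t \near z, \sum_j V t 0 j * gram G c t j l = 'D_(e l) (f \o cinv c) t.
  by apply: filterS (near_cran Ac cz) => t; exact: grad_in_gram.
rewrite -(near_eq_derive xi E) derive_fsum; last first.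
  move=> j; apply: (@derivableM _ _ (fun t => V t 0 j)) => //.
  by apply: diff_derivable; exact: dV.
rewrite -sumrB; apply: eq_bigr => j _.
rewrite (@deriveM _ _ (fun t => V t 0 j)); last 2 first.
- by apply: diff_derivable; exact: dV.
- exact: dg.
rewrite (derive_coord _ dVz) (derive_row_basis xi (gram_differentiable _ _ Ac cz)).
rewrite /g; set S := \sum_(i < n) _ *: _; set S' := \sum_(i < n) _ * _ * _.
have -> : S' = V z 0 j *: S.
  by rewrite /S /S' scaler_sumr; apply: eq_bigr => i _; rewrite -mulrA.
by rewrite [_ *: S + _]addrC addrK mulrC.
Qed.

Lemma christoffel_lower u v l :
  \sum_k (christoffel_app G c z u v) 0 k * g k l =
  2^-1 * \sum_i \sum_j u 0 i * v 0 j * C i j l.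
Proof.
have uG : g \in unitmx by exact: gram_unit.
have gam i j : \sum_k christoffel G c z i j k * g k l = 2^-1 * C i j l.
  rewrite /christoffel -/g.
  under eq_bigr do rewrite -mulrA mulr_suml.
  rewrite -mulr_sumr exchange_big /=; congr (_ * _).
  rewrite (bigD1 l)//= [X in _ + X]big1 ?addr0 => [|l' l'l].
    under eq_bigr do rewrite mulrAC.
    rewrite -mulr_suml.
    have -> : \sum_k invmx g k l * g k l = (g *m invmx g) l l.
      by rewrite mxE; apply: eq_bigr => k _; rewrite mulrC /g gram_sym.
    by rewrite mulmxV// mxE eqxx mul1r.
  under eq_bigr do rewrite mulrAC.
  rewrite -mulr_suml.
  have -> : \sum_k invmx g k l' * g k l = (g *m invmx g) l l'.
    by rewrite mxE; apply: eq_bigr => k _; rewrite mulrC /g gram_sym.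
  by rewrite mulmxV// mxE eq_sym (negbTE l'l) mul0r.
under eq_bigr do rewrite mxE mulr_suml.
rewrite exchange_big mulr_sumr; apply: eq_bigr => i _ /=.
under eq_bigr do rewrite mulr_suml.
rewrite exchange_big mulr_sumr; apply: eq_bigr => j _ /=.
rewrite mulrCA -gam mulr_sumr; apply: eq_bigr => k _; ring.
Qed.

(** Compatibility of the connection with the metric: the derivative of the Gram entry j l in
    direction i, minus half of [C i j l], is half of [C i l j]. What is left of the metric terms is
    thus the Christoffel term with eta in its second slot. *)
Lemma covd_grad xi eta : bilin g (covd G c V z xi) eta =
  'D_xi ('D_eta (f \o cinv c)) z
  - 'D_(christoffel_app G c z xi eta) (f \o cinv c) z.
Proof.
have [df _ _] := Cf.
rewrite bilin_sumE (derive2_bilinear _ _ (cran_open Ac) Cf cz) derive_row_basis; last first.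
  exact: df.
have -> : \sum_k (christoffel_app G c z xi eta) 0 k *: 'D_(e k) (f \o cinv c) z =
    \sum_l \sum_i \sum_j 2^-1 * (V z 0 j * (xi 0 i * eta 0 l * C i l j)).
  transitivity (\sum_j V z 0 j *
     \sum_k (christoffel_app G c z xi eta) 0 k * g k j).
    under eq_bigr do rewrite -(grad_in_gram _ cz) scaler_sumr.
    rewrite exchange_big; apply: eq_bigr => j _ /=; rewrite mulr_sumr.
    by apply: eq_bigr => k _; rewrite /g (gram_sym G c z k j) mulrCA.
  under eq_bigr do rewrite christoffel_lower mulrCA !mulr_sumr.
  rewrite exchange_big /=.
  under eq_bigr do under eq_bigr do rewrite !mulr_sumr.
  under eq_bigr do rewrite exchange_big.
  by rewrite exchange_big.
rewrite -sumrB; apply: eq_bigr => l _.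
rewrite /covd.
under eq_bigr do rewrite mxE mulrDl.
rewrite big_split /= derV christoffel_lower.
rewrite [X in _ - X](_ : _ = \sum_i \sum_j V z 0 j * xi 0 i * 'D_(e i) (fun t => gram G c t j l) z);
  last by rewrite exchange_big.
rewrite -addrA mulrDl [X in _ = X - _]mulrC; congr (_ + _).
rewrite [- _ + _]addrC mulr_sumr -sumrB mulr_suml -sumrN; apply: eq_bigr => i _ /=.
rewrite mulr_sumr -sumrB mulr_suml -sumrN; apply: eq_bigr => j _ /=.
rewrite /C.
have -> : (fun t => gram G c t l j) = (fun t => gram G c t j l).
  by apply/funext => t; exact: gram_sym.
move: ('D_(e i) _ _) ('D_(e l) _ _) ('D_(e j) _ _) (V z 0 j) (xi 0 i) (eta 0 l) => a1 a2 a3 a4 a5 a6.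
by field.
Qed.

End InChart.

Lemma christoffel_app_sym c z u v : christoffel_app G c z u v = christoffel_app G c z v u.
Proof.
apply/rowP => k; rewrite !mxE exchange_big; apply: eq_bigr => j _; apply: eq_bigr => i _ /=.
rewrite mulrAC; congr (_ * _ * _); rewrite /christoffel; congr (_ * _).
apply: eq_bigr => l _; congr (_ * _).
have -> : (fun t => gram G c t j i) = (fun t => gram G c t i j).
  by apply/funext => t; exact: gram_sym.
by congr (_ - _); exact: addrC.
Qed.

Lemma christoffel_app_linear c z v a u u' : christoffel_app G c z (a *: u + u') v =
  a *: christoffel_app G c z u v + christoffel_app G c z u' v.
Proof.
apply/rowP => k; rewrite !mxE mulr_sumr -big_split; apply: eq_bigr => i _ /=.
rewrite mulr_sumr -big_split; apply: eq_bigr => j _ /=; rewrite !mxE; ring.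
Qed.

Lemma ip_hess_chart_at (f : M -> R) x xi eta :
  C2on (cran (chart_at A x)) (f \o cinv (chart_at A x)) ->
  ip G x (hess G f x xi) eta =
  'D_xi ('D_eta (f \o cinv (chart_at A x))) (pcoord A x)
  - 'D_(christoffel_app G (chart_at A x) (pcoord A x) xi eta)
      (f \o cinv (chart_at A x)) (pcoord A x).
Proof.
move=> Cf; rewrite /ip -gram_chart_at; apply: covd_grad => //.
  exact: chart_at_atlas.
exact/cran_cmap/chart_at_dom.
Qed.

End Hessian.

(** * Second-order retractions *)

Section LinearPrePost.
Context (R : realType).

Lemma derive_precomp_linear (U V W : normedModType R) (f : V -> W) (T : U -> V) (w v : U) :
  linear T -> 'D_v (fun y => f (T y)) w = 'D_(T v) f (T w).
Proof.
move=> lT; rewrite /derive.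
set F := (X in lim (X @ _)); set F' := (X in _ = lim (X @ _)).
suff -> : F = F' by [].
by apply/funext => h /=; rewrite /F /F' /= lT.
Qed.

Lemma derive_postcomp_linear (U V W : normedModType R) (L : {linear V -> W}) (g : U -> V) (x v : U) :
  continuous L -> derivable g x v -> 'D_v (fun y => L (g y)) x = L ('D_v g x).
Proof.
move=> cL dg; rewrite /derive; apply: cvg_lim => //.
have H := continuous_cvg _ (cL _) dg.
rewrite [X in X @ _ --> _](_ : _ = fun h => L (h^-1 *: ((g \o shift x) (h *: v) - g x))).
  exact: H.
by apply/funext => h; rewrite /= [RHS]linearZ /= [in RHS]linearB.
Qed.

Lemma linear_row_differentiable n (W : normedModType R) (T : 'rV[R]_n -> W) y :
  linear T -> differentiable T y.
Proof.
move=> lT; pose tM := GRing.isLinear.Build _ _ _ _ _ lT.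
pose L : {linear 'rV[R]_n -> W} := HB.pack T tM.
exact: (@linear_differentiable _ _ _ L y (linear_row_continuous (f := L))).
Qed.

Lemma row_mx_right_linear n m (u v : 'rV[R]_m) a :
  row_mx (0 : 'rV[R]_n) (a *: u + v) = a *: row_mx 0 u + row_mx 0 v.
Proof. by rewrite scale_row_mx add_row_mx scaler0 addr0. Qed.

Lemma row_mx_right_differentiable n m (z : 'rV[R]_n) (u : 'rV[R]_m) :
  differentiable (fun u => row_mx z u) u.
Proof.
have -> : (fun u => row_mx z u) = (fun u : 'rV[R]_m => row_mx z 0 + row_mx 0 u).
  by apply/funext => t; rewrite add_row_mx addr0 add0r.
apply: differentiableD; first exact: differentiable_cst.
by apply: linear_row_differentiable => a s t; exact: row_mx_right_linear.
Qed.

Lemma derive_row_mx_right n m (W : normedModType R) (f : 'rV[R]_(n + m) -> W) z u v :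
  'D_v (fun u : 'rV[R]_m => f (row_mx z u)) u = 'D_(row_mx 0 v) f (row_mx z u).
Proof.
rewrite /derive.
set F := (X in lim (X @ _)); set F' := (X in _ = lim (X @ _)).
suff -> : F = F' by [].
by apply/funext => h /=; rewrite /F /F' /= scale_row_mx scaler0 add_row_mx add0r.
Qed.

(** With the base point z frozen, derivatives in the fibre are derivatives of f along vectors (0,
    v). *)
Lemma row_mx_right_C2on n m (W : normedModType R) (U : set 'rV[R]_(n + m))
    (f : 'rV[R]_(n + m) -> W) z :
  C2on U f -> C2on [set u : 'rV[R]_m | U (row_mx z u)] (fun u => f (row_mx z u)).
Proof.
move=> [df d2f cf]; split.
- move=> u Uu; apply: (@differentiable_comp _ _ _ _ (fun u => row_mx z u) f); last exact: df.
  exact: row_mx_right_differentiable.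
- move=> v u Uu; have -> : 'D_v (fun u => f (row_mx z u)) =
    (fun u => 'D_(row_mx 0 v) f (row_mx z u)).
    by apply/funext => t; exact: derive_row_mx_right.
  apply: (@differentiable_comp _ _ _ _ (fun u => row_mx z u) ('D_(row_mx 0 v) f)).
    exact: row_mx_right_differentiable.
  exact: d2f.
- move=> w v u Uu; have -> : 'D_v (fun u => f (row_mx z u)) =
    (fun u => 'D_(row_mx 0 v) f (row_mx z u)).
    by apply/funext => t; exact: derive_row_mx_right.
  have -> : 'D_w (fun u => 'D_(row_mx 0 v) f (row_mx z u)) =
    (fun u => 'D_(row_mx 0 w) ('D_(row_mx 0 v) f) (row_mx z u)).
    by apply/funext => t; exact: derive_row_mx_right.
  apply: (@continuous_comp _ _ _ (fun u => row_mx z u) ('D_(row_mx 0 w) ('D_(row_mx 0 v) f))); last exact: cf.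
  exact/differentiable_continuous/row_mx_right_differentiable.
Qed.

End LinearPrePost.

Section Retraction.
Context (R : realType) (n : nat) (M : topologicalType) (A : manifold R n M).
Context (G : riemannian A) (Rt : retraction A).
Implicit Types (c d : chart R n M) (x : M) (z u v w : 'rV[R]_n).

(* The retraction in the chart c, at [cinv c z]. *)
Definition rho c z u := cmap c (retr_in A Rt c (row_mx z u)).

Definition rdom c z : set 'rV[R]_n := [set u | retr_dom A Rt c c (row_mx z u)].

Lemma rhoE c z u : rho c z u = cmap c (Rt (cinv c z) (tvec A c z u)).
Proof. by rewrite /rho /retr_in row_mxKl row_mxKr. Qed.

Lemma rdomE c z u : rdom c z u <-> cran c z /\ cdom c (Rt (cinv c z) (tvec A c z u)).
Proof. by rewrite /rdom /retr_dom /retr_in /= row_mxKl row_mxKr. Qed.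

Lemma rdom_open c z : atlas A c -> open (rdom c z).
Proof.
move=> Ac; have [oD _] := retr_smooth Rt Ac Ac.
apply: (@open_comp _ _ (fun u => row_mx z u) (retr_dom A Rt c c)) => // u _.
exact/differentiable_continuous/row_mx_right_differentiable.
Qed.

Lemma rdom0 c z : atlas A c -> cran c z -> rdom c z 0.
Proof. by move=> Ac cz; apply/rdomE; split=> //; rewrite tvec0 retr0; exact: (cdom_cinv Ac cz). Qed.

Lemma rho0 c z : atlas A c -> cran c z -> rho c z 0 = z.
Proof. by move=> Ac cz; rewrite rhoE tvec0 retr0 (cinvK Ac cz). Qed.

Lemma rho_C2on c z : atlas A c -> C2on (rdom c z) (rho c z).
Proof.
move=> Ac; have [oD /(_ 2%N) C] := retr_smooth Rt Ac Ac.
exact: (row_mx_right_C2on z (Ck2_C2on oD C)).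
Qed.

Lemma rho_cran c z u : rdom c z u -> cran c (rho c z u).
Proof. by rewrite rhoE => /rdomE[_]; exact: cran_cmap. Qed.

Lemma cinv_rho c z u : atlas A c -> rdom c z u ->
  cinv c (rho c z u) = Rt (cinv c z) (tvec A c z u).
Proof. by rewrite rhoE => Ac /rdomE[_ /(cmapK Ac)]. Qed.

Lemma rho_chart_at x : rho (chart_at A x) (pcoord A x) = cmap (chart_at A x) \o Rt x.
Proof.
apply/funext => u; rewrite rhoE tvec_chart_at /pcoord.
by rewrite (cmapK (chart_at_atlas A x) (chart_at_dom A x)).
Qed.

Lemma near_rdom c z u : atlas A c -> rdom c z u -> \forall t \near u, rdom c z t.
Proof. by move=> Ac Du; exact: (near_open (rdom_open Ac) Du). Qed.

(** [Dretr0] speaks of [chart_at A x] only. Near 0 the retraction read in c is a transition map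
    after the retraction read in [chart_at A x] after [tvec]; the derivatives of the outer two
    cancel by [tcovK]. *)
Lemma derive_rho0 c z v : atlas A c -> cran c z -> 'D_v (rho c z) 0 = v.
Proof.
move=> Ac [x cx <-].
have Ad := chart_at_atlas A x; have dx := chart_at_dom A x.
have lT := tvec_linear Ac cx.
set T := tvec A c (cmap c x) in lT.
pose rx := rho (chart_at A x) (pcoord A x).
have dz : cran (chart_at A x) (pcoord A x) by exact: cran_cmap.
have drx : differentiable rx 0.
  by have [d _ _] := @rho_C2on (chart_at A x) (pcoord A x) Ad; apply: d; exact: rdom0.
have T0 : T 0 = 0 by exact: tvec0.
have dT : differentiable (fun y => rx (T y)) 0.
  apply: (@differentiable_comp _ _ _ _ T rx); first exact: linear_row_differentiable.
  by rewrite T0.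
have rx0 : rx (T 0) = pcoord A x by rewrite T0 /rx (rho0 Ad dz).
rewrite (near_eq_derive (g := (cmap c \o cinv (chart_at A x)) \o (fun y => rx (T y)))).
  rewrite derive_comp//; last first.
    by rewrite rx0; exact: (trans_differentiable Ad Ac dx cx).
  rewrite (@derive_precomp_linear _ _ _ _ rx T _ _ lT) rx0 T0 /rx rho_chart_at Dretr0.
  exact: (tcovK v Ac cx).
have cT : {for 0, continuous T}.
  exact/differentiable_continuous/linear_row_differentiable.
have : \forall y \near (0 : 'rV[R]_n), rdom (chart_at A x) (pcoord A x) (T y).
  by apply: cT; rewrite T0; exact: (near_rdom Ad (rdom0 Ad dz)).
apply: filterS => y dy /=; rewrite /rx (cinv_rho Ad dy) rhoE tvec_chart_at.
by rewrite /pcoord (cmapK Ac cx) (cmapK Ad dx).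
Qed.

(** Zero acceleration of the curve [Rt x (t *: xi)], whose velocity at 0 is xi, read in
    [chart_at A x]. *)
Lemma derive2_rho_diag (so : second_order G Rt) x xi :
  'D_xi ('D_xi (rho (chart_at A x) (pcoord A x))) 0 =
  - christoffel_app G (chart_at A x) (pcoord A x) xi xi.
Proof.
have E0 : Rt x (0 *: xi) = x by rewrite scale0r retr0.
pose F := cmap (chart_at A x) \o Rt x.
have D1 (H : 'rV[R]_n -> 'rV[R]_n) :
    derive1 (fun t : R => H (t *: xi)) = (fun t : R => 'D_xi H (t *: xi)).
  apply/funext => t; rewrite derive1E -[RHS](f_equal ('D_xi H) (add0r _)) -derive_line.
  by under [in RHS]eq_fun do rewrite add0r.
have := so x xi; rewrite /acceleration /velocity E0.
have -> : cmap (chart_at A x) \o (fun t : R => Rt x (t *: xi)) = (fun t => F (t *: xi)) by [].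
rewrite derive1nS derive1n1 (D1 F) (D1 ('D_xi F)) scale0r /F Dretr0 rho_chart_at.
by move/eqP; rewrite addr_eq0 => /eqP.
Qed.

(** Polarization: both sides are symmetric and biadditive and agree on the diagonal. Symmetry of the
    left side is taken entry by entry, as [derive2_sym] is about scalar functions. *)
Lemma derive2_rho_chart_at (so : second_order G Rt) x u v :
  'D_u ('D_v (rho (chart_at A x) (pcoord A x))) 0 =
  - christoffel_app G (chart_at A x) (pcoord A x) u v.
Proof.
have Ad := chart_at_atlas A x; have dx := chart_at_dom A x.
have dz : cran (chart_at A x) (pcoord A x) by exact: cran_cmap.
set r := rho _ _; set Gam := christoffel_app _ _ _.
have Cr : C2on (rdom (chart_at A x) (pcoord A x)) r by exact: rho_C2on.
have oD := @rdom_open (chart_at A x) (pcoord A x) Ad; have D0 := rdom0 Ad dz.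
have [dr d2r cr] := Cr.
pose B u v := 'D_u ('D_v r) 0.
have BDl u1 u2 v1 : B (u1 + u2) v1 = B u1 v1 + B u2 v1.
  rewrite /B -[u1]scale1r derivable_diff_linear; last exact: d2r.
  by rewrite !scale1r.
have Bsym u1 v1 : B u1 v1 = B v1 u1.
  apply/rowP => i; rewrite /B.
  have rC w1 y : rdom (chart_at A x) (pcoord A x) y ->
      'D_w1 (fun t => r t 0 i) y = ('D_w1 r y) 0 i.
    by move=> Dy; apply: derive_coord; apply: diff_derivable; exact: dr.
  have r2C w1 w2 y : rdom (chart_at A x) (pcoord A x) y ->
      'D_w1 ('D_w2 (fun t => r t 0 i)) y = ('D_w1 ('D_w2 r) y) 0 i.
    move=> Dy; rewrite -derive_coord; last by apply: diff_derivable; exact: d2r.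
    by apply: near_eq_derive; apply: near_open oD Dy _ => t; exact: rC.
  have Cri : C2on (rdom (chart_at A x) (pcoord A x)) (fun t => r t 0 i).
    split.
    - by move=> y Dy; apply: differentiable_rowE; exact: dr.
    - move=> w1 y Dy; apply: (near_eq_differentiable (f := fun t => ('D_w1 r t) 0 i)).
        by apply: near_open oD Dy _ => t Dt; rewrite rC.
      by apply: (differentiable_rowE (f := 'D_w1 r)); exact: d2r.
    - move=> w1 w2 y Dy; apply: (near_eq_continuous (f := fun t => ('D_w1 ('D_w2 r) t) 0 i)).
        by apply: near_open oD Dy _ => t Dt; rewrite r2C.
      apply: (@continuous_comp _ _ _ ('D_w1 ('D_w2 r)) (fun N : 'rV[R]_n => N 0 i)).
        exact: cr.
      exact: coord_continuous.
  exact: (etrans (esym (r2C u1 v1 _ D0)) (etrans (derive2_sym u1 v1 oD Cri D0) (r2C v1 u1 _ D0))).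
have GDl u1 u2 v1 : Gam (u1 + u2) v1 = Gam u1 v1 + Gam u2 v1.
  by rewrite /Gam -[u1]scale1r christoffel_app_linear !scale1r.
have Gsym u1 v1 : Gam u1 v1 = Gam v1 u1 by exact: christoffel_app_sym.
have BDr u1 v1 v2 : B u1 (v1 + v2) = B u1 v1 + B u1 v2 by rewrite Bsym BDl !(Bsym u1).
have GDr u1 v1 v2 : Gam u1 (v1 + v2) = Gam u1 v1 + Gam u1 v2.
  by rewrite Gsym GDl !(Gsym u1).
have diag w1 : B w1 w1 = - Gam w1 w1 by exact: derive2_rho_diag.
have := diag (u + v); rewrite BDl !BDr GDl !GDr !diag (Bsym v u) (Gsym v u) -/(B u v).
move: (B u v) (Gam u v) (Gam u u) (Gam v v) => b g gu gv E.
apply/rowP => i; have /rowP/(_ i) := E; rewrite !mxE.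
move: (b 0 i) (g 0 i) (gu 0 i) (gv 0 i) => *; lra.
Qed.

Definition C2M (f : M -> R) := forall c, atlas A c -> C2on (cran c) (f \o cinv c).

(** In [chart_at A x] the curvature term of the chain rule is minus the Christoffel symbol applied
    to the differential of f, which is exactly the correction in the Riemannian Hessian. *)
Lemma ip_hess_pullback (so : second_order G Rt) (f : M -> R) x xi eta : C2M f ->
  ip G x (hess G f x xi) eta = 'D_xi ('D_eta (f \o Rt x)) 0.
Proof.
move=> Cf; have Ad := chart_at_atlas A x; have dx := chart_at_dom A x.
have dz : cran (chart_at A x) (pcoord A x) by exact: cran_cmap.
have oD := @rdom_open (chart_at A x) (pcoord A x) Ad; have D0 := rdom0 Ad dz.
have Cr := @rho_C2on (chart_at A x) (pcoord A x) Ad.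
rewrite ip_hess_chart_at; last exact: Cf.
set r := rho (chart_at A x) (pcoord A x) in Cr.
have E y : rdom (chart_at A x) (pcoord A x) y ->
    ((f \o cinv (chart_at A x)) \o r) y = (f \o Rt x) y.
  move=> Dy; rewrite /r /= (cinv_rho Ad Dy) tvec_chart_at /pcoord.
  by rewrite (cmapK Ad dx).
have E1 y : rdom (chart_at A x) (pcoord A x) y ->
    'D_eta ((f \o cinv (chart_at A x)) \o r) y = 'D_eta (f \o Rt x) y.
  by move=> Dy; apply: near_eq_derive; exact: near_open oD Dy E.
rewrite -(near_eq_derive xi (near_open oD D0 E1)).
rewrite (derive2_comp oD (cran_open Ad) Cr (Cf _ Ad) _ _ _ D0); last first.
  by move=> y; exact: rho_cran.
rewrite /r !(derive_rho0 _ Ad dz) (rho0 Ad dz) derive2_rho_chart_at//.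
rewrite -[- christoffel_app _ _ _ _ _]scaleN1r derive_scale ?scaleN1r//.
by have [df _ _] := Cf _ Ad; exact: df.
Qed.

(** On [rdom c z] this is the pullback of f by the retraction at [cinv c z], in the linear
    coordinates that c gives on that tangent space. *)
Definition phi (f : M -> R) c z := (f \o cinv c) \o rho c z.

Lemma pullback_phi (f : M -> R) c x w v : atlas A c -> cdom c x ->
  rdom c (cmap c x) w ->
  'D_(tvec A c (cmap c x) v) (f \o Rt x) (tvec A c (cmap c x) w) =
  'D_v (phi f c (cmap c x)) w.
Proof.
move=> Ac cx Dw; rewrite -(derive_precomp_linear _ _ _ (tvec_linear Ac cx)).
apply: near_eq_derive; apply: near_open (@rdom_open c _ Ac) Dw _ => y Dy.
by rewrite /phi /= (cinv_rho Ac Dy) (cmapK Ac cx).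
Qed.

Lemma pullback_phi2 (f : M -> R) c x w u v : atlas A c -> cdom c x ->
  rdom c (cmap c x) w ->
  'D_(tvec A c (cmap c x) u) ('D_(tvec A c (cmap c x) v) (f \o Rt x))
    (tvec A c (cmap c x) w) = 'D_u ('D_v (phi f c (cmap c x))) w.
Proof.
move=> Ac cx Dw; rewrite -(derive_precomp_linear _ _ _ (tvec_linear Ac cx)).
apply: near_eq_derive; apply: near_open (@rdom_open c _ Ac) Dw _ => y Dy.
exact: pullback_phi.
Qed.

(* As [rho c z] has derivative id at 0, [Hf f c z u v] is the second derivative
   of [phi f c z] at 0; [Qf] is the second-order part of the retraction. *)
Definition Qf c z u v := 'D_u ('D_v (rho c z)) 0.

Definition Hf (f : M -> R) c z u v :=
  'D_u ('D_v (f \o cinv c)) z + 'D_(Qf c z u v) (f \o cinv c) z.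

Lemma phi_derive2_0 (f : M -> R) c z u v : C2M f -> atlas A c -> cran c z ->
  'D_u ('D_v (phi f c z)) 0 = Hf f c z u v.
Proof.
move=> Cf Ac cz.
rewrite (derive2_comp (@rdom_open c z Ac) (cran_open Ac) (@rho_C2on c z Ac) (Cf _ Ac)); last 2 first.
- by move=> y; exact: rho_cran.
- exact: rdom0.
by rewrite !(derive_rho0 _ Ac cz) (rho0 Ac cz).
Qed.

(** The detour through the pullback changes chart by a linear map of the tangent space, which avoids
    the transformation law of the Christoffel symbols. *)
Lemma ip_hess (so : second_order G Rt) (f : M -> R) c x u v : C2M f -> atlas A c -> cdom c x ->
  ip G x (hess G f x (tvec A c (cmap c x) u)) (tvec A c (cmap c x) v) =
  Hf f c (cmap c x) u v.
Proof.
move=> Cf Ac cx; have cz := cran_cmap cx.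
rewrite (ip_hess_pullback so)//; have := pullback_phi2 f u v Ac cx (rdom0 Ac cz).
by rewrite tvec0 (phi_derive2_0 u v Cf Ac cz).
Qed.

End Retraction.

(** * Bounds near the solution *)

Lemma derive2_row_basis (R : realType) n (W : normedModType R) (U : set 'rV[R]_n)
    (f : 'rV[R]_n -> W) x u v : open U -> U x ->
  (forall y, U y -> differentiable f y) ->
  (forall w y, U y -> differentiable ('D_w f) y) ->
  'D_u ('D_v f) x = \sum_i v 0 i *: 'D_u ('D_(basis_vec R i) f) x.
Proof.
move=> oU Ux df d2.
have Dv y : U y -> \sum_i v 0 i *: 'D_(basis_vec R i) f y = 'D_v f y.
  by move=> Uy; rewrite (derive_row_basis v) //; exact: df.
rewrite -(near_eq_derive _ (near_open oU Ux Dv)) derive_fsum; last first.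
  by move=> i; apply: derivableZ; apply: diff_derivable; exact: d2.
by apply: eq_bigr => i _; rewrite deriveZ//; apply: diff_derivable; exact: d2.
Qed.

Section NormBounds.
Context (R : realType).

Lemma norm_entry_le m n (B : 'M[R]_(m, n)) i j : `|B i j| <= `|B|.
Proof.
rewrite [leRHS]/Num.Def.normr/= mx_normrE.
exact: (le_bigmax _ (fun ij => `|B ij.1 ij.2|) (i, j)).
Qed.

Lemma bilin_norm_le n (B : 'M[R]_n) (u v : 'rV[R]_n) :
  `|bilin B u v| <= n%:R ^+ 2 * `|B| * `|u| * `|v|.
Proof.
rewrite bilin_sumE (le_trans (ler_norm_sum _ _ _))//.
apply: (@le_trans _ _ (\sum_(l < n) n%:R * `|B| * `|u| * `|v|)); last first.
  by rewrite sumr_const card_ord -[leLHS]mulr_natl expr2 !mulrA.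
apply: ler_sum => l _; rewrite normrM ler_pM// ?norm_coord_le//.
rewrite (le_trans (ler_norm_sum _ _ _))//.
apply: (@le_trans _ _ (\sum_(k < n) `|B| * `|u|)); last first.
  by rewrite sumr_const card_ord -[leLHS]mulr_natl !mulrA.
by apply: ler_sum => k _; rewrite normrM mulrC ler_pM// ?norm_coord_le ?norm_entry_le.
Qed.

Lemma bilinB n (B B' : 'M[R]_n) (u v : 'rV[R]_n) :
  bilin (B - B') u v = bilin B u v - bilin B' u v.
Proof. by rewrite /bilin mulmxBr mulmxBl !mxE. Qed.

End NormBounds.

Lemma bilinZl (R : realType) n (B : 'M[R]_n) a (u v : 'rV[R]_n) :
  bilin B (a *: u) v = a * bilin B u v.
Proof. by rewrite -[a *: u]addr0 bilinPl bilin0l addr0. Qed.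

Lemma bilinZr (R : realType) n (B : 'M[R]_n) a (u v : 'rV[R]_n) :
  bilin B u (a *: v) = a * bilin B u v.
Proof. by rewrite -[a *: v]addr0 bilinPr bilin0r addr0. Qed.

(** [T'] and [T] stand for the Riemannian norms of one coordinate vector at the centre and at a
    nearby point, [U] for its sup norm. The squares differ by at most half of the lower bound
    (U/b)^2 of T'^2, so the other half survives. *)
Lemma norm_equiv_arith (R : realType) (a b U T T' : R) : 0 < a -> 1 <= b ->
  0 <= U -> 0 <= T -> 0 <= T' -> `|T' ^+ 2 - T ^+ 2| <= (2 * b ^+ 2)^-1 * U ^+ 2 ->
  T' <= a * U -> U <= b * T' ->
  T <= (a + 2 * b + 1) * U /\ U <= (a + 2 * b + 1) * T.
Proof.
move=> a0 b1 U0 T0 T'0 /ler_normlP[d1 d2] up lo.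
have b0 : 0 < b by lra.
have bb : 0 < 2 * b ^+ 2 by rewrite mulr_gt0// exprn_gt0.
have kE : (2 * b ^+ 2)^-1 * (2 * b ^+ 2) = 1 by rewrite mulVf// gt_eqF.
have k0 : 0 < (2 * b ^+ 2)^-1 by rewrite invr_gt0.
move: ((2 * b ^+ 2)^-1) kE k0 d1 d2 => k kE k0 d1 d2.
have bsq : 1 <= b ^+ 2 by rewrite exprn_ege1.
have k1 : k <= 1 by nra.
have U2 : 0 <= U ^+ 2 by rewrite sqr_ge0.
have upsq : T' ^+ 2 <= (a * U) ^+ 2 by rewrite ler_pXn2r// nnegrE mulr_ge0// ltW.
have losq : U ^+ 2 <= (b * T') ^+ 2 by rewrite ler_pXn2r// nnegrE mulr_ge0// ltW.
split.
  apply: (@le_trans _ _ ((a + 1) * U)); last by rewrite ler_wpM2r//; lra.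
  rewrite -(@ler_pXn2r _ 2)// ?nnegrE//; last by rewrite mulr_ge0//; lra.
  have : k * U ^+ 2 <= U ^+ 2 by rewrite ler_piMl.
  rewrite !exprMn in upsq *; move: (U ^+ 2) U2 upsq d1 => W W0 upsq d1 kW.
  have aW : 0 <= a * W by rewrite mulr_ge0// ltW.
  nra.
apply: (@le_trans _ _ (2 * b * T)); last by rewrite ler_wpM2r//; lra.
rewrite -(@ler_pXn2r _ 2)// ?nnegrE//; last by rewrite mulr_ge0//; lra.
have E : b ^+ 2 * (k * U ^+ 2) = 2^-1 * U ^+ 2.
  have -> : b ^+ 2 * (k * U ^+ 2) = 2^-1 * (k * (2 * b ^+ 2)) * U ^+ 2 by field.
  by rewrite kE mulr1.
have : b ^+ 2 * T' ^+ 2 <= b ^+ 2 * (T ^+ 2 + k * U ^+ 2).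
  by rewrite ler_wpM2l ?sqr_ge0//; lra.
rewrite mulrDr E; rewrite !exprMn in losq *.
have -> : 2 ^+ 2 * b ^+ 2 * T ^+ 2 = 4 * (b ^+ 2 * T ^+ 2) by ring.
have : 0 <= b ^+ 2 * T ^+ 2 by rewrite mulr_ge0 ?sqr_ge0.
by move: (b ^+ 2 * T ^+ 2) (b ^+ 2 * T' ^+ 2) losq => p q losq p0 H; lra.
Qed.

Lemma operator_bound_arith (R : realType) (K L w u v tw tu tv op s : R) :
  0 <= L -> 0 <= tw -> 0 <= tu -> 0 <= tv ->
  tw <= K * w -> tu <= K * u -> tv <= K * v -> s <= op * tu -> op <= L * tw ->
  s * tv <= L * K ^+ 3 * w * u * v.
Proof.
move=> L0 tw0 tu0 tv0 twK tuK tvK sop opL.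
apply: (@le_trans _ _ ((L * (K * w)) * (K * u) * (K * v))); last first.
  by rewrite le_eqVlt; apply/orP; left; apply/eqP; ring.
apply: (@le_trans _ _ (L * tw * tu * tv)).
  by rewrite ler_wpM2r// (le_trans sop)// ler_wpM2r.
by rewrite ler_pM// ?mulr_ge0// ler_pM// ?mulr_ge0// ler_wpM2l.
Qed.

(** * Comparison of Riemannian and coordinate norms *)

Section TangentNorm.
Context (R : realType) (n : nat) (M : topologicalType) (A : manifold R n M).
Context (G : riemannian A).
Implicit Types (c d : chart R n M) (x : M) (z u v w : 'rV[R]_n).

Lemma gram_bilin_at c z u v : atlas A c -> cran c z ->
  bilin (gram G c z) u v = ip G (cinv c z) (tvec A c z u) (tvec A c z v).
Proof. by move=> Ac [x cx <-]; rewrite (gram_bilin _ _ _ Ac cx) (cmapK Ac cx). Qed.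

Lemma ip_subl x a u v w y :
  ip G x (u - (a *: v + w)) y = ip G x u y - (a * ip G x v y + ip G x w y).
Proof. by rewrite -scaleN1r addrC /ip !bilinPl; ring. Qed.

(** Serves operators known only through their pairings, such as the difference of two Hessians in
    (A6), which must be linear for [opnorm] to bound them. *)
Lemma linear_of_ip x (S : 'rV[R]_n -> 'rV[R]_n) :
  (forall a u v y, ip G x (S (a *: u + v)) y = a * ip G x (S u) y + ip G x (S v) y) ->
  linear S.
Proof.
move=> H a u v; apply/eqP; rewrite -subr_eq0; apply/eqP.
by apply: (ip_nondeg (G := G) (x := x)) => y; rewrite ip_subl H subrr.
Qed.

Lemma tnormZ x a u : tnorm G x (a *: u) = `|a| * tnorm G x u.
Proof.
rewrite /tnorm /ip bilinZl bilinZr.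
by rewrite mulrA -expr2 sqrtrM ?sqr_ge0// sqrtr_sqr.
Qed.

Lemma tnorm0 x : tnorm G x 0 = 0.
Proof. by rewrite /tnorm /ip bilin0l sqrtr0. Qed.

Lemma tnorm_upper x : exists2 C : R, 0 < C & forall u, tnorm G x u <= C * `|u|.
Proof.
exists (n%:R ^+ 2 * `|metric G x| + 1) => [|u].
  by rewrite ltr_wpDl// mulr_ge0// exprn_ge0.
set K := n%:R ^+ 2 * _; have K0 : 0 <= K by rewrite mulr_ge0// exprn_ge0.
rewrite -(@ler_pXn2r _ 2)// ?nnegrE ?tnorm_ge0//; last first.
  by rewrite mulr_ge0// addr_ge0.
rewrite tnorm_sqr; have := bilin_norm_le (metric G x) u u; rewrite -/K.
move=> /(le_trans (ler_norm _)); rewrite -/(ip G x u u).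
move: (ip G x u u) => b; have := normr_ge0 u; move: (`|u|) => t t0 bt.
by rewrite exprMn (le_trans bt)// -mulrA -expr2 ler_wpM2r ?sqr_ge0//; nra.
Qed.

(** The i-th entry of u is its inner product with the i-th row of the inverse metric; Cauchy-Schwarz
    bounds it. *)
Lemma tnorm_lower x : exists2 C : R, 0 < C & forall u, `|u| <= C * tnorm G x u.
Proof.
pose b i := tnorm G x (basis_vec R i *m invmx (metric G x)).
exists (\sum_i b i + 1) => [|u].
  by rewrite ltr_wpDl// sumr_ge0// => i _; exact: tnorm_ge0.
have t0 := tnorm_ge0 G x u.
have S0 : 0 <= \sum_i b i by rewrite sumr_ge0// => i _; exact: tnorm_ge0.
apply: norm_row_le => [|i]; first by rewrite mulr_ge0// addr_ge0.
have -> : u 0 i = ip G x (basis_vec R i *m invmx (metric G x)) u.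
  rewrite /ip bilin_inv ?metric_unit// (bigD1 i)//= [X in _ + X]big1 ?addr0.
    by rewrite basis_vecE eqxx mul1r.
  by move=> j ji; rewrite basis_vecE (negbTE ji) mul0r.
rewrite (le_trans (ip_CS _ _ _ _))// ler_wpM2r// -/(b i) (bigD1 i)//=.
by rewrite -addrA lerDl addr_ge0// sumr_ge0// => j _; exact: tnorm_ge0.
Qed.

Lemma tnorm_eq0 x u : tnorm G x u = 0 -> u = 0.
Proof.
move=> u0; have [C _ /(_ u)] := tnorm_lower x.
by rewrite u0 mulr0 normr_le0 => /eqP.
Qed.

Lemma opnorm_bound x (S : 'rV[R]_n -> 'rV[R]_n) u : linear S ->
  tnorm G x (S u) <= opnorm G x S * tnorm G x u.
Proof.
move=> lS; have [t0|t0] := eqVneq (tnorm G x u) 0.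
  have S0 : S 0 = 0.
    by have := lS (-1) 0 0; rewrite scaler0 addr0 scaleN1r addNr.
  by rewrite (tnorm_eq0 t0) S0 tnorm0 mulr0.
have tp : 0 < tnorm G x u by rewrite lt_def t0 tnorm_ge0.
rewrite -ler_pdivrMr//.
have -> : tnorm G x (S u) / tnorm G x u = tnorm G x (S ((tnorm G x u)^-1 *: u)).
  have SZ a w : S (a *: w) = a *: S w.
    have S0 : S 0 = 0.
      by have := lS (-1) 0 0; rewrite scaler0 addr0 scaleN1r addNr.
    by rewrite -[a *: w]addr0 lS S0 addr0.
  by rewrite SZ tnormZ ger0_norm ?invr_ge0 ?tnorm_ge0// mulrC.
apply: ub_le_sup; last first.
  exists ((tnorm G x u)^-1 *: u) => //=.
  by rewrite tnormZ ger0_norm ?invr_ge0 ?tnorm_ge0// mulVf.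
(* The supremum defining [opnorm] dominates the members of the set only once the set is known to be
   bounded. *)
have [C C0 HC] := tnorm_upper x; have [D D0 HD] := tnorm_lower x.
exists (C * ((\sum_i `|S (basis_vec R i)|) * (D * 1))) => _ [w /= w1 <-].
rewrite (le_trans (HC _))// ler_wpM2l ?(ltW C0)//.
rewrite (le_trans (linear_row_bounded w lS))// ler_wpM2l ?sumr_ge0//.
by rewrite (le_trans (HD _))// ler_wpM2l// ltW.
Qed.

(** [tvec A c z] need not depend continuously on z, but the square of the norm is the quadratic form
    of the Gram matrix, which does; the norms at z are compared with those at the centre through
    it. *)
Lemma tvec_norm_equiv c x : atlas A c -> cdom c x ->
  exists2 K : R, 0 < K & \forall z \near cmap c x, forall u,
    tnorm G (cinv c z) (tvec A c z u) <= K * `|u| /\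
    `|u| <= K * tnorm G (cinv c z) (tvec A c z u).
Proof.
move=> Ac cx; have cz := cran_cmap cx.
have [C C0 HC] := tnorm_upper x; have [D D0 HD] := tnorm_lower x.
pose t := \sum_i `|tvec A c (cmap c x) (basis_vec R i)|.
pose s := \sum_i `|tcov A c x (basis_vec R i)|.
have t0 : 0 <= t by rewrite sumr_ge0.
have s0 : 0 <= s by rewrite sumr_ge0.
have up u : tnorm G x (tvec A c (cmap c x) u) <= C * t * `|u|.
  rewrite (le_trans (HC _))// -mulrA ler_wpM2l ?(ltW C0)//.
  exact: linear_row_bounded (tvec_linear Ac cx).
have lo u : `|u| <= s * D * tnorm G x (tvec A c (cmap c x) u).
  rewrite -{1}(tcovK u Ac cx) (le_trans (linear_row_bounded _ (tcov_linear Ac cx)))//.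
  by rewrite -mulrA ler_wpM2l.
pose a := C * t + 1; pose b := s * D + 1.
have a0 : 0 < a by rewrite ltr_wpDl// mulr_ge0// ltW.
have b0 : 0 < b by rewrite ltr_wpDl// mulr_ge0// ltW.
(* [bilin_norm_le] costs a factor n^2; this precision on the Gram matrix leaves the (2b^2)^-1 that
   [norm_equiv_arith] asks for. *)
pose e := (2 * b ^+ 2 * (n%:R ^+ 2 + 1))^-1.
have nn : 0 < (n%:R : R) ^+ 2 + 1 by rewrite ltr_wpDl// exprn_ge0.
have e0 : 0 < e by rewrite invr_gt0 !mulr_gt0// exprn_gt0.
have cg : {for cmap c x, continuous (gram G c)}.
  apply: differentiable_continuous; have [dg _] := metric_smooth G Ac 1%N; exact: dg.
have /cvgrPdist_le/(_ _ e0) := cg => Hg.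
exists (a + 2 * b + 1); first by move: a0 b0; clearbody a b => ? ?; lra.
apply: filterS2 Hg (near_cran Ac cz) => z ge czz u.
have zd := cdom_cinv Ac czz.
have tE : tnorm G (cinv c z) (tvec A c z u) ^+ 2 = bilin (gram G c z) u u.
  by rewrite tnorm_sqr (gram_bilin_at _ _ Ac czz).
have tE' : tnorm G x (tvec A c (cmap c x) u) ^+ 2 = bilin (gram G c (cmap c x)) u u.
  by rewrite tnorm_sqr (gram_bilin G u u Ac cx).
have dB : `|tnorm G x (tvec A c (cmap c x) u) ^+ 2 - tnorm G (cinv c z) (tvec A c z u) ^+ 2|
    <= (2 * b ^+ 2)^-1 * `|u| ^+ 2.
  rewrite [X in X - _]tE' [X in _ - X]tE -bilinB (le_trans (bilin_norm_le _ _ _))// -mulrA -expr2 ler_wpM2r ?sqr_ge0//.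
  apply: (@le_trans _ _ ((n%:R ^+ 2 + 1) * e)).
    by rewrite ler_pM// ?exprn_ge0// lerDl.
  by rewrite /e invfM mulrC -mulrA mulVf ?mulr1// gt_eqF.
apply: norm_equiv_arith (normr_ge0 u) (tnorm_ge0 _ _ _) (tnorm_ge0 _ _ _) dB _ _ => //.
- by rewrite lerDr mulr_ge0// ltW.
- by rewrite (le_trans (up u))// ler_wpM2r// lerDl.
- by rewrite (le_trans (lo u))// ler_wpM2r ?tnorm_ge0// lerDl.
Qed.

End TangentNorm.

(** * Hessians of pullbacks and (A6) in a chart *)

Section PullbackHessian.
Context (R : realType) (n : nat) (M : topologicalType) (A : manifold R n M).
Context (G : riemannian A) (Rt : retraction A).
Implicit Types (c d : chart R n M) (x : M) (z u v w : 'rV[R]_n).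

(** On a single tangent space the inverse metric is a constant linear map, so it commutes with the
    derivative and cancels against the inner product. *)
Lemma ip_ehess (F : 'rV[R]_n -> R) (U : set 'rV[R]_n) x xi u eta : open U -> U xi ->
  (forall y, U y -> differentiable F y) ->
  (forall w y, U y -> differentiable ('D_w F) y) ->
  ip G x (ehess G x F xi u) eta = 'D_u ('D_eta F) xi.
Proof.
move=> oU Uxi dF d2F.
pose r t : 'rV[R]_n := \row_i 'D_(basis_vec R i) F t.
have dr : derivable r xi u.
  apply/derivable_mxP => i j; rewrite ord1.
  under eq_fun do rewrite mxE.
  by apply: diff_derivable; exact: d2F.
rewrite /ehess.
have -> : egrad G x F = (fun t => mulmxr (invmx (metric G x)) (r t)) by [].
rewrite (derive_postcomp_linear (L := mulmxr (invmx (metric G x)))) //; last first.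
  exact: linear_row_continuous.
rewrite /ip /= bilin_inv ?metric_unit// (derive2_row_basis u eta oU Uxi dF d2F).
apply: eq_bigr => i _; rewrite -derive_coord//.
under eq_fun do rewrite mxE.
by rewrite mulrC.
Qed.

Lemma phi_differentiable (f : M -> R) c z u : C2M A f -> atlas A c -> rdom Rt c z u ->
  differentiable (phi Rt f c z) u.
Proof.
move=> Cf Ac Du.
apply: (differentiable_comp2 (@rho_C2on R n M A Rt c z Ac) (Cf _ Ac) _ Du) => y.
exact: rho_cran.
Qed.

Lemma phi_differentiable2 (f : M -> R) c z u v : C2M A f -> atlas A c -> rdom Rt c z u ->
  differentiable ('D_v (phi Rt f c z)) u.
Proof.
move=> Cf Ac Du.
apply: (differentiable_derive_comp (@rdom_open R n M A Rt c z Ac) (@rho_C2on R n M A Rt c z Ac) (Cf _ Ac) _ v Du) => y.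
exact: rho_cran.
Qed.

Lemma ip_ehess_pullback (f : M -> R) c x w u v : C2M A f -> atlas A c -> cdom c x ->
  rdom Rt c (cmap c x) w ->
  ip G x (ehess G x (f \o Rt x) (tvec A c (cmap c x) w) (tvec A c (cmap c x) u))
     (tvec A c (cmap c x) v) = 'D_u ('D_v (phi Rt f c (cmap c x))) w.
Proof.
move=> Cf Ac cx Dw; rewrite -(pullback_phi2 f u v Ac cx Dw).
(* An open set of stored tangent vectors on which [f \o Rt x] is [phi] after the linear map [tcov],
   and is therefore regular. *)
pose U : set 'rV[R]_n := [set xi | rdom Rt c (cmap c x) (tcov A c x xi)].
have dS xi : differentiable (tcov A c x) xi.
  exact: linear_row_differentiable (tcov_linear Ac cx).
have oU : open U.
  apply: (@open_comp _ _ (tcov A c x) (rdom Rt c (cmap c x))); last exact: rdom_open.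
  by move=> xi _; exact/differentiable_continuous.
have E xi eta : U xi -> 'D_eta (f \o Rt x) xi =
    'D_(tcov A c x eta) (phi Rt f c (cmap c x)) (tcov A c x xi).
  by move=> Uxi; rewrite -(pullback_phi f _ Ac cx Uxi) !(tvecK _ Ac cx).
apply: (ip_ehess (U := U)); first exact: oU.
- by rewrite /U /= (tcovK _ Ac cx).
- move=> xi Uxi; apply: (near_eq_differentiable (f := phi Rt f c (cmap c x) \o tcov A c x)).
    apply: (near_open oU Uxi) => t Ut.
    by rewrite /phi /= (cinv_rho Ac Ut) (cmapK Ac cx) (tvecK _ Ac cx).
  by apply: differentiable_comp => //; exact: phi_differentiable.
- move=> eta xi Uxi.
  apply: (near_eq_differentiable
    (f := 'D_(tcov A c x eta) (phi Rt f c (cmap c x)) \o tcov A c x)).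
    by apply: (near_open oU Uxi) => t Ut; rewrite E.
  by apply: differentiable_comp => //; exact: phi_differentiable2.
Qed.

(** The domain of the retraction is open in the bundle chart at (z, 0), which gives one radius for
    all base points near z. *)
Lemma rdom_near c z : atlas A c -> cran c z -> exists2 r : R, 0 < r &
  forall z' w, `|z' - z| < r -> `|w| < r -> rdom Rt c z' w.
Proof.
move=> Ac cz; have [oD _] := retr_smooth Rt Ac Ac.
have /near_ball[d [d0 H]] : \forall y \near row_mx z (0 : 'rV[R]_n), retr_dom A Rt c c y.
  by apply: near_open oD (rdom0 Rt Ac cz) _.
exists d => // z' w zz w0; apply: H.
have -> : row_mx z' w - row_mx z 0 = row_mx (z' - z) w.
  by rewrite opp_row_mx oppr0 add_row_mx addr0.
exact: norm_row_mx.
Qed.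

Lemma pullback_lipschitz_coord (f : M -> R) c x : C2M A f -> atlas A c -> cdom c x ->
  pullback_hess_lipschitz G Rt f x ->
  exists L r : R, [/\ 0 < L, 0 < r & forall z w u v, `|z - cmap c x| < r -> `|w| < r ->
    `|'D_u ('D_v (phi Rt f c z)) w - 'D_u ('D_v (phi Rt f c z)) 0| <= L * `|w| * `|u| * `|v|].
Proof.
move=> Cf Ac cx [L [L0 [r [r0 HL]]]]; have cz := cran_cmap cx.
have [K K0 HK] := tvec_norm_equiv G Ac cx.
have [d d0 Hd] := rdom_near Ac cz.
have HL' : \forall z \near cmap c x, forall xi, tnorm G (cinv c z) xi < r ->
    opnorm G (cinv c z) (fun u => ehess G (cinv c z) (f \o Rt (cinv c z)) xi u
       - ehess G (cinv c z) (f \o Rt (cinv c z)) 0 u) <= L * tnorm G (cinv c z) xi.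
  pose P y := forall xi, tnorm G y xi < r ->
    opnorm G y (fun u => ehess G y (f \o Rt y) xi u - ehess G y (f \o Rt y) 0 u)
      <= L * tnorm G y xi.
  have HP : \forall y \near cinv c (cmap c x), P y by rewrite (cmapK Ac cx).
  exact: (cinv_continuous Ac cz HP).
have [e [e0 He]] := near_ball (filterI HK (filterI HL' (near_cran Ac cz))).
exists (L * K ^+ 3), (Num.min (Num.min d e) (r / K)); split.
- by rewrite mulr_gt0// exprn_gt0.
- by rewrite !lt_min d0 e0 divr_gt0.
move=> z w u v; rewrite !lt_min -!andbA => /and3P[zd ze _] /and3P[wd _ wr].
have [HKz [HLz czz]] := He _ ze.
have xd := cdom_cinv Ac czz.
have zE := cinvK Ac czz.
have Dwz : rdom Rt c z w by exact: Hd.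
have D0z : rdom Rt c z 0 by exact: rdom0.
have Dw : rdom Rt c (cmap c (cinv c z)) w by rewrite zE.
have D0 : rdom Rt c (cmap c (cinv c z)) 0 by rewrite zE.
have T0 : tvec A c z 0 = 0 by exact: tvec0.
pose x' := cinv c z.
(* The operator whose norm (A6) bounds; [g] is its bilinear form in the chart, and linearity of S is
   read off from g. *)
pose S u : 'rV[R]_n := ehess G x' (f \o Rt x') (tvec A c z w) u - ehess G x' (f \o Rt x') 0 u.
pose g u1 v1 := 'D_u1 ('D_v1 (phi Rt f c z)) w - 'D_u1 ('D_v1 (phi Rt f c z)) 0.
have ipS u1 v1 : ip G x' (S (tvec A c z u1)) (tvec A c z v1) = g u1 v1.
  have := ip_ehess_pullback u1 v1 Cf Ac xd Dw.
  have := ip_ehess_pullback u1 v1 Cf Ac xd D0.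
  rewrite /g !zE T0 => <- <-.
  by rewrite /S /ip -scaleN1r addrC bilinPl mulN1r addrC.
have glin a u1 u2 v1 : g (a *: u1 + u2) v1 = a * g u1 v1 + g u2 v1.
  have d0' : differentiable ('D_v1 (phi Rt f c z)) 0.
    exact: (phi_differentiable2 v1 Cf Ac D0z).
  have dw' : differentiable ('D_v1 (phi Rt f c z)) w.
    exact: (phi_differentiable2 v1 Cf Ac Dwz).
  rewrite /g (derivable_diff_linear _ _ _ d0') (derivable_diff_linear _ _ _ dw').
  move: ('D_u1 _ w) ('D_u1 _ 0) ('D_u2 _ w) ('D_u2 _ 0) => p q p' q'.
  by rewrite /GRing.scale /=; ring.
rewrite -/(g u v); clearbody g.
have Tsurj y : exists y', tvec A c z y' = y.
  by exists (tcov A c x' y); rewrite -{1}zE (tvecK _ Ac xd).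
have Tlin := tvec_linear Ac xd; rewrite zE in Tlin.
have lS : linear S.
  clearbody S.
  have lin a u1 u2 v1 : ip G x' (S (tvec A c z (a *: u1 + u2))) (tvec A c z v1) =
     a * ip G x' (S (tvec A c z u1)) (tvec A c z v1) + ip G x' (S (tvec A c z u2)) (tvec A c z v1).
    apply: (etrans (ipS _ _)); apply: (etrans (glin _ _ _ _)).
    by apply: congr2; [apply: congr1|]; exact/esym/ipS.
  apply: (linear_of_ip (G := G) (x := x')) => a s1 s2 y.
  have [y' <-] := Tsurj y; have [s1' <-] := Tsurj s1; have [s2' <-] := Tsurj s2.
  by have := lin a s1' s2' y'; rewrite Tlin.
rewrite -ipS (le_trans (ip_CS _ _ _ _))//.
have [tw _] := HKz w; have [tu _] := HKz u; have [tv _] := HKz v.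
have twr : tnorm G x' (tvec A c z w) < r.
  by rewrite (le_lt_trans tw)// mulrC -ltr_pdivlMr.
have op := HLz _ twr.
have Sop := opnorm_bound G x' (tvec A c z u) lS.
exact: (operator_bound_arith (ltW L0) (tnorm_ge0 _ _ _) (tnorm_ge0 _ _ _)
  (tnorm_ge0 _ _ _) tw tu tv Sop op).
Qed.

End PullbackHessian.

Lemma near_forall (T : topologicalType) (I : finType) (P : I -> T -> Prop) (x : T) :
  (forall i, \forall y \near x, P i y) -> \forall y \near x, forall i, P i y.
Proof. by move=> H; apply: filter_forall => i; exact: H. Qed.

Lemma near_and (T : topologicalType) (P Q : T -> Prop) (x : T) :
  (\forall y \near x, P y) -> (\forall y \near x, Q y) -> \forall y \near x, P y /\ Q y.
Proof. by move=> HP HQ; apply: filterI. Qed.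

(** * Taylor expansion of pullbacks, uniform in the base point *)

Section Taylor.
Context (R : realType) (n : nat) (M : topologicalType) (A : manifold R n M).
Context (G : riemannian A) (Rt : retraction A).
Context (c : chart R n M) (xs : M) (Ac : atlas A c) (cxs : cdom c xs).
Implicit Types (z u v w : 'rV[R]_n) (f : M -> R).
Let zs := cmap c xs.
Let czs : cran c zs. Proof. exact: cran_cmap. Qed.
Let rt := cmap c \o retr_in A Rt c.

Let rt_C2 : C2on (retr_dom A Rt c c) rt.
Proof. by have [oD /(_ 2%N)] := retr_smooth Rt Ac Ac; exact: Ck2_C2on. Qed.

Let derive_rho_rt z u v : 'D_v (rho Rt c z) u = 'D_(row_mx 0 v) rt (row_mx z u).
Proof. exact: (@derive_row_mx_right R n n _ rt z u v). Qed.

Lemma derive_phi f z u v : C2M A f -> rdom Rt c z u ->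
  'D_v (phi Rt f c z) u = 'D_('D_v (rho Rt c z) u) (f \o cinv c) (rho Rt c z u).
Proof.
move=> Cf Du; apply: derive_comp.
  by have [dr _ _] := @rho_C2on R n M A Rt c z Ac; exact: dr.
by have [df _ _] := Cf _ Ac; apply: df; exact: rho_cran.
Qed.

Lemma derive_phi0 f z v : C2M A f -> cran c z ->
  'D_v (phi Rt f c z) 0 = 'D_v (f \o cinv c) z.
Proof.
move=> Cf cz; rewrite (derive_phi v Cf (rdom0 Rt Ac cz)).
by rewrite (derive_rho0 _ _ Ac cz) (rho0 _ Ac cz).
Qed.

(** The derivative of the retraction is the identity at (x*, 0) and is continuous jointly in base
    point and vector; 1/2 is what [covector_bound] can absorb. *)
Lemma derive_rho_near : exists2 r : R, 0 < r & forall z u v,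
  `|z - zs| < r -> `|u| < r -> rdom Rt c z u /\ `|'D_v (rho Rt c z) u - v| <= 2^-1 * `|v|.
Proof.
have [d d0 Hd] := rdom_near Rt Ac czs.
(* The deviation on v is at most the sum of the n deviations on basis vectors times |v|, hence below
   |v| / 2. *)
pose e : R := (2 * (n%:R + 1))^-1.
have n1 : 0 < n%:R + 1 :> R by rewrite ltr_wpDl.
have e0 : 0 < e by rewrite invr_gt0 mulr_gt0.
have H b : \forall y \near row_mx zs (0 : 'rV[R]_n),
    `|'D_(row_mx 0 (basis_vec R b)) rt y - basis_vec R b| <= e.
  have cD : {for row_mx zs (0 : 'rV[R]_n), continuous ('D_(row_mx 0 (basis_vec R b)) rt)}.
    apply: differentiable_continuous; have [_ d2 _] := rt_C2; apply: d2.
    exact: (rdom0 Rt Ac czs).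
  have := cD; rewrite /prop_for /continuous_at -derive_rho_rt (derive_rho0 _ _ Ac czs).
  by move=> /cvgrPdist_le/(_ _ e0); apply: filterS => y; rewrite distrC.
have /near_ball[r [r0 Hr]] : \forall y \near row_mx zs (0 : 'rV[R]_n), forall b,
    `|'D_(row_mx 0 (basis_vec R b)) rt y - basis_vec R b| <= e.
  exact: near_forall H.
exists (Num.min d r); first by rewrite lt_min d0.
move=> z u v; rewrite !lt_min => /andP[zd zr] /andP[ud ur].
have Du : rdom Rt c z u by exact: Hd.
split=> //.
have lD : linear (fun v => 'D_v (rho Rt c z) u - v).
  move=> a v1 v2; rewrite derivable_diff_linear; last first.
    by have [dr _ _] := @rho_C2on R n M A Rt c z Ac; exact: dr.
  by move: ('D_v1 _ u) ('D_v2 _ u) => p q; rewrite scalerBr opprD addrACA.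
rewrite (le_trans (linear_row_bounded v lD))// ler_wpM2r//.
apply: (@le_trans _ _ (\sum_(b < n) e)).
  apply: ler_sum => b _; rewrite derive_rho_rt; apply: Hr.
  have -> : row_mx z u - row_mx zs 0 = row_mx (z - zs) u.
    by rewrite opp_row_mx oppr0 add_row_mx addr0.
  exact: norm_row_mx.
rewrite sumr_const card_ord -[leLHS]mulr_natl /e invfM mulrCA -[leRHS]mulr1 ler_wpM2l//.
by rewrite ler_pdivrMr// mul1r lerDl.
Qed.

Lemma rho_near : exists2 r : R, 0 < r & forall z u,
  `|z - zs| < r -> `|u| < r -> rdom Rt c z u /\ `|rho Rt c z u - z| <= 2 * `|u|.
Proof.
have [r r0 Hr] := derive_rho_near; exists r => // z u zr ur.
have [Du _] := Hr z u 0 zr ur; split=> //.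
have /rdomE[cz _] := Du.
have tr t : 0 <= t <= 1 -> `|0 + t *: u| < r.
  move=> /andP[t0 t1]; rewrite add0r normrZ ger0_norm// (le_lt_trans _ ur)//.
  by rewrite ler_piMl.
apply: norm_row_le => [|i]; first by rewrite mulr_ge0.
have [dr _ _] := @rho_C2on R n M A Rt c z Ac.
have dseg (t : R) : 0 <= t <= 1 -> differentiable (fun y => rho Rt c z y 0 i) (0 + t *: u).
  move=> t01; apply: (differentiable_rowE (f := rho Rt c z)); apply: dr.
  by have [] := Hr z (0 + t *: u) 0 zr (tr t t01).
have [t t01] := mean_value_line dseg.
have t01' : 0 <= t <= 1 by case/andP: t01 => ? ?; rewrite !ltW.
have [Dt Ht] := Hr z (0 + t *: u) u zr (tr t t01').
rewrite add0r (rho0 Rt Ac cz) (derive_coord (f := rho Rt c z)); last first.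
  by apply: diff_derivable; exact: dr.
move=> E; have -> : (rho Rt c z u - z) 0 i = rho Rt c z u 0 i - z 0 i by rewrite !mxE.
rewrite E (le_trans (norm_coord_le _ _))//.
rewrite -(subrK u ('D_u _ _)) (le_trans (ler_normD _ _))//.
move: (`|u|) (normr_ge0 u) Ht => U U0 Ht.
by rewrite (le_trans (lerD Ht (lexx _)))//; lra.
Qed.

Lemma Qf_linear z v a u u' : cran c z ->
  Qf Rt c z (a *: u + u') v = a *: Qf Rt c z u v + Qf Rt c z u' v.
Proof.
move=> cz; apply: derivable_diff_linear.
by have [_ d2 _] := @rho_C2on R n M A Rt c z Ac; apply: d2; exact: rdom0.
Qed.

Lemma Qf_basis z u v : cran c z ->
  Qf Rt c z u v = \sum_b v 0 b *: Qf Rt c z u (basis_vec R b).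
Proof.
move=> cz; rewrite /Qf.
exact: (derive2_bilinear u v (@rdom_open R n M A Rt c z Ac) (@rho_C2on R n M A Rt c z Ac) (rdom0 Rt Ac cz)).
Qed.

Lemma Hf_linear f z v a u u' : C2M A f -> cran c z ->
  Hf Rt f c z (a *: u + u') v = a * Hf Rt f c z u v + Hf Rt f c z u' v.
Proof.
move=> Cf cz; have [df d2f _] := Cf _ Ac.
rewrite /Hf Qf_linear// (derivable_diff_linear _ _ _ (d2f v _ cz)).
rewrite (derivable_diff_linear _ _ _ (df _ cz)) /GRing.scale /= mulrDr.
exact: addrACA.
Qed.

Lemma Hf_basis f z u v : C2M A f -> cran c z ->
  Hf Rt f c z u v = \sum_b v 0 b * Hf Rt f c z u (basis_vec R b).
Proof.
move=> Cf cz; have [df d2f _] := Cf _ Ac.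
rewrite /Hf (derive2_bilinear u v (cran_open Ac) (Cf _ Ac) cz) (Qf_basis _ _ cz).
under [in RHS]eq_bigr do rewrite mulrDr.
rewrite big_split /=; congr (_ + _).
rewrite deriveE; last exact: df.
rewrite linear_sum; apply: eq_bigr => b _.
by rewrite linearZ /= -deriveE//; exact: df.
Qed.

(** [Qf] is a second derivative of the retraction in the bundle chart, along (0, u) and (0, v) at
    (z, 0), and so is continuous in z. *)
Lemma Hf_continuous f u v : C2M A f -> {for zs, continuous (fun z => Hf Rt f c z u v)}.
Proof.
move=> Cf; have [df d2f c2f] := Cf _ Ac.
have cQ : {for zs, continuous (fun z => Qf Rt c z u v)}.
  have -> : (fun z => Qf Rt c z u v) =
      (fun z => 'D_(row_mx 0 u) ('D_(row_mx 0 v) rt) (row_mx z 0)).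
    apply/funext => z; rewrite /Qf -(@derive_row_mx_right R n n _ ('D_(row_mx 0 v) rt) z 0 u).
    have E : 'D_v (rho Rt c z) = (fun u0 => 'D_(row_mx 0 v) rt (row_mx z u0)).
      by apply/funext => y; exact: derive_rho_rt.
    exact: (congr1 (fun g => derive g 0 u) E).
  apply: (@continuous_comp _ _ _ (fun z => row_mx z 0)
     ('D_(row_mx 0 u) ('D_(row_mx 0 v) rt))); last first.
    by have [_ _ c2] := rt_C2; apply: c2; exact: (rdom0 Rt Ac czs).
  apply: differentiable_continuous; apply: linear_row_differentiable => a s t.
  by rewrite scale_row_mx add_row_mx scaler0 addr0.
have E z : cran c z -> 'D_u ('D_v (f \o cinv c)) z +
    \sum_b (Qf Rt c z u v) 0 b * 'D_(basis_vec R b) (f \o cinv c) z = Hf Rt f c z u v.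
  by move=> cz; rewrite /Hf (derive_row_basis (Qf Rt c z u v))//; exact: df.
apply: near_eq_continuous (near_open (cran_open Ac) czs E) _.
apply: (@continuousD _ _ _ ('D_u ('D_v (f \o cinv c)))); first exact: c2f.
apply: continuous_fsum => b.
apply: (@continuousM _ _ (fun z => (Qf Rt c z u v) 0 b)).
  apply: (@continuous_comp _ _ _ (fun z => Qf Rt c z u v) (fun N : 'rV[R]_n => N 0 b)) => //.
  exact: coord_continuous.
by apply: differentiable_continuous; exact: d2f.
Qed.

Lemma Hf_bound f : C2M A f -> exists B r : R, [/\ 0 < B, 0 < r & forall z u v,
  `|z - zs| < r -> `|Hf Rt f c z u v| <= B * `|u| * `|v|].
Proof.
move=> Cf.
pose h z a b := Hf Rt f c z (basis_vec R a) (basis_vec R b).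
have H ab : \forall z \near zs, `|h z ab.1 ab.2| <= `|h zs ab.1 ab.2| + 1.
  have /cvgrPdist_le/(_ _ ltr01) := @Hf_continuous f (basis_vec R ab.1) (basis_vec R ab.2) Cf.
  apply: filterS => z; rewrite distrC => hz.
  rewrite -[X in `|X| <= _](subrK (h zs ab.1 ab.2)) (le_trans (ler_normD _ _))//.
  by rewrite addrC lerD2l.
have /near_ball[r [r0 Hr]] := near_and (near_cran Ac czs) (near_forall H).
pose B := \sum_b \sum_a (`|h zs a b| + 1).
have B0 : 0 <= B by rewrite sumr_ge0// => b _; rewrite sumr_ge0// => a _; rewrite addr_ge0.
exists (B + 1), r; split=> //; first by rewrite ltr_wpDl.
move=> z u v /Hr[cz hz].
rewrite (Hf_basis _ _ Cf cz) (le_trans (ler_norm_sum _ _ _))//.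
apply: (@le_trans _ _ (B * `|u| * `|v|)); last by rewrite !ler_wpM2r// lerDl.
rewrite /B !mulr_suml; apply: ler_sum => b _.
rewrite normrM mulrC ler_pM ?norm_coord_le//.
have lH : linear (fun u => Hf Rt f c z u (basis_vec R b)).
  by move=> a s t; exact: Hf_linear.
rewrite (le_trans (linear_row_bounded u lH))// ler_wpM2r//.
by apply: ler_sum => a _; exact: (hz (a, b)).
Qed.

(** Mean value theorem for ['D_v (phi f c z)] between 0 and u: its value at 0 is ['D_v f], its
    derivative at 0 is [Hf], and (A6) bounds the change of that derivative. All second derivatives
    involved have the same base point z. *)
Lemma taylor_derive f : C2M A f -> pullback_hess_lipschitz G Rt f xs ->
  exists L r : R, [/\ 0 < L, 0 < r & forall z u v, `|z - zs| < r -> `|u| < r ->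
    `|'D_v (phi Rt f c z) u - 'D_v (f \o cinv c) z - Hf Rt f c z u v| <= L * `|u| ^+ 2 * `|v|].
Proof.
move=> Cf Lf; have [L [r [L0 r0 HL]]] := pullback_lipschitz_coord Cf Ac cxs Lf.
have [d d0 Hd] := rdom_near Rt Ac czs.
exists L, (Num.min d r); split=> //; first by rewrite lt_min d0.
move=> z u v; rewrite !lt_min => /andP[zd zr] /andP[ud ur].
have /rdomE[cz _] := Hd _ _ zd ud.
have tb t q : 0 <= t <= 1 -> `|u| < q -> `|0 + t *: u| < q.
  move=> /andP[t0 t1] uq; rewrite add0r normrZ ger0_norm// (le_lt_trans _ uq)//.
  by rewrite ler_piMl.
have dseg (t : R) : 0 <= t <= 1 -> differentiable ('D_v (phi Rt f c z)) (0 + t *: u).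
  by move=> t01; exact: (phi_differentiable2 v Cf Ac (Hd _ _ zd (tb _ _ t01 ud))).
have [t t01 E] := mean_value_line dseg.
have t01' : 0 <= t <= 1 by case/andP: t01 => ? ?; rewrite !ltW.
have := HL z (0 + t *: u) u v zr (tb _ _ t01' ur).
rewrite -E (derive_phi0 v Cf cz) (phi_derive2_0 Rt u v Cf Ac cz) !add0r => H.
apply: (le_trans H); rewrite normrZ ger0_norm; last by case/andP: t01'.
rewrite ler_wpM2r// -mulrA ler_wpM2l ?(ltW L0)// expr2 ler_wpM2r// ler_piMl//.
by case/andP: t01'.
Qed.

(** A mean value of the pullback, with the derivative at the intermediate point expanded by
    [taylor_derive]. The Hessian term is merely bounded, since the constraints need only a quadratic
    error. *)
Lemma taylor_value f : C2M A f -> pullback_hess_lipschitz G Rt f xs ->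
  exists L r : R, [/\ 0 < L, 0 < r & forall z u, `|z - zs| < r -> `|u| < r ->
    `|phi Rt f c z u - (f \o cinv c) z - 'D_u (f \o cinv c) z| <= L * `|u| ^+ 2].
Proof.
move=> Cf Lf; have [L [r [L0 r0 HL]]] := taylor_derive Cf Lf.
have [B [s [B0 s0 HB]]] := Hf_bound Cf.
have [d d0 Hd] := rdom_near Rt Ac czs.
exists (L + B), (Num.min (Num.min d r) (Num.min s 1)); split; first by rewrite addr_gt0.
  by rewrite !lt_min d0 r0 s0 ltr01.
move=> z u; rewrite !lt_min -!andbA => /and4P[zd zr zs' _] /and4P[ud ur us u1].
have /rdomE[cz _] := Hd _ _ zd ud.
have tb t q : 0 <= t <= 1 -> `|u| < q -> `|0 + t *: u| < q.
  move=> /andP[t0 t1] uq; rewrite add0r normrZ ger0_norm// (le_lt_trans _ uq)//.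
  by rewrite ler_piMl.
have dseg (t : R) : 0 <= t <= 1 -> differentiable (phi Rt f c z) (0 + t *: u).
  by move=> t01; exact: (phi_differentiable Cf Ac (Hd _ _ zd (tb _ _ t01 ud))).
have [t t01] := mean_value_line dseg.
have t01' : 0 <= t <= 1 by case/andP: t01 => ? ?; rewrite !ltW.
have := HL z (0 + t *: u) u zr (tb _ _ t01' ur).
have := HB z (0 + t *: u) u zs'.
have -> : phi Rt f c z 0 = (f \o cinv c) z by rewrite /phi /= (rho0 Rt Ac cz).
rewrite !add0r normrZ ger0_norm; last by case/andP: t01'.
move=> Hb Hl ->.
move: ('D_u (phi Rt f c z) _) ('D_u (f \o cinv c) z) (Hf _ _ _ _ _ _) Hb Hl => p q h Hb Hl.
rewrite -(subrK h (p - q)) (le_trans (ler_normD _ _))// mulrDl.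
case/andP: t01' => t0 t1; have U0 := normr_ge0 u.
move: `|u| (ltW u1) U0 Hb Hl => U U1 U0 Hb Hl.
have tU : t * U <= U by rewrite ler_piMl.
have tU0 : 0 <= t * U by rewrite mulr_ge0.
apply: lerD.
  apply: (le_trans Hl); rewrite -mulrA ler_wpM2l ?(ltW L0)//.
  apply: (@le_trans _ _ (U ^+ 2 * 1)); last by rewrite mulr1.
  by rewrite ler_pM ?sqr_ge0// ler_pXn2r.
by apply: (le_trans Hb); rewrite -mulrA ler_wpM2l ?(ltW B0)// expr2 ler_wpM2r.
Qed.

End Taylor.

(** * Primal-dual triples *)

Section Triples.
Context (R : realType) (n m p : nat).
Notation V := (incr R n m p).
Implicit Types (d : V).

Lemma norm_tripleE d : `|d| = Num.max (Num.max `|d.1.1| `|d.1.2|) `|d.2|.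
Proof. by rewrite !prod_normE. Qed.

Lemma norm_triple_le d (B : R) :
  (`|d| <= B) = [&& `|d.1.1| <= B, `|d.1.2| <= B & `|d.2| <= B].
Proof. by rewrite norm_tripleE !ge_max andbA. Qed.

Lemma norm_triple_lt d (B : R) :
  (`|d| < B) = [&& `|d.1.1| < B, `|d.1.2| < B & `|d.2| < B].
Proof. by rewrite norm_tripleE !gt_max andbA. Qed.

Lemma norm_triple1 d : `|d.1.1| <= `|d|.
Proof. by have := lexx `|d|; rewrite norm_triple_le => /and3P[]. Qed.
Lemma norm_triple2 d : `|d.1.2| <= `|d|.
Proof. by have := lexx `|d|; rewrite norm_triple_le => /and3P[]. Qed.
Lemma norm_triple3 d : `|d.2| <= `|d|.
Proof. by have := lexx `|d|; rewrite norm_triple_le => /and3P[]. Qed.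

Definition tbasis (b : 'I_n + ('I_m + 'I_p)) : V :=
  match b with
  | inl a => (basis_vec R a, 0, 0)
  | inr (inl i) => (0, basis_vec R i, 0)
  | inr (inr j) => (0, 0, basis_vec R j)
  end.

Lemma triple_linear_bound (W : normedModType R) (f : V -> W) d : linear f ->
  `|f d| <= (\sum_b `|f (tbasis b)|) * `|d|.
Proof.
move=> lf; pose tM := GRing.isLinear.Build _ _ _ _ _ lf.
pose L : {linear V -> W} := HB.pack f tM.
have l1 : linear (fun a : 'rV[R]_n => f (a, 0, 0)).
  by move=> k a b; rewrite -lf; congr f; congr (_, _, _); rewrite /= ?scaler0 ?addr0.
have l2 : linear (fun a : 'rV[R]_m => f (0, a, 0)).
  by move=> k a b; rewrite -lf; congr f; congr (_, _, _); rewrite /= ?scaler0 ?addr0.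
have l3 : linear (fun a : 'rV[R]_p => f (0, 0, a)).
  by move=> k a b; rewrite -lf; congr f; congr (_, _, _); rewrite /= ?scaler0 ?addr0.
have fD u v : f (u + v) = f u + f v by rewrite -[u]scale1r lf !scale1r.
have -> : f d = f (d.1.1, 0, 0) + f (0, d.1.2, 0) + f (0, 0, d.2).
  case: d => [[a b] e] /=; rewrite -!fD; congr f.
  by congr (_, _, _) => /=; rewrite ?addr0 ?add0r.
rewrite !big_sumType /= !mulrDl addrA.
rewrite (le_trans (ler_normD _ _))// lerD//; last first.
  rewrite (le_trans (linear_row_bounded d.2 l3))// ler_wpM2l ?norm_triple3//.
  by rewrite sumr_ge0.
rewrite (le_trans (ler_normD _ _))// lerD//.
  rewrite (le_trans (linear_row_bounded d.1.1 l1))// ler_wpM2l ?norm_triple1//.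
  by rewrite sumr_ge0.
rewrite (le_trans (linear_row_bounded d.1.2 l2))// ler_wpM2l ?norm_triple2//.
by rewrite sumr_ge0.
Qed.

Lemma linear_inj_inverse (J : V -> V) : linear J -> (forall d, J d = 0 -> d = 0) ->
  exists g : V -> V, [/\ linear g, cancel J g & cancel g J].
Proof.
move=> lJ inj; pose tM := GRing.isLinear.Build _ _ _ _ _ lJ.
pose L : {linear V -> V} := HB.pack J tM.
pose f := linfun L.
have fE d : f d = J d by rewrite lfunE.
have k0 : lker f == 0%VS.
  apply/eqP/vspaceP => d; rewrite memv_ker memv0 fE.
  by apply/eqP/eqP => [/inj//|->]; rewrite -fE linear0.
exists (f^-1)%VF; split.
- by move=> a u v; rewrite linearP.
- by move=> d; rewrite -fE lker0_lfunK.
- by move=> d; rewrite -fE lker0_lfunVK.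
Qed.

Lemma linear_inj_bound (J : V -> V) : linear J -> (forall d, J d = 0 -> d = 0) ->
  exists2 al : R, 0 < al & forall d, al * `|d| <= `|J d|.
Proof.
move=> lJ inj; have [g [lg gK _]] := linear_inj_inverse lJ inj.
pose K := \sum_b `|g (tbasis b)| + 1.
have K0 : 0 < K by rewrite ltr_wpDl// sumr_ge0.
exists K^-1; first by rewrite invr_gt0.
move=> d; rewrite ler_pdivrMl// -{1}(gK d) (le_trans (triple_linear_bound _ lg))//.
by rewrite ler_wpM2r// lerDl.
Qed.

Lemma triple_linear_continuous (W : normedModType R) (f : V -> W) d :
  linear f -> {for d, continuous f}.
Proof.
move=> lf; pose K := \sum_b `|f (tbasis b)| + 1.
have K0 : 0 < K by rewrite ltr_wpDl// sumr_ge0.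
apply/cvgrPdist_le => e e0.
suff H : \forall t \near d, `|f d - f t| <= e by exact: H.
apply: (ball_near (d := e / K)); first by rewrite divr_gt0.
move=> y; rewrite distrC => yd.
have -> : f d - f y = f (d - y).
  pose tM := GRing.isLinear.Build _ _ _ _ _ lf.
  pose L : {linear V -> W} := HB.pack f tM.
  by rewrite -[f]/(L : _ -> _) linearB.
rewrite (le_trans (triple_linear_bound _ lf))//.
rewrite ltr_pdivlMr// mulrC in yd.
by rewrite (le_trans _ (ltW yd))// ler_wpM2r// lerDl.
Qed.

Lemma triple_linear_differentiable (W : normedModType R) (f : V -> W) d :
  linear f -> differentiable f d.
Proof.
move=> lf; pose tM := GRing.isLinear.Build _ _ _ _ _ lf.
pose L : {linear V -> W} := HB.pack f tM.
apply: (@linear_differentiable _ _ _ L d) => e.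
exact: triple_linear_continuous.
Qed.

End Triples.

Lemma derive_linear_self (R : realType) (V W : normedModType R) (f : V -> W) x v :
  linear f -> 'D_v f x = f v.
Proof.
move=> lf; rewrite /derive; apply: cvg_lim => //.
apply: (@cvg_trans _ (cst (f v) @ (0 : R)^')); last exact: cvg_cst.
apply: near_eq_cvg; near=> h; rewrite /= /cst.
have h0 : h != 0 by near: h; exact: nbhs_dnbhs_neq.
by rewrite lf addrK scalerA mulVf ?scale1r.
Unshelve. all: by end_near. Qed.

(** Stated with ['D] and not with the differential, so that the product and sum rules compute the
    linear term. *)
Lemma differentiable_derive_eps (R : realType) (V W : normedModType R) (f : V -> W) x (e : R) :
  differentiable f x -> 0 < e ->
  \forall y \near x, `|f y - f x - 'D_(y - x) f x| <= e * `|y - x|.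
Proof.
move=> df e0; move: (df) => /differentiable_epsP[L [Lc HL]].
have dE v : 'D_v f x = L v.
  have [->|v0] := eqVneq v 0; first by rewrite derive0 linear0.
  rewrite /derive; apply: cvg_lim => //; apply/cvgrPdist_le => k k0.
  have nv : 0 < `|v| by rewrite normr_gt0.
  have /near_ball[d [d0 Hd]] := HL (k / `|v|) (divr_gt0 k0 nv).
  near=> h.
  have h0 : h != 0 by near: h; exact: nbhs_dnbhs_neq.
  have hd : `|h| < d / `|v| by near: h; apply: dnbhs0_lt; rewrite divr_gt0.
  have := Hd (h *: v + x); rewrite addrK normrZ -ltr_pdivlMr// => /(_ hd) H.
  rewrite /= -[L v](scalerK h0) -scalerBr normrZ distrC -linearZ normfV ler_pdivrMl ?normr_gt0//.
  by apply: (le_trans H); rewrite [`|h| * `|v|]mulrC mulrA divfK ?gt_eqF// mulrC.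
have E : (fun y => f y - f x - 'D_(y - x) f x) = (fun y => f y - f x - L (y - x)).
  by apply/funext => y; rewrite dE.
have := HL e e0; apply: filterS => y; by rewrite dE.
Unshelve. all: by end_near. Qed.

Lemma uniform_consts (R : realType) (I : finType) (Q : I -> R -> R -> Prop) :
  (forall i, exists L r : R, [/\ 0 < L, 0 < r & Q i L r]) ->
  (forall i L L' r r', L <= L' -> r' <= r -> Q i L r -> Q i L' r') ->
  exists L r : R, [/\ 0 < L, 0 < r & forall i, Q i L r].
Proof.
move=> H mono.
suff [L [r [L0 r0 HQ]]] : exists L r : R, [/\ 0 < L, 0 < r & forall i, i \in enum I -> Q i L r].
  by exists L, r; split=> // i; apply: HQ; rewrite mem_enum.
elim: (enum I) => [|i s [L [r [L0 r0 IH]]]]; first by exists 1, 1; split.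
have [L' [r' [L'0 r'0 HQ]]] := H i.
exists (Num.max L L'), (Num.min r r'); split.
- by rewrite lt_max L0.
- by rewrite lt_min r0 r'0.
move=> j; rewrite inE => /orP[/eqP->|js].
  by apply: mono HQ; [rewrite le_max lexx orbT|rewrite ge_min lexx orbT].
by apply: mono (IH j js); [rewrite le_max lexx|rewrite ge_min lexx].
Qed.

(* Testing [l] on the vector of the signs of its entries gives its l1 norm,
   which replacing v by [S v] changes by at most one half. *)
Lemma covector_bound (R : realType) n (l : 'rV[R]_n -> R) (S : 'rV[R]_n -> 'rV[R]_n) (B : R) :
  linear_for *%R l -> (forall v, `|S v - v| <= 2^-1 * `|v|) ->
  (forall v, `|l (S v)| <= B * `|v|) -> 0 <= B ->
  forall v, `|l v| <= 2 * B * `|v|.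
Proof.
move=> ll HS HB B0.
pose N := \sum_i `|l (basis_vec R i)|.
have lN v : `|l v| <= N * `|v| by exact: (@linear_row_bounded R n R l v ll).
pose sg : 'rV[R]_n := \row_i Num.sg (l (basis_vec R i)).
have sg1 : `|sg| <= 1.
  apply: norm_row_le => // i; rewrite mxE.
  by case: (sgrP (l (basis_vec R i))) => _; rewrite ?normrN ?normr1 ?normr0.
have lsg : l sg = N.
  pose tM := GRing.isLinear.Build _ _ _ _ _ ll.
  pose L : {linear 'rV[R]_n -> R | *%R} := HB.pack l tM.
  rewrite -[l]/(L : _ -> _) {1}[sg]row_basis linear_sum; apply: eq_bigr => i _.
  by rewrite linearZ /= mxE [RHS]normrEsg.
have lB u v : l (u - v) = l u - l v.
  by rewrite -scaleN1r addrC ll mulN1r addrC.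
have N2 : N <= 2 * B.
  have H1 : N = l (S sg) - l (S sg - sg) by rewrite lB opprB addrC subrK.
  have N0 : 0 <= N by rewrite sumr_ge0.
  have H2 : l (S sg) <= B.
    by rewrite (le_trans (ler_norm _))// (le_trans (HB _))// ler_piMr.
  have H3 : - l (S sg - sg) <= N * 2^-1.
    rewrite (le_trans (ler_norm _))// normrN (le_trans (lN _))// ler_wpM2l//.
    by rewrite (le_trans (HS _))// ler_piMr// invr_ge0.
  rewrite H1 in H3 *; lra.
by move=> v; rewrite (le_trans (lN v))// ler_wpM2r.
Qed.

(** * The KKT system in a chart *)

Section C2Sums.
Context (R : realType) (n : nat) (I : finType).

Lemma derive_lincomb (V : normedModType R) (F : I -> V -> R) (a : I -> R) x v :
  (forall i, derivable (F i) x v) ->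
  'D_v (fun y => \sum_i a i * F i y) x = \sum_i a i * 'D_v (F i) x.
Proof.
move=> dF; rewrite (derive_fsum (f := fun i y => a i * F i y)).
  by apply: eq_bigr => i _; exact: (deriveZ (f := F i) (a i)).
by move=> i; exact: (@derivableZ _ _ _ (F i) (a i) x v (dF i)).
Qed.

Lemma differentiable_lincomb (V : normedModType R) (F : I -> V -> R) (a : I -> R) x :
  (forall i, differentiable (F i) x) -> differentiable (fun y => \sum_i a i * F i y) x.
Proof.
move=> dF; apply: (differentiable_fsum (f := fun i y => a i * F i y)) => i.
exact: (differentiableZ (f := F i) (a i)).
Qed.

Lemma derive2_lincomb (U : set 'rV[R]_n) (F : I -> 'rV[R]_n -> R) (a : I -> R) x u v :
  open U -> U x -> (forall i, C2on U (F i)) ->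
  'D_u ('D_v (fun y => \sum_i a i * F i y)) x = \sum_i a i * 'D_u ('D_v (F i)) x.
Proof.
move=> oU Ux CF.
have E y : U y -> \sum_i a i * 'D_v (F i) y = 'D_v (fun y => \sum_i a i * F i y) y.
  move=> Uy; rewrite derive_lincomb// => i; apply: diff_derivable.
  by have [d _ _] := CF i; exact: d.
rewrite -(near_eq_derive u (near_open oU Ux E)); apply: derive_lincomb => i.
by apply: diff_derivable; have [_ d _] := CF i; exact: d.
Qed.

Lemma C2on_lincomb (U : set 'rV[R]_n) (F : I -> 'rV[R]_n -> R) (a : I -> R) :
  open U -> (forall i, C2on U (F i)) -> C2on U (fun y => \sum_i a i * F i y).
Proof.
move=> oU CF; split.
- by move=> x Ux; apply: differentiable_lincomb => i; have [d _ _] := CF i; exact: d.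
- move=> v x Ux; apply: (near_eq_differentiable (f := fun y => \sum_i a i * 'D_v (F i) y)).
    apply: (near_open oU Ux) => y Uy; rewrite derive_lincomb// => i.
    by apply: diff_derivable; have [d _ _] := CF i; exact: d.
  by apply: differentiable_lincomb => i; have [_ d _] := CF i; exact: d.
- move=> u v x Ux; apply: (near_eq_continuous (f := fun y => \sum_i a i * 'D_u ('D_v (F i)) y)).
    by apply: (near_open oU Ux) => y Uy; rewrite (derive2_lincomb a u v oU Uy CF).
  apply: (continuous_fsum (f := fun i y => a i * 'D_u ('D_v (F i)) y)) => i.
  by apply: (continuousZr (f := 'D_u ('D_v (F i)))); have [_ _ d] := CF i; exact: d.
Qed.

End C2Sums.

Section NLP.
Context (R : realType) (n m p : nat) (M : topologicalType) (A : manifold R n M).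
Context (G : riemannian A) (Rt : retraction A).
Context (c : chart R n M) (Ac : atlas A c) (P : nlp R M m p).
Notation V := (incr R n m p).
Implicit Types (w d : V) (z u v : 'rV[R]_n) (y dy : 'rV[R]_m) (s ds : 'rV[R]_p).

(** One index set for the objective and all constraints: the Lagrangian becomes a single sum of
    [coef] times [theta]. [dcoef] is the linear part of the affine [coef], zero on the objective. *)
Definition findex := ('I_1 + ('I_m + 'I_p))%type.

Definition theta (k : findex) : M -> R :=
  match k with inl _ => obj P | inr (inl i) => ineq P i | inr (inr j) => eqc P j end.

Definition coef y s (k : findex) : R :=
  match k with inl _ => 1 | inr (inl i) => - y 0 i | inr (inr j) => s 0 j end.

Definition dcoef dy ds (k : findex) : R :=
  match k with inl _ => 0 | inr (inl i) => - dy 0 i | inr (inr j) => ds 0 j end.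

Definition F k : 'rV[R]_n -> R := theta k \o cinv c.
Definition Fg i := F (inr (inl i)).
Definition Fe j := F (inr (inr j)).

(* The KKT map and its Jacobian in the chart: their first components are kept
   as covectors, i.e. paired with a tangent vector v, which avoids inverting the
   Gram matrix. *)
Definition gL w v : R := \sum_k coef w.1.2 w.2 k * 'D_v (F k) w.1.1.

Definition jL w d v : R :=
  \sum_k coef w.1.2 w.2 k * Hf Rt (theta k) c w.1.1 d.1.1 v
  + \sum_k dcoef d.1.2 d.2 k * 'D_v (F k) w.1.1.

Definition Fh w : V := (\row_l gL w (basis_vec R l),
  \row_i (Fg i w.1.1 * w.1.2 0 i), \row_j Fe j w.1.1).

Definition Jh w d : V := (\row_l jL w d (basis_vec R l),
  \row_i (w.1.2 0 i * 'D_(d.1.1) (Fg i) w.1.1 + Fg i w.1.1 * d.1.2 0 i),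
  \row_j 'D_(d.1.1) (Fe j) w.1.1).

Lemma coefD y s dy ds k : coef (y + dy) (s + ds) k = coef y s k + dcoef dy ds k.
Proof. by case: k => [i|[i|j]] /=; rewrite ?mxE ?addr0 ?opprD. Qed.

Lemma dcoef_linear k a dy ds dy' ds' :
  dcoef (a *: dy + dy') (a *: ds + ds') k = a * dcoef dy ds k + dcoef dy' ds' k.
Proof. by case: k => [i|[i|j]] /=; rewrite ?mxE; ring. Qed.

Lemma coef_bound y s k : `|coef y s k| <= 1 + `|y| + `|s|.
Proof.
case: k => [i|[i|j]] /=.
- by rewrite normr1 -addrA lerDl addr_ge0.
- rewrite normrN (le_trans (norm_coord_le _ _))//.
  by rewrite addrAC lerDr addr_ge0.
- by rewrite (le_trans (norm_coord_le _ _))// lerDr addr_ge0.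
Qed.

Lemma dcoef_bound d k : `|dcoef d.1.2 d.2 k| <= `|d|.
Proof.
case: k => [i|[i|j]] /=; rewrite ?normr0 ?normrN//.
- by rewrite (le_trans (norm_coord_le _ _))// norm_triple2.
- by rewrite (le_trans (norm_coord_le _ _))// norm_triple3.
Qed.

Lemma lagrangianE y s : lagrangian P y s = fun x => \sum_k coef y s k * theta k x.
Proof.
apply/funext => x; rewrite !big_sumType /= big_ord1 mul1r /lagrangian addrA.
by congr (_ + _ + _); rewrite -sumrN; apply: eq_bigr => i _; rewrite mulNr.
Qed.

Hypothesis CP : C2_nlp A P.

Lemma theta_C2M k : C2M A (theta k).
Proof.
move=> d Ad; apply: (CkM2_C2on Ad); case: CP => Cobj Cineq Ceqc.
by case: k => [i|[i|j]]; [exact: Cobj|exact: Cineq|exact: Ceqc].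
Qed.

Lemma F_C2 k : C2on (cran c) (F k).
Proof. exact: theta_C2M. Qed.

Lemma lagrangian_C2M y s : C2M A (lagrangian P y s).
Proof.
move=> d Ad; rewrite lagrangianE.
apply: (C2on_lincomb (F := fun k => theta k \o cinv d)); first exact: (cran_open Ad).
by move=> k; exact: theta_C2M.
Qed.

Lemma derive_lagrangian y s z v : cran c z ->
  'D_v (lagrangian P y s \o cinv c) z = gL (z, y, s) v.
Proof.
move=> cz; rewrite lagrangianE.
apply: (@derive_lincomb R _ _ F (coef y s)) => k; apply: diff_derivable.
by have [dF _ _] := F_C2 k; exact: dF.
Qed.

Lemma Hf_lagrangian y s z u v : cran c z -> Hf Rt (lagrangian P y s) c z u v =
  \sum_k coef y s k * Hf Rt (theta k) c z u v.
Proof.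
move=> cz; rewrite /Hf derive_lagrangian// lagrangianE.
have -> : 'D_u ('D_v ((fun x => \sum_k coef y s k * theta k x) \o cinv c)) z =
    \sum_k coef y s k * 'D_u ('D_v (F k)) z.
  exact: (derive2_lincomb _ _ _ (cran_open Ac) cz F_C2).
by rewrite /gL /= -big_split; apply: eq_bigr => k _; rewrite mulrDr.
Qed.

Lemma differentiable_at_self (f : M -> R) x : C2M A f ->
  differentiable (f \o cinv (chart_at A x)) (pcoord A x).
Proof.
move=> Cf; have [df _ _] := Cf _ (chart_at_atlas A x).
by apply: df; exact/cran_cmap/chart_at_dom.
Qed.

Lemma ip_grad_lag x y s v : cdom c x ->
  ip G x (grad_lag G P (x, y, s)) (tvec A c (cmap c x) v) = gL (cmap c x, y, s) v.
Proof.
move=> cx; rewrite /grad_lag (ip_grad G v Ac cx); last exact/differentiable_at_self/lagrangian_C2M.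
by rewrite derive_lagrangian//; exact: cran_cmap.
Qed.

Lemma ip_grad_theta k x v : cdom c x ->
  ip G x (grad G (theta k) x) (tvec A c (cmap c x) v) = 'D_v (F k) (cmap c x).
Proof.
by move=> cx; rewrite (ip_grad G v Ac cx)//; exact/differentiable_at_self/theta_C2M.
Qed.

Lemma ip_addl x u1 u2 v : ip G x (u1 + u2) v = ip G x u1 v + ip G x u2 v.
Proof. by rewrite /ip -[u1]scale1r bilinPl mul1r scale1r. Qed.

Lemma ip_suml x (I : finType) (a : I -> R) (f : I -> 'rV[R]_n) v :
  ip G x (\sum_i a i *: f i) v = \sum_i a i * ip G x (f i) v.
Proof.
elim/big_ind2: _ => [|p1 p2 q1 q2 <- <-|i _]; first by rewrite /ip bilin0l.
  exact: ip_addl.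
by rewrite /ip bilinZl.
Qed.

Lemma jacF1E x y s dx dy ds : (jacF G P (x, y, s) (dx, dy, ds)).1.1 =
  hess G (lagrangian P y s) x dx + \sum_k dcoef dy ds k *: grad G (theta k) x.
Proof.
rewrite /jacF /= !big_sumType /= big_ord1 scale0r add0r addrA; congr (_ + _ + _).
by rewrite -sumrN; apply: eq_bigr => i _; rewrite scaleNr.
Qed.

Lemma ip_jacF (so : second_order G Rt) x y s u dy ds v : cdom c x ->
  ip G x (jacF G P (x, y, s) (tvec A c (cmap c x) u, dy, ds)).1.1 (tvec A c (cmap c x) v)
  = jL (cmap c x, y, s) (u, dy, ds) v.
Proof.
move=> cx; rewrite jacF1E ip_addl (ip_hess so u v (lagrangian_C2M y s) Ac cx).
rewrite Hf_lagrangian; last exact: cran_cmap.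
by rewrite ip_suml; congr (_ + _); apply: eq_bigr => k _; rewrite ip_grad_theta.
Qed.

Lemma gL_linear w : cran c w.1.1 -> linear_for *%R (gL w).
Proof.
move=> cz a u v; rewrite /gL mulr_sumr -big_split; apply: eq_bigr => k _ /=.
have [dF _ _] := F_C2 k; rewrite (derivable_diff_linear _ _ _ (dF _ cz)).
by rewrite /GRing.scale /= mulrDr mulrCA.
Qed.

Lemma jL_basis w d v : cran c w.1.1 -> jL w d v = \sum_l v 0 l * jL w d (basis_vec R l).
Proof.
move=> cz; rewrite /jL; under [in RHS]eq_bigr do rewrite mulrDr.
rewrite big_split /=; congr (_ + _).
  under [in RHS]eq_bigr do rewrite mulr_sumr.
  rewrite exchange_big; apply: eq_bigr => k _ /=.
  rewrite (Hf_basis Rt Ac _ _ (theta_C2M k) cz) mulr_sumr.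
  by apply: eq_bigr => l _; rewrite mulrCA.
under [in RHS]eq_bigr do rewrite mulr_sumr.
rewrite exchange_big; apply: eq_bigr => k _ /=.
have [dF _ _] := F_C2 k.
rewrite (derive_row_basis v (dF _ cz)) mulr_sumr.
by apply: eq_bigr => l _; rewrite mulrCA.
Qed.

Lemma jL_linear w v a d d' : cran c w.1.1 ->
  jL w (a *: d + d') v = a * jL w d v + jL w d' v.
Proof.
move=> cz; rewrite /jL /= mulrDr addrACA; congr (_ + _).
  rewrite mulr_sumr -big_split; apply: eq_bigr => k _ /=.
  by rewrite (Hf_linear Rt Ac _ _ _ _ (theta_C2M k) cz) mulrDr mulrCA.
rewrite mulr_sumr -big_split; apply: eq_bigr => k _ /=.
by rewrite dcoef_linear mulrDl mulrA.
Qed.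

Lemma Jh_linear w : cran c w.1.1 -> linear (Jh w).
Proof.
move=> cz a d d'; rewrite /Jh.
have dL k u u' : 'D_(a *: u + u') (F k) w.1.1 = a * 'D_u (F k) w.1.1 + 'D_u' (F k) w.1.1.
  by have [dF _ _] := F_C2 k; rewrite (derivable_diff_linear _ _ _ (dF _ cz)).
congr (_, _, _); apply/rowP => i; rewrite !mxE /=.
- exact: jL_linear.
- by rewrite /Fg dL; ring.
- by rewrite /Fe dL.
Qed.

End NLP.

Lemma free_coef (R : realType) (n : nat) (I : eqType) (f : I -> 'rV[R]_n) (s : seq I) (a : I -> R) :
  free [seq f i | i <- s] -> \sum_(i <- s) a i *: f i = 0 -> forall i, i \in s -> a i = 0.
Proof.
elim: s => [//|j s IH] /=; rewrite free_cons => /andP[fj fs].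
rewrite big_cons => E.
have aj : a j = 0.
  apply/eqP; apply: contraNT fj => aj0.
  have -> : f j = - (a j)^-1 *: (\sum_(i <- s) a i *: f i).
    rewrite -[\sum_(i <- s) _](addKr (a j *: f j)) E addr0 scalerN scaleNr opprK.
    by rewrite scalerA mulVf// scale1r.
  rewrite memvZ// big_seq memv_suml// => i si; rewrite memvZ// memv_span//.
  exact: map_f.
move=> i; rewrite inE => /orP[/eqP->//|].
by apply: IH => //; move: E; rewrite aj scale0r add0r.
Qed.

Section CoefCalculus.
Context (R : realType) (n m p : nat).
Notation V := (incr R n m p).
Implicit Types (w d : V).

Lemma dcoef_scalar k : linear_for *%R (fun w : V => dcoef w.1.2 w.2 k).
Proof. by move=> a d d' /=; exact: dcoef_linear. Qed.

Lemma coef_affine k : (fun w : V => coef w.1.2 w.2 k) =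
  (fun w => coef 0 0 k + dcoef w.1.2 w.2 k).
Proof. by apply/funext => w; rewrite -coefD !add0r. Qed.

Lemma coef_differentiable k w : differentiable (fun w : V => coef w.1.2 w.2 k) w.
Proof.
rewrite coef_affine; apply: (@differentiableD _ _ _ (cst (coef 0 0 k))).
  exact: differentiable_cst.
exact: (triple_linear_differentiable (W := R) w (@dcoef_scalar k)).
Qed.

Lemma coef_derive k w d : 'D_d (fun w : V => coef w.1.2 w.2 k) w = dcoef d.1.2 d.2 k.
Proof.
rewrite coef_affine.
have dd : derivable (fun w : V => dcoef w.1.2 w.2 k) w d.
  by apply: diff_derivable; exact: (triple_linear_differentiable (W := R) w (@dcoef_scalar k)).
rewrite (deriveD (f := cst (coef 0 0 k))) //.
by rewrite derive_cst add0r; exact: (derive_linear_self (W := R) w d (@dcoef_scalar k)).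
Qed.

Lemma proj1_continuous w : {for w, continuous (fun w : V => w.1.1)}.
Proof. exact: triple_linear_continuous. Qed.

Lemma comp1_continuous (f : 'rV[R]_n -> R) w :
  {for w.1.1, continuous f} -> {for w, continuous (fun w : V => f w.1.1)}.
Proof.
by move=> cf; apply: (@continuous_comp _ _ _ (fun w : V => w.1.1) f); first exact: proj1_continuous.
Qed.

Lemma comp1_differentiable (f : 'rV[R]_n -> R) w :
  differentiable f w.1.1 -> differentiable (fun w : V => f w.1.1) w.
Proof.
move=> df; apply: (@differentiable_comp _ _ _ _ (fun w : V => w.1.1) f) => //.
exact: triple_linear_differentiable.
Qed.

Lemma comp1_derive (f : 'rV[R]_n -> R) w d :
  'D_d (fun w : V => f w.1.1) w = 'D_(d.1.1) f w.1.1.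
Proof. exact: (@derive_precomp_linear R V _ _ f (fun w : V => w.1.1)). Qed.

Lemma entry2_scalar i : linear_for *%R (fun w : V => w.1.2 0 i).
Proof. by move=> a d d' /=; rewrite !mxE. Qed.

Lemma entry2_differentiable i w : differentiable (fun w : V => w.1.2 0 i) w.
Proof. exact: (triple_linear_differentiable (W := R) w (@entry2_scalar i)). Qed.

Lemma entry2_derive i w d : 'D_d (fun w : V => w.1.2 0 i) w = d.1.2 0 i.
Proof. exact: (derive_linear_self (W := R) w d (@entry2_scalar i)). Qed.

Lemma norm_triple_near (w0 : V) (f : V -> V) (e : V -> R) : (forall w, 0 <= e w) ->
  (forall l, \forall w \near w0, `|(f w).1.1 0 l| <= e w) ->
  (forall i, \forall w \near w0, `|(f w).1.2 0 i| <= e w) ->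
  (forall j, \forall w \near w0, `|(f w).2 0 j| <= e w) ->
  \forall w \near w0, `|f w| <= e w.
Proof.
move=> e0 /near_forall H1 /near_forall H2 /near_forall H3.
apply: filterS3 H1 H2 H3 => w h1 h2 h3; rewrite norm_triple_le.
by apply/and3P; split; apply: norm_row_le.
Qed.

End CoefCalculus.

(** * Injectivity of the Jacobian at the solution, lower bound nearby *)

Section NewtonLocal.
Context (R : realType) (n m p : nat) (M : topologicalType) (A : manifold R n M).
Context (G : riemannian A) (Rt : retraction A).
Context (c : chart R n M) (Ac : atlas A c) (P : nlp R M m p).
Context (xs : M) (ys : 'rV[R]_m) (ss : 'rV[R]_p) (cxs : cdom c xs).
Notation V := (incr R n m p).
Local Notation F := (F c P).
Local Notation Fg := (Fg c P).
Local Notation Fe := (Fe c P).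
Local Notation gL := (gL c P).
Local Notation jL := (jL Rt c P).
Local Notation Fh := (Fh c P).
Local Notation Jh := (Jh Rt c P).
Local Notation T := (tvec A c (cmap c xs)).
Implicit Types (w d : V) (z u v : 'rV[R]_n) (y dy : 'rV[R]_m) (s ds : 'rV[R]_p).
Hypotheses (CP : C2_nlp A P) (so : second_order G Rt).
Hypotheses (kkt : KKT G P (xs, ys, ss)) (sc : strict_complementarity P (xs, ys, ss)).
Hypotheses (licq : LICQ G P xs) (sosc : SOSC G P (xs, ys, ss)).
Let zs := cmap c xs.
Let ws : V := (zs, ys, ss).
Let czs : cran c zs. Proof. exact: cran_cmap. Qed.

Lemma hess0 (f : M -> R) x : hess G f x 0 = 0.
Proof.
rewrite /hess /covd derive0 add0r; apply/rowP => k; rewrite !mxE.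
by rewrite big1// => i _; rewrite big1// => j _; rewrite mxE mulr0 mul0r.
Qed.

(** By strict complementarity the second block makes dx orthogonal to the active gradients and dy
    zero off the active set. Pairing the first block with dx then leaves only the Hessian term, so
    SOSC forces dx = 0; its sign condition for active i with y_i = 0 is vacuous. What remains of the
    first block is a relation among the gradients of LICQ. *)
Lemma jacF_injective d : jacF G P (xs, ys, ss) d = 0 -> d = 0.
Proof.
case: d => [[dx dy] ds] E.
have E1 : (jacF G P (xs, ys, ss) (dx, dy, ds)).1.1 = 0 by rewrite E.
have E2 i : ys 0 i * ip G xs (grad G (ineq P i) xs) dx + ineq P i xs * dy 0 i = 0.
  have := congr1 (fun t : V => t.1.2 0 i) E; rewrite /jacF /=.
  by rewrite mxE => ->; rewrite mxE.
have E3 j : ip G xs (grad G (eqc P j) xs) dx = 0.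
  have := congr1 (fun t : V => t.2 0 j) E; rewrite /jacF /=.
  by rewrite mxE => ->; rewrite mxE.
have [_ gs0 ys0] := kkt.
have act i : i \in active P xs -> ys 0 i != 0 /\ ip G xs (grad G (ineq P i) xs) dx = 0.
  rewrite inE => gi; have := sc i; rewrite gi addbT => yi; split=> //.
  by have /eqP := E2 i; rewrite (eqP gi) mul0r addr0 mulf_eq0 (negbTE yi) => /eqP.
have inact i : i \notin active P xs -> dy 0 i = 0.
  rewrite inE => gi; have := sc i; rewrite (negbTE gi) addbF => /eqP yi.
  by have /eqP := E2 i; rewrite yi mul0r add0r mulf_eq0 (negbTE gi) => /eqP.
have dx0 : dx = 0.
  apply/eqP; apply: contraTT isT => dx0.
  have := sosc dx0; rewrite /hess_lag => H.
  have : 0 < ip G xs (hess G (lagrangian P ys ss) xs dx) dx.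
    apply: H => [i /act[]//|i /act[yi _] yi0|j]; last exact: E3.
    by rewrite yi0 eqxx in yi.
  suff -> : ip G xs (hess G (lagrangian P ys ss) xs dx) dx = 0 by rewrite ltxx.
  have : ip G xs (jacF G P (xs, ys, ss) (dx, dy, ds)).1.1 dx = 0.
    by rewrite E1 /ip bilin0l.
  rewrite jacF1E ip_addl ip_suml.
  rewrite [X in _ + X]big1 ?addr0// => -[i|[i|j]] _ /=.
  - by rewrite mul0r.
  - have [ia|ia] := boolP (i \in active P xs); last by rewrite (inact _ ia) oppr0 mul0r.
    by have [_ ->] := act i ia; rewrite mulr0.
  - by rewrite E3 mulr0.
move: E1; rewrite jacF1E dx0 hess0 add0r => E1.
(* Both families of gradients get one index type, so that [free_coef] applies to the concatenated
   list in LICQ. *)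
pose f (k : 'I_m + 'I_p) := match k with inl i => grad G (ineq P i) xs
  | inr j => grad G (eqc P j) xs end.
pose a (k : 'I_m + 'I_p) := match k with inl i => - dy 0 i | inr j => ds 0 j end.
pose l := [seq inl i | i <- enum (active P xs)] ++ [seq inr j | j <- enum 'I_p] : seq ('I_m + 'I_p).
have fl : free [seq f k | k <- l].
  have -> : [seq f k | k <- l] = [seq grad G (ineq P i) xs | i in active P xs]
      ++ [seq grad G (eqc P j) xs | j : 'I_p] by rewrite /l map_cat -(map_comp f inl) -(map_comp f inr).
  exact: licq.
have suml : \sum_(k <- l) a k *: f k = 0.
  rewrite -[RHS]E1 /l big_cat 2!big_map /= !big_sumType /= big_ord1 scale0r add0r.
  rewrite big_enum /=; congr (_ + _); last by rewrite big_enum.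
  rewrite [RHS](bigID (mem (active P xs))) /= [X in _ = _ + X]big1 ?addr0//.
  by move=> i ia; rewrite (inact _ ia) oppr0 scale0r.
have a0 := free_coef fl suml.
have dy0 : dy = 0.
  apply/rowP => i; rewrite mxE; have [ia|/inact//] := boolP (i \in active P xs).
  have := a0 (inl i); rewrite /l mem_cat map_f ?mem_enum// => /(_ isT) /eqP.
  by rewrite oppr_eq0 => /eqP.
have ds0 : ds = 0.
  apply/rowP => j; rewrite mxE; have := a0 (inr j).
  by rewrite /l mem_cat [X in _ || X]map_f ?mem_enum// orbT => /(_ isT).
by rewrite dy0 ds0.
Qed.

Lemma jacF_coord x y s u dy ds : cdom c x ->
  [/\ forall v, ip G x (jacF G P (x, y, s) (tvec A c (cmap c x) u, dy, ds)).1.1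
        (tvec A c (cmap c x) v) = jL (cmap c x, y, s) (u, dy, ds) v,
      (jacF G P (x, y, s) (tvec A c (cmap c x) u, dy, ds)).1.2 =
        (Jh (cmap c x, y, s) (u, dy, ds)).1.2 &
      (jacF G P (x, y, s) (tvec A c (cmap c x) u, dy, ds)).2 =
        (Jh (cmap c x, y, s) (u, dy, ds)).2].
Proof.
move=> cx; split.
- by move=> v; exact: (ip_jacF Ac CP so).
- rewrite /jacF /=; apply/rowP => i; rewrite !mxE /=.
  have /= -> := ip_grad_theta G Ac CP (inr (inl i)) u cx.
  by rewrite /Fg /F /= (cmapK Ac cx).
- rewrite /jacF /=; apply/rowP => i; rewrite !mxE /=.
  exact: (ip_grad_theta G Ac CP (inr (inr i)) u cx).
Qed.

(** The first components are a tangent vector on one side and its covector in the chart on the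
    other; nondegeneracy makes them vanish together. *)
Lemma jacF_coord_eq0 x y s u dy ds : cdom c x ->
  Jh (cmap c x, y, s) (u, dy, ds) = 0 <->
  jacF G P (x, y, s) (tvec A c (cmap c x) u, dy, ds) = 0.
Proof.
move=> cx; have [H1 H2 H3] := jacF_coord y s u dy ds cx.
have cz := cran_cmap cx; split=> E.
  rewrite [LHS]surjective_pairing [X in (X, _)]surjective_pairing H2 H3 E.
  congr (_, _, _); apply: (ip_nondeg (G := G) (x := x)) => t.
  rewrite -(tvecK t Ac cx) H1 (jL_basis Rt Ac CP)// big1// => l _.
  have := congr1 (fun t : V => t.1.1 0 l) E; rewrite /= mxE => ->.
  by rewrite mxE mulr0.
rewrite [LHS]surjective_pairing [X in (X, _)]surjective_pairing -H2 -H3 E.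
by congr (_, _, _); apply/rowP => l; rewrite mxE -H1 E /ip bilin0l mxE.
Qed.

Lemma Jh_injective d : Jh ws d = 0 -> d = 0.
Proof.
case: d => [[u dy] ds] /(jacF_coord_eq0 _ _ _ _ _ cxs) /jacF_injective [Tu -> ->].
congr (_, _, _); rewrite -(tcovK u Ac cxs) Tu; exact: derive0.
Qed.

Lemma gL_star v : gL ws v = 0.
Proof.
rewrite -(ip_grad_lag G Ac CP ys ss v cxs); have [E _ _] := kkt.
by have := congr1 (fun t : V => t.1.1) E; rewrite /= => ->; rewrite /ip bilin0l.
Qed.

Lemma Fh_star : Fh ws = 0.
Proof.
have [E _ _] := kkt; congr (_, _, _); apply/rowP => i; rewrite !mxE.
- exact: gL_star.
- have := congr1 (fun t : V => t.1.2 0 i) E; rewrite /= !mxE subr0 /Fg /F /=.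
  by rewrite (cmapK Ac cxs).
- have := congr1 (fun t : V => t.2 0 i) E; rewrite /= !mxE /Fe /F /=.
  by rewrite (cmapK Ac cxs).
Qed.

Lemma jL_continuous d v : {for ws, continuous (fun w => jL w d v)}.
Proof.
apply: (@continuousD _ _ _ (fun w => \sum_k coef w.1.2 w.2 k * Hf Rt (theta P k) c w.1.1 d.1.1 v)).
  apply: continuous_fsum => k; apply: (@continuousM _ _ (fun w : V => coef w.1.2 w.2 k)).
    by apply: differentiable_continuous; exact: coef_differentiable.
  apply: (comp1_continuous (f := fun z => Hf Rt (theta P k) c z d.1.1 v)).
  by apply: Hf_continuous; [exact: Ac|exact: cxs|exact: (theta_C2M CP k)].
apply: continuous_fsum => k.
apply: (@continuousM _ _ (fun=> dcoef d.1.2 d.2 k)); first exact: cst_continuous.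
apply: (comp1_continuous (f := 'D_v (F k))); apply: differentiable_continuous.
by have [_ d2 _] := F_C2 Ac CP k; exact: d2.
Qed.

(** Perturbation of an injective linear map: continuity of [Jh] on the finitely many basis
    increments keeps it within al / 2 of its value at the solution, as an operator. *)
Lemma Jh_lower : exists2 al : R, 0 < al &
  \forall w \near ws, forall d, al * `|d| <= `|Jh w d|.
Proof.
have lJ w : cran c w.1.1 -> linear (Jh w) by move=> ?; exact: (Jh_linear Rt Ac CP).
have [al al0 Hal] := linear_inj_bound (lJ ws czs) Jh_injective.
pose N : R := #|{: 'I_n + ('I_m + 'I_p)}|%:R + 1.
have N0 : 0 < N by rewrite ltr_wpDl.
pose e := al / 2 / N.
have e0 : 0 < e by rewrite !divr_gt0.
have dist (f : V -> R) : {for ws, continuous f} -> \forall w \near ws, `|f w - f ws| <= e.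
  by move=> /cvgrPdist_le/(_ _ e0); apply: filterS => w; rewrite distrC.
have H b : \forall w \near ws, `|Jh w (tbasis R b) - Jh ws (tbasis R b)| <= e.
  apply: (norm_triple_near (f := fun w => Jh w (tbasis R b) - Jh ws (tbasis R b)) (e := fun=> e)).
  - by move=> _; exact: ltW.
  - move=> l; have := dist _ (@jL_continuous (tbasis R b) (basis_vec R l)).
    by apply: filterS => w; rewrite !mxE.
  - move=> i; have : {for ws, continuous (fun w : V => w.1.2 0 i * 'D_((tbasis R b).1.1) (Fg i) w.1.1 +
        Fg i w.1.1 * (tbasis R b).1.2 0 i)}.
      have [d1 d2 _] := F_C2 Ac CP (inr (inl i)).
      apply: (@continuousD _ _ _ (fun w : V => w.1.2 0 i * 'D_((tbasis R b).1.1) (Fg i) w.1.1)).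
        apply: (@continuousM _ _ (fun w : V => w.1.2 0 i)).
          by apply: differentiable_continuous; exact: entry2_differentiable.
        apply: (comp1_continuous (f := 'D_((tbasis R b).1.1) (Fg i))).
        by apply: differentiable_continuous; exact: d2.
      apply: (@continuousM _ _ (fun w : V => Fg i w.1.1)); last exact: cst_continuous.
      by apply: (comp1_continuous (f := Fg i)); apply: differentiable_continuous; exact: d1.
    by move=> /dist; apply: filterS => w; rewrite !mxE.
  - move=> j; have : {for ws, continuous (fun w : V => 'D_((tbasis R b).1.1) (Fe j) w.1.1)}.
      have [_ d2 _] := F_C2 Ac CP (inr (inr j)).
      apply: (comp1_continuous (f := 'D_((tbasis R b).1.1) (Fe j))).
      by apply: differentiable_continuous; exact: d2.
    by move=> /dist; apply: filterS => w; rewrite !mxE.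
have nz : \forall w \near ws, cran c w.1.1.
  have [r [r0 Hr]] := near_ball (near_cran Ac czs).
  apply: (ball_near r0) => w wr; apply: Hr.
  exact: le_lt_trans (norm_triple1 (w - ws)) wr.
exists (al / 2); first by rewrite divr_gt0.
apply: filterS2 nz (near_forall H) => w cw Hw d.
have lD : linear (fun d => Jh w d - Jh ws d).
  move=> a d1 d2; rewrite (lJ w cw) (lJ ws czs).
  by move: (Jh w d1) (Jh w d2) (Jh ws d1) (Jh ws d2) => q1 q2 q3 q4; rewrite scalerBr opprD addrACA.
have B : `|Jh w d - Jh ws d| <= al / 2 * `|d|.
  rewrite (le_trans (triple_linear_bound d lD))// ler_wpM2r//.
  apply: (@le_trans _ _ (\sum_(b : 'I_n + ('I_m + 'I_p)) e)); first by apply: ler_sum.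
  rewrite sumr_const -[leLHS]mulr_natl /e mulrCA -[leRHS]mulr1 ler_wpM2l ?divr_ge0 ?(ltW al0)//.
  by rewrite ler_pdivrMr// mul1r lerDl.
have := Hal d; have := ler_normB (Jh w d) (Jh w d - Jh ws d).
rewrite opprB addrC subrK.
by move: B; move: `|Jh w d - Jh ws d| `|Jh ws d| `|Jh w d| `|d| => *; lra.
Qed.

End NewtonLocal.

(** * Error bound and Newton step *)

Section ErrorBound.
Context (R : realType) (n m p : nat) (M : topologicalType) (A : manifold R n M).
Context (G : riemannian A) (Rt : retraction A).
Context (c : chart R n M) (Ac : atlas A c) (P : nlp R M m p).
Context (xs : M) (ys : 'rV[R]_m) (ss : 'rV[R]_p) (cxs : cdom c xs).
Notation V := (incr R n m p).
Local Notation F := (F c P).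
Local Notation Fg := (Fg c P).
Local Notation Fe := (Fe c P).
Local Notation gL := (gL c P).
Local Notation jL := (jL Rt c P).
Local Notation Fh := (Fh c P).
Local Notation Jh := (Jh Rt c P).
Implicit Types (w d : V) (z u v : 'rV[R]_n) (y dy : 'rV[R]_m) (s ds : 'rV[R]_p).
Hypotheses (CP : C2_nlp A P) (so : second_order G Rt).
Hypotheses (kkt : KKT G P (xs, ys, ss)) (sc : strict_complementarity P (xs, ys, ss)).
Hypotheses (licq : LICQ G P xs) (sosc : SOSC G P (xs, ys, ss)).
Let zs := cmap c xs.
Let ws : V := (zs, ys, ss).
Let czs : cran c zs. Proof. exact: cran_cmap. Qed.

Let dF k : differentiable (F k) zs.
Proof. by have [d _ _] := F_C2 Ac CP k; exact: d. Qed.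

Let d2F k v : differentiable ('D_v (F k)) zs.
Proof. by have [_ d _] := F_C2 Ac CP k; exact: d. Qed.

Lemma gL_differentiable v : differentiable (fun w => gL w v) ws.
Proof.
apply: (differentiable_fsum (f := fun k w => coef w.1.2 w.2 k * 'D_v (F k) w.1.1)) => k.
apply: (@differentiableM _ _ (fun w : V => coef w.1.2 w.2 k)); first exact: coef_differentiable.
exact: (comp1_differentiable (w := ws) (d2F k v)).
Qed.

(* The derivative of the Lagrangian vanishes at the solution, so the second
   order part of the retraction does not contribute to the Hessian there. *)
Lemma gL_derive v d : 'D_d (fun w => gL w v) ws = jL ws d v.
Proof.
rewrite (derive_fsum (f := fun k w => coef w.1.2 w.2 k * 'D_v (F k) w.1.1)); last first.
  move=> k; apply: (@derivableM _ _ (fun w : V => coef w.1.2 w.2 k)).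
    by apply: diff_derivable; exact: coef_differentiable.
  by apply: diff_derivable; exact: (comp1_differentiable (w := ws) (d2F k v)).
have E k : 'D_d (fun w : V => coef w.1.2 w.2 k * 'D_v (F k) w.1.1) ws =
    coef ys ss k * 'D_(d.1.1) ('D_v (F k)) zs + dcoef d.1.2 d.2 k * 'D_v (F k) zs.
  rewrite (@deriveM _ _ (fun w : V => coef w.1.2 w.2 k)); last 2 first.
  - by apply: diff_derivable; exact: coef_differentiable.
  - by apply: diff_derivable; exact: (comp1_differentiable (w := ws) (d2F k v)).
  rewrite (comp1_derive ('D_v (F k))) coef_derive /GRing.scale /=.
  by congr (_ + _); exact: mulrC.
rewrite (eq_bigr _ (fun k _ => E k)) big_split /= /jL /=; congr (_ + _).
apply/esym; rewrite -[RHS]addr0.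
have g0 := gL_star Ac cxs CP kkt.
under eq_bigr do rewrite /Hf mulrDr.
rewrite big_split /=; congr (_ + _).
have Qlin k : 'D_(Qf Rt c zs d.1.1 v) (F k) zs =
    \sum_b (Qf Rt c zs d.1.1 v) 0 b * 'D_(basis_vec R b) (F k) zs.
  by rewrite (derive_row_basis _ (dF k)).
exact: g0.
Qed.

(** [Jh] is the derivative of [Fh] at the solution thanks to [gL_derive]; the expansion is made
    entry by entry, every entry of [Fh] being zero there. *)
Lemma Fh_expand (e : R) : 0 < e ->
  \forall w \near ws, `|Fh w - Jh ws (w - ws)| <= e * `|w - ws|.
Proof.
move=> e0.
have F0 := Fh_star Ac cxs CP kkt.
have comp (f : V -> R) : differentiable f ws -> f ws = 0 ->
    \forall w \near ws, `|f w - 'D_(w - ws) f ws| <= e * `|w - ws|.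
  move=> df f0; have := differentiable_derive_eps df e0.
  by apply: filterS => w; rewrite f0 subr0.
apply: (norm_triple_near (f := fun w => Fh w - Jh ws (w - ws)) (e := fun w => e * `|w - ws|)).
- by move=> w; rewrite mulr_ge0// ltW.
- move=> l; have := comp _ (gL_differentiable (basis_vec R l)) (gL_star Ac cxs CP kkt _).
  by apply: filterS => w; rewrite gL_derive !mxE.
- move=> i.
  have dg : differentiable (fun w : V => Fg i w.1.1 * w.1.2 0 i) ws.
    apply: (@differentiableM _ _ (fun w : V => Fg i w.1.1)); last exact: entry2_differentiable.
    exact: (comp1_differentiable (w := ws) (dF (inr (inl i)))).
  have g0 : Fg i zs * ys 0 i = 0.
    by have := congr1 (fun t : V => t.1.2 0 i) F0; rewrite /= !mxE.
  have := comp _ dg g0; apply: filterS => w.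
  rewrite (@deriveM _ _ (fun w : V => Fg i w.1.1)); last 2 first.
  + by apply: diff_derivable; exact: (comp1_differentiable (w := ws) (dF (inr (inl i)))).
  + by apply: diff_derivable; exact: entry2_differentiable.
  rewrite (comp1_derive (Fg i)) entry2_derive /GRing.scale /=.
  by rewrite !mxE [Fg i zs * _ + _]addrC.
- move=> j; have e0' : Fe j zs = 0.
    by have := congr1 (fun t : V => t.2 0 j) F0; rewrite /= !mxE.
  have := comp _ (comp1_differentiable (w := ws) (dF (inr (inr j)))) e0'.
  by apply: filterS => w; rewrite (comp1_derive (Fe j)) !mxE.
Qed.

Lemma Fh_equiv : exists a b r : R, [/\ 0 < a, 0 < b, 0 < r & forall w, `|w - ws| < r ->
  a * `|w - ws| <= `|Fh w| <= b * `|w - ws|].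
Proof.
have lJ : linear (Jh ws) by exact: (Jh_linear Rt Ac CP).
have [al al0 Hal] := linear_inj_bound lJ (Jh_injective Ac cxs CP so kkt sc licq sosc).
pose K := \sum_b `|Jh ws (tbasis R b)|.
have K0 : 0 <= K by rewrite sumr_ge0.
have HK d : `|Jh ws d| <= K * `|d| by exact: triple_linear_bound.
have e0 : 0 < al / 2 by rewrite divr_gt0.
have [r [r0 Hr]] := near_ball (Fh_expand e0).
exists (al / 2), (K + al / 2), r; split=> //; first by rewrite ltr_wpDl.
move=> w /Hr H; have := Hal (w - ws); have := HK (w - ws).
have := ler_normD (Fh w - Jh ws (w - ws)) (Jh ws (w - ws)); rewrite subrK.
have := ler_normB (Fh w) (Fh w - Jh ws (w - ws)); rewrite opprB addrC subrK.
move: H; move: `|_ - Jh ws _| `|Jh ws _| `|Fh w| `|w - ws| => p1 p2 p3 p4 *.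
by apply/andP; split; lra.
Qed.

Lemma derive_bound : exists B r : R, [/\ 0 < B, 0 < r & forall k z v,
  `|z - zs| < r -> `|'D_v (F k) z| <= B * `|v|].
Proof.
pose Q (k : findex m p) (B r : R) := forall z v, `|z - zs| < r -> `|'D_v (F k) z| <= B * `|v|.
suff [B [r [B0 r0 H]]] : exists L r : R, [/\ 0 < L, 0 < r & forall k, Q k L r].
  by exists B, r; split=> // k; exact: H.
apply: uniform_consts; last first.
  move=> k L L' r r' LL rr HQ z v zr; rewrite (le_trans (HQ z v (lt_le_trans zr rr)))//.
  by rewrite ler_wpM2r.
move=> k.
have H b : \forall z \near zs, `|'D_(basis_vec R b) (F k) z| <= `|'D_(basis_vec R b) (F k) zs| + 1.
  have cD : {for zs, continuous ('D_(basis_vec R b) (F k))}.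
    exact: differentiable_continuous.
  have /cvgrPdist_le/(_ _ ltr01) := cD.
  apply: filterS => z; move: ('D_(basis_vec R b) (F k) z) ('D_(basis_vec R b) (F k) zs) => q q0.
  move=> H; rewrite -[q](subrK q0) (le_trans (ler_normD _ _))// addrC lerD2l.
  by rewrite distrC.
have [r [r0 Hr]] := near_ball (near_and (near_cran Ac czs) (near_forall H)).
exists (\sum_b (`|'D_(basis_vec R b) (F k) zs| + 1) + 1), r; split=> //.
  by rewrite ltr_wpDl// sumr_ge0// => b _; rewrite addr_ge0.
move=> z v /Hr[cz Hz].
have [dk _ _] := F_C2 Ac CP k.
rewrite (derive_row_basis v (dk _ cz)) (le_trans (ler_norm_sum _ _ _))//.
rewrite mulrDl mul1r ler_wpDr// mulr_suml; apply: ler_sum => b _.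
by rewrite normrM mulrC ler_pM ?norm_coord_le.
Qed.

End ErrorBound.

(** * Residual of a Newton step *)

Section NewtonEstimate.
Context (R : realType) (n m p : nat) (M : topologicalType) (A : manifold R n M).
Context (G : riemannian A) (Rt : retraction A).
Context (c : chart R n M) (Ac : atlas A c) (P : nlp R M m p).
Context (xs : M) (ys : 'rV[R]_m) (ss : 'rV[R]_p) (cxs : cdom c xs).
Notation V := (incr R n m p).
Local Notation F := (F c P).
Local Notation Fg := (Fg c P).
Local Notation Fe := (Fe c P).
Local Notation gL := (gL c P).
Local Notation jL := (jL Rt c P).
Implicit Types (w d : V) (z u v : 'rV[R]_n) (y dy : 'rV[R]_m) (s ds : 'rV[R]_p).
Hypotheses (CP : C2_nlp A P).
Hypothesis lip : forall k, pullback_hess_lipschitz G Rt (theta P k) xs.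
Let zs := cmap c xs.
Let ws : V := (zs, ys, ss).

Definition newton_point w d : V := (rho Rt c w.1.1 d.1.1, w.1.2 + d.1.2, w.2 + d.2).

Let taylor1 : exists L r : R, [/\ 0 < L, 0 < r & forall k z u v,
  `|z - zs| < r -> `|u| < r ->
  `|'D_v (phi Rt (theta P k) c z) u - 'D_v (F k) z - Hf Rt (theta P k) c z u v|
     <= L * `|u| ^+ 2 * `|v|].
Proof.
pose Q (k : findex m p) (L r : R) := forall z u v, `|z - zs| < r -> `|u| < r ->
  `|'D_v (phi Rt (theta P k) c z) u - 'D_v (F k) z - Hf Rt (theta P k) c z u v|
     <= L * `|u| ^+ 2 * `|v|.
suff [L [r [L0 r0 H]]] : exists L r : R, [/\ 0 < L, 0 < r & forall k, Q k L r].
  by exists L, r; split=> // k; exact: H.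
apply: uniform_consts => [k|k L L' r r' LL rr HQ z u v zr ur].
  exact: (taylor_derive Ac cxs (theta_C2M CP k) (lip k)).
rewrite (le_trans (HQ z u v (lt_le_trans zr rr) (lt_le_trans ur rr)))//.
by rewrite ler_wpM2r// ler_wpM2r ?sqr_ge0.
Qed.

Let taylor0 : exists L r : R, [/\ 0 < L, 0 < r & forall k z u,
  `|z - zs| < r -> `|u| < r ->
  `|F k (rho Rt c z u) - F k z - 'D_u (F k) z| <= L * `|u| ^+ 2].
Proof.
pose Q (k : findex m p) (L r : R) := forall z u, `|z - zs| < r -> `|u| < r ->
  `|F k (rho Rt c z u) - F k z - 'D_u (F k) z| <= L * `|u| ^+ 2.
suff [L [r [L0 r0 H]]] : exists L r : R, [/\ 0 < L, 0 < r & forall k, Q k L r].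
  by exists L, r; split=> // k; exact: H.
apply: uniform_consts => [k|k L L' r r' LL rr HQ z u zr ur].
  exact: (taylor_value Ac cxs (theta_C2M CP k) (lip k)).
rewrite (le_trans (HQ z u (lt_le_trans zr rr) (lt_le_trans ur rr)))//.
by rewrite ler_wpM2r ?sqr_ge0.
Qed.

Let hess_bound : exists B r : R, [/\ 0 < B, 0 < r & forall k z u v,
  `|z - zs| < r -> `|Hf Rt (theta P k) c z u v| <= B * `|u| * `|v|].
Proof.
pose Q (k : findex m p) (B r : R) := forall z u v, `|z - zs| < r ->
  `|Hf Rt (theta P k) c z u v| <= B * `|u| * `|v|.
suff [L [r [L0 r0 H]]] : exists L r : R, [/\ 0 < L, 0 < r & forall k, Q k L r].
  by exists L, r; split=> // k; exact: H.
apply: uniform_consts => [k|k L L' r r' LL rr HQ z u v zr].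
  exact: (Hf_bound Rt Ac cxs (theta_C2M CP k)).
rewrite (le_trans (HQ z u v (lt_le_trans zr rr)))//.
by rewrite ler_wpM2r// ler_wpM2r.
Qed.

(** Newton's equations cancel the zeroth and first order terms of the Taylor expansions of the
    pullbacks; the rest is made of Taylor remainders and products of two increments. *)
Lemma newton_estimate : exists C r : R, [/\ 0 < C, 0 < r & forall w d mu,
  `|w - ws| < r -> `|d| < r ->
  (forall v, jL w d v = - gL w v) ->
  (forall i, w.1.2 0 i * 'D_(d.1.1) (Fg i) w.1.1 + Fg i w.1.1 * d.1.2 0 i =
     mu - Fg i w.1.1 * w.1.2 0 i) ->
  (forall j, 'D_(d.1.1) (Fe j) w.1.1 = - Fe j w.1.1) ->
  [/\ rdom Rt c w.1.1 d.1.1, `|newton_point w d - w| <= 2 * `|d|,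
    forall v, `|gL (newton_point w d) v| <= C * `|d| ^+ 2 * `|v|,
    forall i, `|Fg i (newton_point w d).1.1 * (newton_point w d).1.2 0 i - mu| <= C * `|d| ^+ 2
    & forall j, `|Fe j (newton_point w d).1.1| <= C * `|d| ^+ 2]].
Proof.
have [L1 [r1 [L10 r10 H1]]] := taylor1.
have [L2 [r2 [L20 r20 H2]]] := taylor0.
have [B [r3 [B0 r30 H3]]] := hess_bound.
have [D [r4 [D0 r40 H4]]] := derive_bound Ac cxs CP.
have [r5 r50 H5] := derive_rho_near Rt Ac cxs.
have [r6 r60 H6] := rho_near Rt Ac cxs.
(* With |w - ws| and |d| below 1 both new multipliers have norm at most |ws| + 2, and [coef_bound]
   gives 1 + 2(|ws| + 2). *)
pose Cc : R := 5 + 2 * `|ws|.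
have ws0 : 0 <= `|ws| by [].
have Cc0 : 0 < Cc by rewrite /Cc; lra.
have sumB (a b q dn : R) : a <= q -> q <= `|ws| + 1 -> b <= dn -> dn < 1 -> a + b <= `|ws| + 2.
  by move=> *; lra.
have coefC (a b : R) : a <= `|ws| + 2 -> b <= `|ws| + 2 -> 1 + a + b <= Cc.
  by rewrite /Cc => *; lra.
have CcB : `|ws| + 2 <= Cc by rewrite /Cc; lra.
pose N : R := #|{: findex m p}|%:R.
have N0 : 0 <= N by [].
pose C1 := N * (Cc * L1 + B).
have C10 : 0 <= C1 by rewrite mulr_ge0// addr_ge0// ltW// mulr_gt0.
pose C2 := L2 * Cc + D.
have C20 : 0 < C2 by rewrite addr_gt0// mulr_gt0.
pose r := Num.min 1 (Num.min (Num.min (Num.min r1 r2) (Num.min r3 r4)) (Num.min r5 r6)).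
(* [C1] is for stationarity, doubled by [covector_bound]; [C2] is for complementarity and [L2] for
   the equality constraints. *)
exists (2 * C1 + C2 + L2), r; split.
- by rewrite ltr_wpDl// ltW// ltr_wpDl// mulr_ge0.
- by rewrite !lt_min ltr01 r10 r20 r30 r40 r50 r60.
move=> w d mu; rewrite !lt_min => /andP[w1 /andP[/andP[/andP[wr1 wr2] /andP[wr3 wr4]] /andP[wr5 wr6]]].
move=> /andP[d1 /andP[/andP[/andP[dr1 dr2] /andP[dr3 dr4]] /andP[dr5 dr6]]] E1 E2 E3.
set z := w.1.1 in E1 E2 E3 *; set u := d.1.1 in E1 E2 E3 *.
have zl q : `|w - ws| < q -> `|z - zs| < q.
  by apply: le_lt_trans; exact: (norm_triple1 (w - ws)).
have ul q : `|d| < q -> `|u| < q by apply: le_lt_trans; exact: norm_triple1.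
have ud : `|u| <= `|d| by exact: norm_triple1.
have u2 : `|u| ^+ 2 <= `|d| ^+ 2 by rewrite ler_pXn2r// nnegrE.
have d0 : 0 <= `|d| ^+ 2 by rewrite sqr_ge0.
have [Du Hrho] := H6 z u (zl _ wr6) (ul _ dr6).
have wn : `|w| <= `|ws| + 1.
  by rewrite -[w](subrK ws) addrC (le_trans (ler_normD _ _))// lerD2l ltW.
have y'n : `|w.1.2 + d.1.2| <= `|ws| + 2.
  rewrite (le_trans (ler_normD _ _))//.
  exact: (sumB _ _ _ _ (norm_triple2 w) wn (norm_triple2 d) d1).
have s'n : `|w.2 + d.2| <= `|ws| + 2.
  rewrite (le_trans (ler_normD _ _))//.
  exact: (sumB _ _ _ _ (norm_triple3 w) wn (norm_triple3 d) d1).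
have coefB k : `|coef (w.1.2 + d.1.2) (w.2 + d.2) k| <= Cc.
  by rewrite (le_trans (coef_bound _ _ _))// coefC.
have yB i : `|(w.1.2 + d.1.2) 0 i| <= Cc.
  by rewrite (le_trans (norm_coord_le _ _))// (le_trans y'n).
have tB k : `|F k (rho Rt c z u) - F k z - 'D_u (F k) z| <= L2 * `|d| ^+ 2.
  rewrite (le_trans (H2 k z u (zl _ wr2) (ul _ dr2)))//.
  by rewrite ler_wpM2l// ltW.
have LD : L2 * `|d| ^+ 2 <= (2 * C1 + C2 + L2) * `|d| ^+ 2.
  by rewrite ler_wpM2r// lerDr addr_ge0 ?(ltW C20)// mulr_ge0.
split=> //.
- rewrite norm_triple_le /=; apply/and3P; split.
  + by rewrite (le_trans Hrho)// ler_wpM2l.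
  + by rewrite addrC addKr (le_trans (norm_triple2 d))// ler_peMl// ler1n.
  + by rewrite addrC addKr (le_trans (norm_triple3 d))// ler_peMl// ler1n.
- have key v : `|gL (newton_point w d) ('D_v (rho Rt c z) u)| <= C1 * `|d| ^+ 2 * `|v|.
    pose t k := 'D_v (phi Rt (theta P k) c z) u - 'D_v (F k) z - Hf Rt (theta P k) c z u v.
    have tk k : `|t k| <= L1 * `|d| ^+ 2 * `|v|.
      rewrite (le_trans (H1 k z u v (zl _ wr1) (ul _ dr1)))//.
      by rewrite ler_wpM2r// ler_wpM2l// ltW.
    (* The derivative of [phi] at u turns the left side into a sum over pullbacks based at w.
       Subtracting [jL + gL = 0] leaves the remainders [t] and the multiplier increments times
       [Hf]. *)
    have E : gL (newton_point w d) ('D_v (rho Rt c z) u) =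
        \sum_k (coef (w.1.2 + d.1.2) (w.2 + d.2) k * t k
                + dcoef d.1.2 d.2 k * Hf Rt (theta P k) c z u v).
      transitivity (\sum_k coef (w.1.2 + d.1.2) (w.2 + d.2) k *
          'D_v (phi Rt (theta P k) c z) u).
        apply: eq_bigr => k _; congr (_ * _).
        exact/esym/(derive_phi Ac v (theta_C2M CP k) Du).
      have := E1 v => /eqP; rewrite -addr_eq0 /jL /gL -/z => /eqP E0.
      rewrite -[RHS]addr0 -[X in _ = _ + X]E0 -!big_split; apply: eq_bigr => k _ /=.
      rewrite coefD /t.
      move: ('D_v (phi _ _ _ _) _) ('D_v (F k) z) (Hf _ _ _ _ _ _) (coef _ _ _) (dcoef _ _ _).
      by move=> q1 q2 q3 q4 q5; ring.
    rewrite E (le_trans (ler_norm_sum _ _ _))// /C1 -!mulrA.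
    rewrite /N mulr_natl -sumr_const.
    apply: ler_sum => k _; rewrite (le_trans (ler_normD _ _))// mulrDl !normrM.
    apply: lerD.
      have := tk k; rewrite expr2 -!mulrA => tk'.
      by apply: ler_pM.
    have hb := H3 k z u v (zl _ wr3).
    have := dcoef_bound d k.
    move: (dcoef _ _ _) (Hf _ _ _ _ _ _) hb => q1 q2 hb q1d.
    apply: (@le_trans _ _ (`|d| * (B * `|d| * `|v|))).
      apply: ler_pM => //; apply: (le_trans hb).
      by rewrite ler_wpM2r// ler_wpM2l// ltW.
    by rewrite le_eqVlt; apply/orP; left; apply/eqP; ring.
  move=> v.
  have lgL : linear_for *%R (gL (newton_point w d)).
    by apply: (gL_linear Ac CP); exact: rho_cran.
  have Sb v' : `|'D_v' (rho Rt c z) u - v'| <= 2^-1 * `|v'|.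
    by have [] := H5 z u v' (zl _ wr5) (ul _ dr5).
  have C1d : 0 <= C1 * `|d| ^+ 2 by rewrite mulr_ge0.
  rewrite (le_trans (covector_bound lgL Sb key C1d v))//.
  rewrite ler_wpM2r// mulrA ler_wpM2r// -addrA lerDl addr_ge0// ltW//.
- move=> i.
  have tb : `|Fg i (rho Rt c z u) - Fg i z - 'D_u (Fg i) z| <= L2 * `|d| ^+ 2 := tB (inr (inl i)).
  have Db : `|'D_u (Fg i) z| <= D * `|u| := H4 (inr (inl i)) z u (zl _ wr4).
  move: tb (E2 i) Db; rewrite /newton_point /=.
  have dyi : `|d.1.2 0 i| <= `|d|.
    by rewrite (le_trans (norm_coord_le _ _))// norm_triple2.
  have := yB i.
  move: (Fg i (rho Rt c z u)) (Fg i z) ('D_u (Fg i) z) => q1 q2 q3 yb tb E Db.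
  (* The Newton equation eliminates mu: Taylor remainder times new multiplier, plus the product of
     the two increments. *)
  have -> : q1 * (w.1.2 + d.1.2) 0 i - mu = (q1 - q2 - q3) * (w.1.2 + d.1.2) 0 i + q3 * d.1.2 0 i.
    have -> : mu = w.1.2 0 i * q3 + q2 * d.1.2 0 i + q2 * w.1.2 0 i by rewrite E subrK.
    by rewrite mxE; ring.
  rewrite (le_trans (ler_normD _ _))// !normrM.
  apply: (@le_trans _ _ (L2 * `|d| ^+ 2 * Cc + D * `|d| * `|d|)).
    apply: lerD; first exact: ler_pM.
    by apply: ler_pM => //; rewrite (le_trans Db)// ler_wpM2l// ltW.
  have -> : L2 * `|d| ^+ 2 * Cc + D * `|d| * `|d| = C2 * `|d| ^+ 2 by rewrite /C2; ring.
  by rewrite ler_wpM2r// addrAC lerDr addr_ge0 ?(ltW L20)// mulr_ge0.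
- move=> j.
  have tb : `|Fe j (rho Rt c z u) - Fe j z - 'D_u (Fe j) z| <= L2 * `|d| ^+ 2 := tB (inr (inr j)).
  by move: tb; rewrite E3 opprK subrK => /le_trans; apply.
Qed.

End NewtonEstimate.

Section EuclideanNorm.
Context (R : realType) (k : nat).
Implicit Types (v : 'rV[R]_k).

Lemma enorm_ge0 v : 0 <= enorm v.
Proof. exact: sqrtr_ge0. Qed.

Lemma enorm_sqr v : enorm v ^+ 2 = \sum_(i < k) v 0 i ^+ 2.
Proof. by rewrite sqr_sqrtr// sumr_ge0// => i _; rewrite sqr_ge0. Qed.

Lemma coord_le_enorm v i : `|v 0 i| <= enorm v.
Proof.
rewrite -(@ler_pXn2r _ 2)// ?nnegrE ?enorm_ge0// enorm_sqr real_normK ?num_real//.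
by rewrite (bigD1 i)//= lerDl sumr_ge0// => j _; rewrite sqr_ge0.
Qed.

Lemma norm_le_enorm v : `|v| <= enorm v.
Proof. by apply: norm_row_le => [|i]; [exact: enorm_ge0|exact: coord_le_enorm]. Qed.

Lemma enorm_le v (B : R) : (forall i, `|v 0 i| <= B) -> 0 <= B -> enorm v <= k%:R * B.
Proof.
move=> vB B0; rewrite -(@ler_pXn2r _ 2)// ?nnegrE ?enorm_ge0 ?mulr_ge0//.
rewrite enorm_sqr; apply: (@le_trans _ _ (\sum_(i < k) B ^+ 2)).
  by apply: ler_sum => i _; rewrite -[leLHS]real_normK ?num_real// ler_pXn2r ?nnegrE.
rewrite sumr_const card_ord -[leLHS]mulr_natl exprMn ler_wpM2r ?sqr_ge0//.
by rewrite expr2 -natrM ler_nat; case: (k) => // q; rewrite leq_pmulr.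
Qed.

End EuclideanNorm.

(** * From the chart to the iterates on the manifold *)

Section StepInChart.
Context (R : realType) (n m p : nat) (M : topologicalType) (A : manifold R n M).
Context (G : riemannian A) (Rt : retraction A).
Context (c : chart R n M) (Ac : atlas A c) (P : nlp R M m p).
Context (xs : M) (ys : 'rV[R]_m) (ss : 'rV[R]_p) (cxs : cdom c xs).
Notation V := (incr R n m p).
Local Notation F := (F c P).
Local Notation Fg := (Fg c P).
Local Notation Fe := (Fe c P).
Local Notation gL := (gL c P).
Local Notation jL := (jL Rt c P).
Local Notation Fh := (Fh c P).
Local Notation Jh := (Jh Rt c P).
Implicit Types (d : V) (w : pdpoint R M m p).
Hypotheses (CP : C2_nlp A P) (so : second_order G Rt).
Hypotheses (kkt : KKT G P (xs, ys, ss)) (sc : strict_complementarity P (xs, ys, ss)).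
Hypotheses (licq : LICQ G P xs) (sosc : SOSC G P (xs, ys, ss)).
Hypothesis lip : forall k, pullback_hess_lipschitz G Rt (theta P k) xs.
Let zs := cmap c xs.
Let ws : V := (zs, ys, ss).
Let czs : cran c zs. Proof. exact: cran_cmap. Qed.

Definition hat (w : pdpoint R M m p) : V := (cmap c w.1.1, w.1.2, w.2).

(** Increments are handled with their tangent part in the chart c; [jacF] and [step] expect it in
    [chart_at]. *)
Definition push (w : pdpoint R M m p) d : V :=
  (tvec A c (cmap c w.1.1) d.1.1, d.1.2, d.2).


Lemma hat_near1 w (r : R) : `|hat w - ws| < r -> `|cmap c w.1.1 - zs| < r.
Proof. by apply: le_lt_trans; exact: (norm_triple1 (hat w - ws)). Qed.

Lemma FgE w i : cdom c w.1.1 -> Fg i (cmap c w.1.1) = ineq P i w.1.1.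
Proof. by move=> cx; rewrite /Fg /F /= (cmapK Ac cx). Qed.

Lemma FeE w j : cdom c w.1.1 -> Fe j (cmap c w.1.1) = eqc P j w.1.1.
Proof. by move=> cx; rewrite /Fe /F /= (cmapK Ac cx). Qed.

Lemma ip_grad_hat w v : cdom c w.1.1 ->
  ip G w.1.1 (grad_lag G P w) (tvec A c (cmap c w.1.1) v) = gL (hat w) v.
Proof. by case: w => [[x y] s] cx; exact: (ip_grad_lag G Ac CP). Qed.

Lemma stopping_residual (phiL phic phie : R -> R) :
  exists K r : R, [/\ 0 < K, 0 < r & forall w mu t,
    cdom c w.1.1 -> `|hat w - ws| < r -> 0 <= mu -> mu <= t ->
    phiL mu <= t -> phic mu <= t -> phie mu <= t ->
    stopping G P phiL phic phie mu w -> `|Fh (hat w)| <= K * t].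
Proof.
have [K K0 /near_ball[r [r0 HK]]] := tvec_norm_equiv G Ac cxs.
(* K serves the gradient, tested on basis vectors by Cauchy-Schwarz; 2 serves complementarity, whose
   stopping test is centred at mu and not at 0. *)
exists (K + 2), r; split=> //; first by rewrite addr_gt0.
move=> w mu t cx wr mu0 mut Lt ct et.
have t0 : 0 <= t by exact: le_trans mut.
case: w cx wr => [[x y] s] /= cx wr [sL sc' se _ _].
have Kt : K * t <= (K + 2) * t by rewrite ler_wpM2r// lerDl.
have t1 : t <= (K + 2) * t by rewrite ler_peMl//; move: K0; lra.
have t2 : 2 * t <= (K + 2) * t by rewrite ler_wpM2r// lerDr ltW.
have B0 : 0 <= (K + 2) * t by rewrite mulr_ge0// addr_ge0// ltW.
rewrite norm_triple_le /=; apply/and3P; split; apply: norm_row_le => // l; rewrite mxE /=.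
- rewrite -(ip_grad_lag G Ac CP y s (basis_vec R l) cx) (le_trans _ Kt)//.
  have [H _] := HK _ (hat_near1 wr) (basis_vec R l); rewrite /= (cmapK Ac cx) in H.
  rewrite (le_trans (ip_CS _ _ _ _))// mulrC ler_pM// ?tnorm_ge0//; last exact: le_trans Lt.
  by rewrite (le_trans H)// ler_piMr ?(ltW K0)// norm_basis_vec.
- rewrite (le_trans _ t2)// (@FgE (x, y, s) l cx) /=.
  have := coord_le_enorm (\row_i (ineq P i x * y 0 i - mu)) l; rewrite mxE => H.
  rewrite -[_ * _](subrK mu) (le_trans (ler_normD _ _))// mulr_natl mulr2n lerD//.
    by rewrite (le_trans H)// (le_trans sc').
  by rewrite ger0_norm.
- rewrite (le_trans _ t1)// (@FeE (x, y, s) l cx) /=.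
  have := coord_le_enorm (\row_j eqc P j x) l; rewrite mxE => H.
  by rewrite (le_trans H)// (le_trans se).
Qed.

(** Inherited from [Jh]: directly in the last two components, through pairings and nondegeneracy in
    the first. *)
Lemma jacF_push_linear w : cdom c w.1.1 -> linear (fun d => jacF G P w (push w d)).
Proof.
case: w => [[x y] s] /= cx a d d'.
case: d d' => [[u dy] ds] [[u' dy'] ds'].
have [a1 a2 a3] := jacF_coord Ac CP so y s (a *: u + u') (a *: dy + dy') (a *: ds + ds') cx.
have [b1 b2 b3] := jacF_coord Ac CP so y s u dy ds cx.
have [e1 e2 e3] := jacF_coord Ac CP so y s u' dy' ds' cx.
have cz := cran_cmap cx.
have lJ := @Jh_linear R n m p M A Rt c Ac P CP (cmap c x, y, s) cz a (u, dy, ds) (u', dy', ds').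
have tripleE (q q' : V) : q.1.1 = q'.1.1 -> q.1.2 = q'.1.2 -> q.2 = q'.2 -> q = q'.
  by case: q q' => [[? ?] ?] [[? ?] ?] /= -> -> ->.
apply: tripleE.
- apply/eqP; rewrite -subr_eq0; apply/eqP; apply: (ip_nondeg (G := G) (x := x)) => t.
  rewrite -(tvecK t Ac cx); apply: (etrans (ip_subl _ _ _ _ _ _ _)).
  apply/eqP; rewrite subr_eq0; apply/eqP; apply: (etrans (a1 _)).
  rewrite (jL_linear Rt Ac CP (w := (cmap c x, y, s)) _ a (u, dy, ds) (u', dy', ds') cz).
  by rewrite -b1 -e1.
- apply: (etrans a2); apply: (etrans (congr1 (fun t : V => t.1.2) lJ)).
  exact: (esym (f_equal2 (fun u v => a *: u + v) b2 e2)).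
- apply: (etrans a3); apply: (etrans (congr1 (fun t : V => t.2) lJ)).
  exact: (esym (f_equal2 (fun u v => a *: u + v) b3 e3)).
Qed.

(** Near the solution [Jh] is bounded below, so [jacF] after [push] is an injective linear map of a
    finite-dimensional space, hence bijective; [push] is invertible, so [jacF] is bijective too. The
    same lower bound controls d by the right-hand side. *)
Lemma newton_direction : exists al r : R, [/\ 0 < al, 0 < r & forall w mu,
  cdom c w.1.1 -> `|hat w - ws| < r -> bijective (jacF G P w) /\
  exists d, [/\ jacF G P w (push w d) = - KKT_map G P mu w,
    forall v, jL (hat w) d v = - gL (hat w) v,
    forall i, (hat w).1.2 0 i * 'D_(d.1.1) (Fg i) (hat w).1.1 + Fg i (hat w).1.1 * d.1.2 0 i =
      mu - Fg i (hat w).1.1 * (hat w).1.2 0 i,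
    forall j, 'D_(d.1.1) (Fe j) (hat w).1.1 = - Fe j (hat w).1.1 &
    al * `|d| <= `|Fh (hat w)| + `|const_mx mu : 'rV[R]_m| ]].
Proof.
have [al al0 /near_ball[r [r0 H]]] := Jh_lower Ac cxs CP so kkt sc licq sosc.
exists al, r; split=> // w mu cx wr.
have lower := H _ wr.
have inj d : jacF G P w (push w d) = 0 -> d = 0.
  case: w d cx wr lower => [[x y] s] [[u dy] ds] /= cx wr lower.
  move=> /(jacF_coord_eq0 Ac CP so y s u dy ds cx) E; have := lower (u, dy, ds).
  rewrite /hat /= E normr0 pmulr_rle0// normr_le0 => /eqP; exact.
have [g [_ gK Kg]] := linear_inj_inverse (jacF_push_linear cx) inj.
pose pull (d : V) : V := (tcov A c w.1.1 d.1.1, d.1.2, d.2).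
have pushK d : pull (push w d) = d.
  by case: d => [[u dy] ds]; rewrite /pull /push /= (tcovK u Ac cx).
have pullK d : push w (pull d) = d.
  by case: d => [[u dy] ds]; rewrite /pull /push /= (tvecK u Ac cx).
split.
  exists (push w \o g) => d /=; last exact: Kg.
  by rewrite -[d in LHS]pullK gK pullK.
pose d := g (- KKT_map G P mu w); exists d.
have E : jacF G P w (push w d) = - KKT_map G P mu w by exact: Kg.
have [E1 E2 E3] : [/\ forall v, jL (hat w) d v = - gL (hat w) v,
    forall i, (hat w).1.2 0 i * 'D_(d.1.1) (Fg i) (hat w).1.1 + Fg i (hat w).1.1 * d.1.2 0 i =
      mu - Fg i (hat w).1.1 * (hat w).1.2 0 i &
    forall j, 'D_(d.1.1) (Fe j) (hat w).1.1 = - Fe j (hat w).1.1].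
  clearbody d; clear pull pushK pullK H lower inj gK Kg.
  case: w d cx wr E => [[x y] s] [[u dy] ds] cx wr E; rewrite /= in cx wr.
  have {}E : jacF G P (x, y, s) (tvec A c (cmap c x) u, dy, ds) = - KKT_map G P mu (x, y, s) := E.
  have [H1 H2 H3] := jacF_coord Ac CP so y s u dy ds cx; rewrite /hat /=; split.
  - move=> v; rewrite -H1 E.
    rewrite /KKT_map /= -(ip_grad_lag G Ac CP y s v cx).
    by rewrite -scaleN1r /ip bilinZl mulN1r.
  - move=> i; have := congr1 (fun t : 'rV[R]_m => t 0 i) H2.
    rewrite E /= !mxE opprB /= => <-.
    by rewrite (@FgE (x, y, s) i cx).
  - move=> i; have := congr1 (fun t : 'rV[R]_p => t 0 i) H3.
    rewrite E /= !mxE /= => <-.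
    by rewrite (@FeE (x, y, s) i cx).
split=> //; rewrite (le_trans (lower d))//.
have -> : Jh (hat w) d = (0, const_mx mu, 0) - Fh (hat w).
  congr (_, _, _); apply/rowP => l; rewrite !mxE ?sub0r.
  - exact: E1.
  - exact: E2.
  - exact: E3.
rewrite (le_trans (ler_normB _ _))// addrC lerD2l norm_triple_le /=.
by rewrite !normr0 !normr_ge0 lexx.
Qed.

(** By strict complementarity one of the two factors is positive at the solution, hence nearby; the
    sign of the product decides the other. Strict feasibility of the Newton point thus follows from
    its small complementarity residual. *)
Lemma positivity_near : exists2 r : R, 0 < r & forall w i, cdom c w.1.1 ->
  `|hat w - ws| < r -> 0 < ineq P i w.1.1 * w.1.2 0 i ->
  0 < ineq P i w.1.1 /\ 0 < w.1.2 0 i.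
Proof.
have [_ gs0 ys0] := kkt.
suff H i : \forall h \near ws, 0 < Fg i (h : V).1.1 \/ 0 < (h : V).1.2 0 i.
  have [r [r0 Hr]] := near_ball (near_forall H); exists r => // w i cx wr gy.
  have := Hr _ wr i; rewrite FgE//= => -[|] h0.
    by move: gy; rewrite pmulr_rgt0.
  by move: gy; rewrite pmulr_lgt0.
have [y0|y0] := eqVneq (ys 0 i) 0.
  have g0 : 0 < Fg i zs.
    rewrite (@FgE (xs, ys, ss) i cxs) lt_def gs0 andbT.
    by have := sc i; rewrite y0 eqxx addTb.
  have [dF _ _] := F_C2 Ac CP (inr (inl i)).
  have cF : {for ws, continuous (fun w : V => Fg i w.1.1)}.
    by apply: (comp1_continuous (f := Fg i)); apply: differentiable_continuous; exact: dF.
  have : \forall h \near ws, 0 < Fg i (h : V).1.1 by exact: (cvgr_gt _ cF).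
  by apply: filterS => h; left.
have yp : 0 < ys 0 i by rewrite lt_def y0 ys0.
have cy : {for ws, continuous (fun w : V => w.1.2 0 i)}.
  by apply: differentiable_continuous; exact: entry2_differentiable.
have : \forall h \near ws, 0 < (h : V).1.2 0 i by exact: (cvgr_gt _ cy).
by apply: filterS => h; right.
Qed.

(** The stopping conditions use the Riemannian norm of the gradient, the chart estimate bounds a
    covector. Testing that covector on the gradient itself and dividing by its norm links the
    two. *)
Lemma step_estimate : exists C r : R, [/\ 0 < C, 0 < r & forall w d mu,
  let w' := step Rt w (push w d) in
  cdom c w.1.1 -> `|hat w - ws| < r -> `|d| < r ->
  (forall v, jL (hat w) d v = - gL (hat w) v) ->
  (forall i, (hat w).1.2 0 i * 'D_(d.1.1) (Fg i) (hat w).1.1 + Fg i (hat w).1.1 * d.1.2 0 i =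
     mu - Fg i (hat w).1.1 * (hat w).1.2 0 i) ->
  (forall j, 'D_(d.1.1) (Fe j) (hat w).1.1 = - Fe j (hat w).1.1) ->
  [/\ cdom c w'.1.1, `|hat w' - hat w| <= 2 * `|d|,
    tnorm G w'.1.1 (grad_lag G P w') <= C * `|d| ^+ 2 /\
    (forall v, `|gL (hat w') v| <= C * `|d| ^+ 2 * `|v|),
    forall i, `|ineq P i w'.1.1 * w'.1.2 0 i - mu| <= C * `|d| ^+ 2
    & forall j, `|eqc P j w'.1.1| <= C * `|d| ^+ 2]].
Proof.
have [C [r1 [C0 r10 H1]]] := newton_estimate Ac ys ss cxs CP lip.
have [K K0 /near_ball[r2 [r20 HK]]] := tvec_norm_equiv G Ac cxs.
pose r := Num.min r1 (r2 / 3).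
have r23 : 0 < r2 / 3 by rewrite divr_gt0.
have third (a b e : R) : a <= 2 * e -> b < r2 / 3 -> e < r2 / 3 -> a + b < r2.
  by move=> *; lra.
exists (C * K + C), r; split; first by rewrite addr_gt0// mulr_gt0.
  by rewrite lt_min r10.
move=> w d mu w' cx; rewrite !lt_min => /andP[wr1 wr2] /andP[dr1 dr2] E1 E2 E3.
have [D1 D2 D3 D4 D5] := H1 (hat w) d mu wr1 dr1 E1 E2 E3.
have [cx' hE] : cdom c w'.1.1 /\ hat w' = newton_point Rt c (hat w) d.
  rewrite /w'; clear - Ac cx D1; case: w d cx D1 => [[x y] s] [[u dy] ds] /= cx.
  move=> /rdomE[_]; rewrite (cmapK Ac cx) => Dx; split; first exact: Dx.
  by rewrite /hat /newton_point /= rhoE (cmapK Ac cx).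
rewrite -hE in D2 D3 D4 D5.
have q0 : 0 <= `|d| ^+ 2 by rewrite sqr_ge0.
have CK : C <= C * K + C by rewrite lerDr mulr_ge0 ?ltW.
have CKd : C * `|d| ^+ 2 <= (C * K + C) * `|d| ^+ 2 by rewrite ler_wpM2r.
have d3 : 0 <= C * `|d| ^+ 2 by rewrite mulr_ge0// ltW.
split=> //; last 2 first.
- by move=> i; have := D4 i; rewrite (FgE i cx') => /le_trans; apply.
- by move=> j; have := D5 j; rewrite (FeE j cx') => /le_trans; apply.
split; last by move=> v; rewrite (le_trans (D3 v))// ler_wpM2r.
set t := tnorm _ _ _.
have t0 : 0 <= t by exact: tnorm_ge0.
have wr' : `|hat w' - ws| < r2.
  rewrite -(subrK (hat w) (hat w')) -addrA (le_lt_trans (ler_normD _ _))//.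
  exact: third D2 wr2 dr2.
pose v := tcov A c w'.1.1 (grad_lag G P w').
have vK : tvec A c (cmap c w'.1.1) v = grad_lag G P w' by exact: tvecK.
have vt : `|v| <= K * t.
  by have [_] := HK _ (hat_near1 wr') v; rewrite (cmapK Ac cx') vK.
have : t ^+ 2 <= C * `|d| ^+ 2 * (K * t).
  rewrite /t tnorm_sqr -{2}vK (ip_grad_hat _ cx') (le_trans (ler_norm _))//.
  by rewrite (le_trans (D3 v))// ler_wpM2l.
have [->|tn] := eqVneq t 0.
  by move=> _; rewrite (le_trans d3).
rewrite expr2 mulrA ler_pM2r ?lt_def ?tn// => /le_trans; apply.
by rewrite mulrAC ler_wpM2r// lerDl ltW.
Qed.

End StepInChart.

(** * One iteration of the algorithm *)

Section StepArithmetic.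
Context (R : realType).
Implicit Types (a b e d f t : R).

(** The square of be e + b is at most twice the sum of squares, and b^2 <= b since b <= 1: the
    barrier term stays of first order while the error enters squared. *)
Lemma quadratic_bound (al be C e b d : R) :
  0 < al -> 0 <= be -> 0 <= C -> 0 <= e -> 0 <= b -> b <= 1 -> 0 <= d ->
  al * d <= be * e + b -> C * d ^+ 2 + b <= (2 * C * (be ^+ 2 + 1) / al ^+ 2 + 1) * (e ^+ 2 + b).
Proof.
move=> al0 be0 C0 e0 b0 b1 d0 H.
have al2 : 0 < al ^+ 2 by rewrite exprn_gt0.
have D : d ^+ 2 <= 2 * (be ^+ 2 + 1) / al ^+ 2 * (e ^+ 2 + b).
  rewrite mulrAC ler_pdivlMr// -exprMn mulrC.
  have ad0 : 0 <= al * d by rewrite mulr_ge0// ltW.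
  apply: (@le_trans _ _ ((be * e + b) ^+ 2)).
    by rewrite ler_pXn2r// ?nnegrE// (le_trans ad0).
  have be2 := sqr_ge0 be; have e2 := sqr_ge0 e; have dif := sqr_ge0 (be * e - b).
  have bb : b ^+ 2 <= b by rewrite expr2 ler_piMr.
  have pe : 0 <= be ^+ 2 * b by rewrite mulr_ge0.
  rewrite sqrrB exprMn in dif; rewrite sqrrD exprMn.
  by rewrite mulr2n in dif *; clear - be2 e2 dif bb pe; lra.
have : C * d ^+ 2 <= 2 * C * (be ^+ 2 + 1) / al ^+ 2 * (e ^+ 2 + b).
  rewrite (_ : 2 * C * (be ^+ 2 + 1) / al ^+ 2 * (e ^+ 2 + b) =
     C * (2 * (be ^+ 2 + 1) / al ^+ 2 * (e ^+ 2 + b))); last by ring.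
  by rewrite ler_wpM2l.
move=> H'; rewrite [leRHS]mulrDl mul1r; apply: lerD => //.
by rewrite lerDr sqr_ge0.
Qed.

Lemma half_bound (g mu k b : R) : `|g - mu| <= k -> k <= 2^-1 * mu -> `|g| <= b -> mu <= 2 * b.
Proof. by move=> /ler_normlP[? ?] ? /ler_normlP[? ?]; lra. Qed.

End StepArithmetic.

Lemma const_mx_le (R : realType) k (t : R) : 0 <= t -> `|const_mx t : 'rV[R]_k| <= t.
Proof. by move=> t0; apply: norm_row_le => // i; rewrite mxE ger0_norm. Qed.

Section NewtonStep.
Context (R : realType) (n m p : nat) (M : topologicalType) (A : manifold R n M).
Context (G : riemannian A) (Rt : retraction A).
Context (c : chart R n M) (Ac : atlas A c) (P : nlp R M m p).
Context (xs : M) (ys : 'rV[R]_m) (ss : 'rV[R]_p) (cxs : cdom c xs).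
Notation V := (incr R n m p).
Local Notation Fh := (Fh c P).
Local Notation hat := (hat c).
Implicit Types (d : V) (w : pdpoint R M m p).
Hypotheses (CP : C2_nlp A P) (so : second_order G Rt).
Hypotheses (kkt : KKT G P (xs, ys, ss)) (sc : strict_complementarity P (xs, ys, ss)).
Hypotheses (licq : LICQ G P xs) (sosc : SOSC G P (xs, ys, ss)).
Hypothesis lip : forall k, pullback_hess_lipschitz G Rt (theta P k) xs.
Let ws : V := (cmap c xs, ys, ss).
Local Notation err w := `|hat w - ws|.
Local Notation bar mu := `|const_mx mu : 'rV[R]_m|.

Lemma stopping_of_bounds (phiL phic phie : R -> R) (kl kap mu : R) w :
  0 < mu -> 0 < kap -> kap < 1 -> (m + p).+1%:R * kap <= kl ->
  kl * mu <= phiL mu -> kl * mu <= phic mu -> kl * mu <= phie mu ->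
  tnorm G w.1.1 (grad_lag G P w) <= kap * mu ->
  (forall i, `|ineq P i w.1.1 * w.1.2 0 i - mu| <= kap * mu) ->
  (forall j, `|eqc P j w.1.1| <= kap * mu) ->
  (forall i, 0 < ineq P i w.1.1 * w.1.2 0 i ->
    0 < ineq P i w.1.1 /\ 0 < w.1.2 0 i) ->
  stopping G P phiL phic phie mu w.
Proof.
case: w => [[x y] s] /= mu0 k0 k1 kl' HL Hc He Bg Bc Be pos.
have km0 : 0 <= kap * mu by rewrite mulr_ge0// ltW.
have N k : (k <= (m + p).+1)%N -> k%:R * (kap * mu) <= kl * mu.
  move=> kN; rewrite mulrA ler_pM2r// (le_trans _ kl')// ler_pM2r// ler_nat//.
have gy i : 0 < ineq P i x * y 0 i.
  have /ler_normlP[] := Bc i; have : kap * mu < mu by rewrite gtr_pMl.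
  by move: (_ * y 0 i) (kap * mu) => *; lra.
split.
- by rewrite (le_trans Bg)// (le_trans _ HL)//; have := N 1%N; rewrite mul1r; apply.
- rewrite (le_trans _ Hc)// (le_trans (enorm_le (B := kap * mu) _ _))//.
    by move=> i; rewrite mxE.
  by apply: N; rewrite leqW// leq_addr.
- rewrite (le_trans _ He)// (le_trans (enorm_le (B := kap * mu) _ _))//.
    by move=> i; rewrite mxE.
  by apply: N; rewrite leqW// leq_addl.
- by move=> i; have [] := pos i (gy i).
- by move=> i; have [] := pos i (gy i).
Qed.

(* [bar mu] is mu if there are inequality constraints and 0 otherwise; only in
   this form is the barrier parameter bounded by the error of the next iterate. *)
Lemma newton_step (phiL phic phie : R -> R) (K kl rA : R) : 0 < K -> 0 < kl -> 0 < rA ->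
  exists r C t0 eta : R, [/\ 0 < r <= rA, 0 < C, 0 < t0, 0 < eta & forall w t mu,
    cdom c w.1.1 -> err w < r -> `|Fh (hat w)| <= K * t ->
    0 < mu -> mu <= t -> t < t0 -> t ^+ 2 <= eta * mu ->
    kl * mu <= phiL mu -> kl * mu <= phic mu -> kl * mu <= phie mu ->
    err w <= C * t /\
    exists d, [/\ bijective (jacF G P w), jacF G P w d = - KKT_map G P mu w,
      stopping G P phiL phic phie mu (step Rt w d) &
      [/\ cdom c (step Rt w d).1.1, err (step Rt w d) < r,
        err (step Rt w d) <= C * (err w ^+ 2 + bar mu) &
        bar mu <= C * err (step Rt w d)]]].
Proof.
move=> K0 kl0 rA0.
have [a [be [r1 [a0 be0 r10 HF]]]] := Fh_equiv Ac cxs CP so kkt sc licq sosc.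
have [al [r2 [al0 r20 HD]]] := newton_direction Ac cxs CP so kkt sc licq sosc.
have [C0 [r3 [C00 r30 HS]]] := step_estimate Ac ys ss cxs CP lip.
have [r4 r40 HP] := positivity_near Ac cxs CP kkt sc.
pose r := Num.min rA (Num.min (Num.min r1 r2) (Num.min r3 r4)).
have r0 : 0 < r by rewrite !lt_min rA0 r10 r20 r30 r40.
have [rrA rr1 rr2 rr3 rr4] : [/\ r <= rA, r <= r1, r <= r2, r <= r3 & r <= r4].
  by split; rewrite /r !ge_min lexx ?orbT.
(* |d| <= D t, because al |d| is at most |Fh| plus mu, hence at most K t + t. *)
pose D := (K + 1) / al.
have D0 : 0 < D by rewrite divr_gt0// addr_gt0.
(* [C1 * t] dominates |d| and also err w + 2|d|, a bound for the next error; t < r / C1 keeps the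
   next iterate in the ball. *)
pose C1 := K / a + 2 * D + D.
have Ka0 : 0 < K / a by rewrite divr_gt0.
have C10 : 0 < C1 by rewrite /C1; lra.
have DC1 : D <= C1 by rewrite /C1; move: (K / a) Ka0 => q; lra.
have C1E (x y t : R) : x <= K / a * t -> y <= D * t -> 0 <= t -> 2 * y + x <= C1 * t.
  move=> xa yD t0; have : 0 <= D * t by rewrite mulr_ge0// ltW.
  by rewrite /C1; move: (K / a) xa yD => q; lra.
have N0 : 0 < (m + p).+1%:R :> R by rewrite ltr0n.
(* Residuals of size kap mu in each coordinate pass the stopping tests even after summation into
   Euclidean norms; kap <= 1/2 keeps every product g_i y_i at least mu / 2. *)
pose kap := Num.min (kl / (m + p).+1%:R) 2^-1.
have kap0 : 0 < kap by rewrite lt_min divr_gt0//=.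
have kap2 : kap <= 2^-1 by rewrite /kap ge_min lexx orbT.
have kapN : (m + p).+1%:R * kap <= kl.
  by rewrite mulrC -ler_pdivlMr// /kap ge_min lexx.
(* The residual C0 |d|^2 is at most C0 D^2 t^2, and t^2 <= eta mu makes it at most kap mu. This is
   the use of (A3). *)
pose eta := kap / (C0 * D ^+ 2).
have CD0 : 0 < C0 * D ^+ 2 by rewrite mulr_gt0// exprn_gt0.
have etaE : C0 * D ^+ 2 * eta = kap by rewrite /eta mulrC divfK ?gt_eqF.
have eta0 : 0 < eta by rewrite divr_gt0.
pose C2 := (2 * C0 * (be ^+ 2 + 1) / al ^+ 2 + 1) / a.
have C20 : 0 < C2.
  rewrite divr_gt0// ltr_wpDl// !mulr_ge0// ?(ltW C00) ?addr_ge0 ?sqr_ge0//.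
  by rewrite invr_ge0 sqr_ge0.
pose C := K / a + C2 + 2 * be.
have be20 : 0 <= 2 * be by rewrite mulr_ge0// ltW.
have [CKa CC2 Cbe] : [/\ K / a <= C, C2 <= C & 2 * be <= C].
  rewrite /C; split; first by rewrite -addrA lerDl addr_ge0// ltW.
    by rewrite addrAC lerDr addr_ge0// ltW.
  by rewrite lerDr addr_ge0// ltW.
have CC : 0 < C by exact: lt_le_trans CC2.
exists r, C, (Num.min (r / C1) 1), eta; split=> //; first by rewrite r0.
  by rewrite lt_min ltr01 divr_gt0.
move=> w t mu cx wr Fw mu0 mut; rewrite lt_min => /andP[tr t1] teta HL Hc He.
have t0 : 0 < t by exact: lt_le_trans mut.
have bm : bar mu <= mu by rewrite const_mx_le// ltW.
have /andP[Fa Fb] := HF _ (lt_le_trans wr rr1).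
have ew : err w <= K / a * t.
  by rewrite mulrAC ler_pdivlMr// mulrC (le_trans Fa).
split; first by rewrite (le_trans ew)// ler_wpM2r// ltW.
have [bij [d [E1 E2 E3 E4 E5]]] := HD w mu cx (lt_le_trans wr rr2).
have dt : `|d| <= D * t.
  rewrite /D mulrAC ler_pdivlMr// mulrC (le_trans E5)// mulrDl mul1r lerD//.
  exact: le_trans mut.
have C1t : C1 * t < r by rewrite mulrC -ltr_pdivlMr.
have Dr : `|d| < r.
  by rewrite (le_lt_trans dt)// (le_lt_trans _ C1t)// ler_wpM2r// ltW.
have [cx' Dw [Bg Bl] Bc Be] := HS w d mu cx (lt_le_trans wr rr3) (lt_le_trans Dr rr3) E2 E3 E4.
set w' := step _ _ _ in cx' Dw Bg Bl Bc Be.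
have wr' : err w' < r.
  rewrite -(subrK (hat w) (hat w')) -addrA (le_lt_trans (ler_normD _ _))//.
  rewrite (le_lt_trans _ C1t)// (le_trans _ (C1E _ _ _ ew dt (ltW t0)))// lerD2r//.
have d2 : C0 * `|d| ^+ 2 <= kap * mu.
  apply: (@le_trans _ _ (C0 * D ^+ 2 * t ^+ 2)).
    by rewrite -mulrA -exprMn ler_wpM2l ?(ltW C00)// ler_pXn2r ?nnegrE// (le_trans _ dt).
  have : C0 * D ^+ 2 * t ^+ 2 <= C0 * D ^+ 2 * (eta * mu) by rewrite ler_wpM2l// ltW.
  by rewrite [C0 * D ^+ 2 * (eta * mu)]mulrA etaE.
exists (push A c w d); rewrite -/w'; split; [exact: bij|exact: E1| |].
  apply: (stopping_of_bounds mu0 kap0 _ kapN HL Hc He).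
  - by rewrite (le_lt_trans kap2)// invf_lt1// ltr1n.
  - exact: le_trans d2.
  - by move=> i; exact: le_trans d2.
  - by move=> j; exact: le_trans d2.
  - by move=> i; apply: HP => //; exact: lt_le_trans rr4.
have /andP[Fa' Fb'] := HF _ (lt_le_trans wr' rr1).
have b1 : bar mu <= 1 by rewrite (le_trans bm)// (le_trans mut)// ltW.
split; [exact: cx'|exact: wr'| |].
- have Fw' : `|Fh (hat w')| <= C0 * `|d| ^+ 2 + bar mu.
    have q0 : 0 <= C0 * `|d| ^+ 2 by rewrite mulr_ge0// ltW.
    have q1 : 0 <= C0 * `|d| ^+ 2 + bar mu by rewrite addr_ge0.
    have q2 : C0 * `|d| ^+ 2 <= C0 * `|d| ^+ 2 + bar mu by rewrite lerDl.
    rewrite norm_triple_le /=; apply/and3P; split; apply: norm_row_le => // l; rewrite mxE.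
    + by rewrite (le_trans (Bl _))// (le_trans _ q2)// ler_piMr// norm_basis_vec.
    + rewrite (FgE Ac P l cx') -[_ * _](subrK mu) (le_trans (ler_normD _ _))// lerD//.
      by have := norm_coord_le (const_mx mu : 'rV[R]_m) l; rewrite mxE.
    + by rewrite (FeE Ac P l cx') (le_trans (Be l)).
  have ald : al * `|d| <= be * err w + bar mu by rewrite (le_trans E5)// lerD2r.
  have Q := quadratic_bound al0 (ltW be0) (ltW C00) (normr_ge0 _) (normr_ge0 _) b1 (normr_ge0 d) ald.
  have aw := le_trans Fa' (le_trans Fw' Q).
  apply: (@le_trans _ _ (C2 * (err w ^+ 2 + bar mu))).
    by rewrite /C2 mulrAC ler_pdivlMr// mulrC.
  by rewrite ler_wpM2r// addr_ge0// sqr_ge0.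
(* Each product g_i y_i is within mu / 2 of mu and is an entry of [Fh], which is at most be times
   the error. *)
- have e0 : 0 <= 2 * be * err w' by rewrite !mulr_ge0// ltW.
  apply: (@le_trans _ _ (2 * be * err w')); last by rewrite ler_wpM2r.
  apply: norm_row_le => // i; rewrite mxE ger0_norm ?(ltW mu0)//.
  rewrite -mulrA; apply: (half_bound (le_trans (Bc i) d2)); first by rewrite ler_wpM2r// ltW.
  apply: le_trans Fb'; apply: le_trans (norm_triple2 _); apply: le_trans (norm_coord_le _ i).
  by rewrite /= mxE (FgE Ac P i cx').
Qed.

End NewtonStep.

(** * Local convergence *)

Section Sequences.
Context (R : realType).
Implicit Types (u : nat -> R).

Lemma cvg0_eventually u (e : R) : u k @[k --> \oo] --> 0 -> 0 < e ->
  exists K, forall k, (K <= k)%N -> `|u k| <= e.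
Proof.
by move=> /cvgr0Pnorm_le/(_ e) H e0; have [K _ HK] := H e0; exists K => k /HK.
Qed.

Lemma positive_lower_bound u K : (forall k, 0 < u k) ->
  exists2 d, 0 < d & forall k, (k < K)%N -> d <= u k.
Proof.
move=> u0; elim: K => [|K [d d0 IH]]; first by exists 1.
exists (Num.min d (u K)); first by rewrite lt_min d0 u0.
by move=> k; rewrite ltnS leq_eqVlt => /orP[/eqP->|/IH H]; rewrite ge_min ?lexx ?orbT// H.
Qed.

Lemma nonincreasing_from u K : (forall k, (K <= k)%N -> u k.+1 <= u k) ->
  forall N k, (K <= N)%N -> u (N + k)%N <= u N.
Proof.
move=> H N k KN; elim: k => [|k IH]; first by rewrite addn0.
by rewrite addnS (le_trans _ IH)// H// (leq_trans KN)// leq_addr.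
Qed.

End Sequences.

Section Barrier.
Context (R : realType) (m : nat).
Local Notation bar mu := `|const_mx mu : 'rV[R]_m|.

Lemma barZ (a t : R) : 0 <= a -> bar (a * t) = a * bar t.
Proof.
move=> a0; have -> : const_mx (a * t) = a *: const_mx t :> 'rV[R]_m.
  by apply/rowP => i; rewrite !mxE.
by rewrite normrZ ger0_norm.
Qed.

Lemma bar_powR (c t q : R) : 0 <= c -> 0 <= t -> 0 < q -> bar (c * t `^ q) <= c * bar t `^ q.
Proof.
move=> c0 t0 q0; rewrite barZ// ler_wpM2l//.
apply: norm_row_le => [|i]; first exact: powR_ge0.
rewrite mxE ger0_norm ?powR_ge0// ge0_ler_powR ?(ltW q0) ?nnegrE//.
have := norm_coord_le (const_mx t : 'rV[R]_m) i.
by rewrite mxE => /(le_trans (ler_norm _)).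
Qed.

End Barrier.

(** * Comparison of distances in two charts *)

Section ChartDistance.
Context (R : realType) (n m p : nat) (M : topologicalType) (A : manifold R n M).
Implicit Types (w : pdpoint R M m p).

Lemma chart_dist_ge0 (c : chart R n M) w w' : 0 <= chart_dist c w w'.
Proof. by case: w w' => [[x y] s] [[x' y'] s']; exact: sqrtr_ge0. Qed.

Lemma sqrt_sum_bounds (a b e : R) : 0 <= a -> 0 <= b -> 0 <= e ->
  let q := Num.sqrt (a ^+ 2 + b ^+ 2 + e ^+ 2) in
  [/\ a <= q, b <= q, e <= q & q <= a + b + e].
Proof.
move=> a0 b0 e0 q; have q0 : 0 <= q by exact: sqrtr_ge0.
have qq : q ^+ 2 = a ^+ 2 + b ^+ 2 + e ^+ 2 by rewrite sqr_sqrtr// !addr_ge0 ?sqr_ge0.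
have le2 s t : 0 <= s -> 0 <= t -> s ^+ 2 <= t ^+ 2 -> s <= t.
  by move=> s0 t0; rewrite ler_pXn2r ?nnegrE.
split; apply: le2; rewrite ?addr_ge0// qq.
- by rewrite -addrA lerDl addr_ge0 ?sqr_ge0.
- by rewrite addrAC lerDr addr_ge0 ?sqr_ge0.
- by rewrite lerDr addr_ge0 ?sqr_ge0.
- have ab := mulr_ge0 a0 b0; have ae := mulr_ge0 a0 e0; have be := mulr_ge0 b0 e0.
  by rewrite !expr2; lra.
Qed.

(** Both transition maps are differentiable at the point, hence Lipschitz relative to it, so error
    estimates in one chart give those in any other. *)
Lemma chart_dist_equiv (c c' : chart R n M) xs ys ss : atlas A c -> atlas A c' ->
  cdom c xs -> cdom c' xs -> let ws : pdpoint R M m p := (xs, ys, ss) in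
  exists D r : R, [/\ 0 < D, 0 < r & forall w, cdom c w.1.1 ->
    `|hat c w - hat c ws| < r ->
    chart_dist c' w ws <= D * `|hat c w - hat c ws| /\
    `|hat c w - hat c ws| <= D * chart_dist c' w ws].
Proof.
move=> Ac Ac' cx c'x ws; have cz := cran_cmap cx; have c'z := cran_cmap c'x.
have [L [L0 HL]] := differentiable_lipschitz_at (trans_differentiable Ac Ac' cx c'x).
have [L' [L'0 HL']] := differentiable_lipschitz_at (trans_differentiable Ac' Ac c'x cx).
have xE : (cmap c' \o cinv c) (cmap c xs) = cmap c' xs by rewrite /= (cmapK Ac cx).
have xE' : (cmap c \o cinv c') (cmap c' xs) = cmap c xs by rewrite /= (cmapK Ac' c'x).
have c'i : cdom c' (cinv c (cmap c xs)) by rewrite (cmapK Ac cx).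
have [r1 [r10 H1]] := near_ball (near_and HL (near_cinv Ac cz (cdom_open Ac') c'i)).
have [r2 [r20 H2]] := near_ball HL'.
pose D := n%:R * L + m%:R + p%:R + L' + 1.
have nL : 0 <= n%:R * L by rewrite mulr_ge0// ltW.
have m0 : 0 <= m%:R :> R by []. have p0 : 0 <= p%:R :> R by [].
have L'D : L' <= D by rewrite /D; lra.
have D1 : 1 <= D by rewrite /D; lra.
have DE : n%:R * L + m%:R + p%:R <= D by rewrite /D; lra.
have D0 : 0 < D by exact: lt_le_trans D1.
exists D, (Num.min r1 (r2 / L)); split=> //; first by rewrite lt_min r10 divr_gt0.
move=> [[x y] s] /= cx1; rewrite lt_min => /andP[wr1 wr2].
set e := `|_ - _| in wr1 wr2 *.
have e0 : 0 <= e by exact: normr_ge0.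
have ze : `|cmap c x - cmap c xs| <= e by exact: (norm_triple1 (hat c (x, y, s) - hat c ws)).
have ye : `|y - ys| <= e by exact: (norm_triple2 (hat c (x, y, s) - hat c ws)).
have se : `|s - ss| <= e by exact: (norm_triple3 (hat c (x, y, s) - hat c ws)).
have [h1 c'x1] := H1 _ (le_lt_trans ze wr1).
rewrite xE /= (cmapK Ac cx1) in h1; rewrite (cmapK Ac cx1) in c'x1.
have z'e : `|cmap c' x - cmap c' xs| <= L * e by rewrite (le_trans h1)// ler_wpM2l// ltW.
have h2 : `|cmap c x - cmap c xs| <= L' * `|cmap c' x - cmap c' xs|.
  have := H2 (cmap c' x); rewrite xE' /= (cmapK Ac' c'x1); apply.
  by rewrite (le_lt_trans z'e)// mulrC -ltr_pdivlMr.
have [q1 q2 q3 q4] := sqrt_sum_bounds (enorm_ge0 (cmap c' x - cmap c' xs))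
  (enorm_ge0 (y - ys)) (enorm_ge0 (s - ss)).
set q := Num.sqrt _ in q1 q2 q3 q4 *.
have q0 : 0 <= q by exact: sqrtr_ge0.
have en k (v : 'rV[R]_k) B : `|v| <= B -> enorm v <= k%:R * B.
  move=> vB; apply: enorm_le => [i|]; last exact: le_trans vB.
  by rewrite (le_trans (norm_coord_le _ _)).
split.
  rewrite (le_trans q4)// (le_trans (lerD (lerD (en _ _ _ z'e) (en _ _ _ ye)) (en _ _ _ se)))//.
  by rewrite mulrA -!mulrDl ler_wpM2r.
rewrite /e norm_triple_le /=; apply/and3P; split.
- rewrite (le_trans h2)// ler_pM ?(ltW L'0)//.
  by rewrite (le_trans (norm_le_enorm _)).
- by rewrite (le_trans (norm_le_enorm _))// (le_trans q2)// ler_peMl.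
- by rewrite (le_trans (norm_le_enorm _))// (le_trans q3)// ler_peMl.
Qed.

End ChartDistance.

(** * Induction along the algorithm *)

Section Iteration.
Context (R : realType) (n m p : nat) (M : topologicalType) (A : manifold R n M).
Context (G : riemannian A) (Rt : retraction A).
Context (c : chart R n M) (Ac : atlas A c) (P : nlp R M m p).
Context (xs : M) (ys : 'rV[R]_m) (ss : 'rV[R]_p) (cxs : cdom c xs).
Context (phiL phic phie : R -> R) (nu : nat -> R).
Local Notation hat := (hat c).
Implicit Types (w : nat -> pdpoint R M m p).
Hypotheses (CP : C2_nlp A P) (so : second_order G Rt).
Hypotheses (kkt : KKT G P (xs, ys, ss)) (sc : strict_complementarity P (xs, ys, ss)).
Hypotheses (licq : LICQ G P xs) (sosc : SOSC G P (xs, ys, ss)).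
Hypothesis lip : forall k, pullback_hess_lipschitz G Rt (theta P k) xs.
Hypothesis nu0 : forall k, 0 < nu k.
Hypotheses (cL : forcing_comparable phiL (fun k => nu k.+1))
  (cc : forcing_comparable phic (fun k => nu k.+1))
  (ce : forcing_comparable phie (fun k => nu k.+1)).
Hypothesis nu_sqr : (nu k ^+ 2 / nu k.+1) @[k --> \oo] --> 0.
Hypothesis nu_dec : \forall k \near \oo, nu k.+1 <= nu k.
Let ws : incr R n m p := (cmap c xs, ys, ss).
Local Notation err w := `|hat w - ws|.
Local Notation bar mu := `|const_mx mu : 'rV[R]_m|.

(** The invariant is membership in the ball together with the stopping conditions for the current
    parameter; [newton_step] reproduces both, with the next parameter as mu and the current one as
    t. *)
Lemma iteration : exists r delta C : R, [/\ 0 < r, 0 < delta, 0 < C & forall N w,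
  nu N < delta -> cdom c (w 0%N).1.1 -> err (w 0%N) < r ->
  stopping G P phiL phic phie (nu N) (w 0%N) ->
  generated G P Rt phiL phic phie (fun k => nu (N + k).+1) w ->
  (0 < N)%N /\ forall k, [/\ cdom c (w k).1.1, err (w k) <= C * nu (N + k)%N,
    err (w k.+1) <= C * (err (w k) ^+ 2 + bar (nu (N + k).+1)) &
    bar (nu (N + k).+1) <= C * err (w k.+1)]].
Proof.
have [lL [uL [/andP[lL0 _] uL1 HL]]] := cL.
have [lc [uc [/andP[lc0 _] uc1 Hc]]] := cc.
have [le [ue [/andP[le0 _] ue1 He]]] := ce.
pose kl := Num.min lL (Num.min lc le); pose ku := Num.max uL (Num.max uc ue).
have kl0 : 0 < kl by rewrite !lt_min lL0 lc0 le0.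
have ku1 : 1 < ku by rewrite lt_max uL1.
have bnd phi (l u : R) k : kl <= l -> u <= ku ->
    (forall k, l * nu k.+1 <= phi (nu k.+1) <= u * nu k.+1) ->
    kl * nu k.+1 <= phi (nu k.+1) /\ phi (nu k.+1) <= ku * nu k.+1.
  move=> kll uku /(_ k)/andP[h1 h2]; split.
    by rewrite (le_trans _ h1)// ler_wpM2r// ltW.
  by rewrite (le_trans h2)// ler_wpM2r// ltW.
have bL k : kl * nu k.+1 <= phiL (nu k.+1) /\ phiL (nu k.+1) <= ku * nu k.+1.
  by apply: bnd HL; rewrite /kl /ku ?ge_min ?le_max lexx ?orbT.
have bc k : kl * nu k.+1 <= phic (nu k.+1) /\ phic (nu k.+1) <= ku * nu k.+1.
  by apply: bnd Hc; rewrite /kl /ku ?ge_min ?le_max lexx ?orbT.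
have be k : kl * nu k.+1 <= phie (nu k.+1) /\ phie (nu k.+1) <= ku * nu k.+1.
  by apply: bnd He; rewrite /kl /ku ?ge_min ?le_max lexx ?orbT.
have [K0 [rA [K00 rA0 HR]]] := stopping_residual G Ac ys ss cxs CP phiL phic phie.
have K0ku : 0 < K0 * ku by rewrite mulr_gt0// (lt_trans ltr01).
have [r [C [t0 [eta [/andP[r0 rrA] C0 t00 eta0 HN]]]]] := newton_step
  Ac cxs CP so kkt sc licq sosc lip phiL phic phie K0ku kl0 rA0.
have [K1 HK1] := cvg0_eventually nu_sqr eta0.
have [K2 _ HK2] := nu_dec.
(* From K on, (A3) holds with the constant eta and the parameters do not increase; the 1 is there
   because (A2) is about [nu k.+1]. *)
pose K := maxn 1 (maxn K1 K2).
(* The finitely many parameters of index below K are at least d, so [nu N < d] forces N >= K: a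
   small initial parameter makes the asymptotic hypotheses effective from the start. *)
have [d d0 Hd] := positive_lower_bound K nu0.
exists r, (Num.min t0 d), C; split=> //; first by rewrite lt_min t00.
move=> N w; rewrite lt_min => /andP[Nt Nd] cx0 w0r st0 gen.
have KN : (K <= N)%N.
  by rewrite leqNgt; apply/negP => /Hd; rewrite leNgt Nd.
have [N1 [NK1 NK2]] : (0 < N)%N /\ (K1 <= N)%N /\ (K2 <= N)%N.
  by move: KN; rewrite !geq_max => /andP[-> /andP[-> ->]].
have dec k : nu (N + k)%N <= nu N.
  by apply: (nonincreasing_from (K := K2)) => // j /HK2.
have sq k : nu (N + k)%N ^+ 2 <= eta * nu (N + k).+1.
  have := HK1 (N + k)%N (leq_trans NK1 (leq_addr _ _)).
  by rewrite ger0_norm ?divr_ge0 ?sqr_ge0 ?(ltW (nu0 _))// ler_pdivrMr.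
have Inv k : [/\ cdom c (w k).1.1, err (w k) < r & stopping G P phiL phic phie (nu (N + k)%N) (w k)] ->
    [/\ cdom c (w k.+1).1.1, err (w k.+1) < r &
      stopping G P phiL phic phie (nu (N + k.+1)%N) (w k.+1)] /\
    [/\ cdom c (w k).1.1, err (w k) <= C * nu (N + k)%N,
      err (w k.+1) <= C * (err (w k) ^+ 2 + bar (nu (N + k).+1)) &
      bar (nu (N + k).+1) <= C * err (w k.+1)].
  move=> [cx wr st].
  have res : `|Fh c P (hat (w k))| <= K0 * ku * nu (N + k)%N.
    rewrite -mulrA; apply: (HR (w k) (nu (N + k)%N)) st => //.
    - exact: lt_le_trans rrA.
    - exact: ltW.
    - by rewrite ler_peMl ?ltW.
    - by have [_] := bL (N + k).-1; rewrite prednK// addn_gt0 N1.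
    - by have [_] := bc (N + k).-1; rewrite prednK// addn_gt0 N1.
    - by have [_] := be (N + k).-1; rewrite prednK// addn_gt0 N1.
  have mut : nu (N + k).+1 <= nu (N + k)%N by apply: HK2; rewrite /= (leq_trans NK2)// leq_addr.
  have [ew [dd [bij E stp [cx' wr' q1 q2]]]] := HN _ _ _ cx wr res (nu0 _) mut
    (le_lt_trans (dec k) Nt) (sq k) (bL _).1 (bc _).1 (be _).1.
  (* The Newton point already passes the stopping test, so it is the iterate returned. *)
  have [st' /(_ dd bij E stp) wE] := gen k.
  by rewrite wE; split; split=> //; rewrite addnS -wE.
have all k : [/\ cdom c (w k).1.1, err (w k) < r & stopping G P phiL phic phie (nu (N + k)%N) (w k)].
  by elim: k => [|k /Inv[]//]; rewrite addn0.
by split=> // k; have [] := Inv k (all k).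
Qed.

End Iteration.

(** * Convergence and rates from the error recursion *)

Section Rates.
Context (R : realType) (n m p : nat) (M : topologicalType) (A : manifold R n M).
Context (c : chart R n M) (Ac : atlas A c).
Context (xs : M) (ys : 'rV[R]_m) (ss : 'rV[R]_p) (cxs : cdom c xs).
Local Notation hat := (hat c).
Let ws : pdpoint R M m p := (xs, ys, ss).
Local Notation err w := `|hat w - hat ws|.
Local Notation bar mu := `|const_mx mu : 'rV[R]_m|.
Implicit Types (w : nat -> pdpoint R M m p).

Lemma hat_cvg w : (forall k, cdom c (w k).1.1) -> err (w k) @[k --> \oo] --> 0 ->
  w k @[k --> \oo] --> ws.
Proof.
move=> cw ew.
have ew' : hat (w k) @[k --> \oo] --> hat ws.
  apply/cvgrPdist_le => e e0; have /cvgr0Pnorm_le/(_ e e0) := ew.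
  by apply: filterS => k; rewrite normr_id distrC.
have near_of (d : nat -> R) : (forall k, d k <= err (w k)) -> forall e, 0 < e ->
    \forall k \near \oo, d k <= e.
  move=> dle e e0; have /cvgr0Pnorm_le/(_ e e0) := ew.
  by apply: filterS => k; rewrite normr_id; exact: le_trans.
have zcvg : cmap c (w k).1.1 @[k --> \oo] --> cmap c xs.
  apply/cvgrPdist_le => e; apply: near_of => k.
  by rewrite distrC; exact: (norm_triple1 (hat (w k) - hat ws)).
have ycvg : (w k).1.2 @[k --> \oo] --> ys.
  apply/cvgrPdist_le => e; apply: near_of => k.
  by rewrite distrC; exact: (norm_triple2 (hat (w k) - hat ws)).
have scvg : (w k).2 @[k --> \oo] --> ss.
  apply/cvgrPdist_le => e; apply: near_of => k.
  by rewrite distrC; exact: (norm_triple3 (hat (w k) - hat ws)).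
have xcvg : (w k).1.1 @[k --> \oo] --> xs.
  have := cvg_comp _ _ zcvg (cinv_continuous Ac (cran_cmap cxs)).
  rewrite (cmapK Ac cxs); apply: cvg_trans; apply: near_eq_cvg.
  by apply: nearW => k /=; rewrite (cmapK Ac (cw k)).
have -> : w = (fun k => ((w k).1.1, (w k).1.2, (w k).2)).
  by apply/funext => k; case: (w k) => [[]].
exact: (cvg_pair (cvg_pair xcvg ycvg) scvg).
Qed.

Lemma near_hat (r : R) : 0 < r ->
  \forall w \near ws, cdom c w.1.1 /\ err w < r.
Proof.
move=> r0.
have Nx : \forall x \near xs, cdom c x /\ `|cmap c x - cmap c xs| < r.
  apply: filterI; first by apply: open_nbhs_nbhs; split=> //; exact: cdom_open Ac.
  have /cvgrPdist_lt/(_ r r0) := cmap_continuous Ac cxs.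
  by apply: filterS => x; rewrite distrC.
have Ny : \forall y \near ys, `|y - ys| < r by apply: (ball_near r0).
have Ns : \forall s \near ss, `|s - ss| < r by apply: (ball_near r0).
exists ([set q | (cdom c q.1 /\ `|cmap c q.1 - cmap c xs| < r) /\ `|q.2 - ys| < r],
  [set s | `|s - ss| < r]) => /=.
  split=> //; exists ([set x | cdom c x /\ `|cmap c x - cmap c xs| < r],
    [set y | `|y - ys| < r]) => //= q [? ?]; by split.
move=> [[x y] s] /= [[[cx xr] yr] sr]; split=> //.
by rewrite norm_triple_lt; apply/and3P; split.
Qed.

Lemma chart_dist_eventually (c' : chart R n M) w : atlas A c' -> cdom c' xs ->
  (forall k, cdom c (w k).1.1) -> err (w k) @[k --> \oo] --> 0 ->
  exists D K, 0 < D /\ forall k, (K <= k)%N ->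
    chart_dist c' (w k) ws <= D * err (w k) /\ err (w k) <= D * chart_dist c' (w k) ws.
Proof.
move=> Ac' c'x cw ew; have [D [r [D0 r0 H]]] := chart_dist_equiv ys ss Ac Ac' cxs c'x.
have r20 : 0 < r / 2 by rewrite divr_gt0.
have [K HK] := cvg0_eventually ew r20.
exists D, K; split=> // k /HK; rewrite normr_id => kr; apply: H => //.
by rewrite (le_lt_trans kr)// ltr_pdivrMr// ltr_pMr// ltr1n.
Qed.

Lemma superlinear_of_coord w : (forall k, cdom c (w k).1.1) ->
  err (w k) @[k --> \oo] --> 0 ->
  (forall e : R, 0 < e -> exists K, forall k, (K <= k)%N -> err (w k.+1) <= e * err (w k)) ->
  superlinear A w ws.
Proof.
move=> cw ew sl c' Ac' c'x.
have [D [K [D0 HK]]] := chart_dist_eventually Ac' c'x cw ew.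
have key (e : R) : 0 < e -> exists K', forall k, (K' <= k)%N ->
    chart_dist c' (w k.+1) ws <= e * chart_dist c' (w k) ws.
  (* One factor D for the change of chart at step k + 1, one for step k. *)
  move=> e0; have e'0 : 0 < e / D / D by rewrite !divr_gt0.
  have [K' HK'] := sl _ e'0; exists (maxn K K') => k; rewrite geq_max => /andP[Kk K'k].
  have [_ h2] := HK _ Kk; have [h1 _] := HK k.+1 (leqW Kk).
  rewrite (le_trans h1)// mulrC -ler_pdivlMr// (le_trans (HK' k K'k))//.
  apply: (@le_trans _ _ (e / D / D * (D * chart_dist c' (w k) ws))).
    by rewrite ler_wpM2l// ltW.
  by rewrite mulrA divfK ?gt_eqF// mulrAC.
split.
  have [K' HK'] := key 1 ltr01; exists K' => // k /HK' h k0.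
  apply/eqP; rewrite eq_le chart_dist_ge0 andbT.
  by rewrite (le_trans h)// k0 mulr0.
apply/cvgr0Pnorm_le => e e0; have [K' HK'] := key e e0; exists K' => // k /= /HK' h.
rewrite ger0_norm ?divr_ge0 ?chart_dist_ge0//.
have [->|d0] := eqVneq (chart_dist c' (w k) ws) 0; first by rewrite invr0 mulr0 ltW.
by rewrite ler_pdivrMr// lt_def d0 chart_dist_ge0.
Qed.

Lemma order_of_coord w (q C : R) K : 0 < q -> 0 < C -> (forall k, cdom c (w k).1.1) ->
  err (w k) @[k --> \oo] --> 0 ->
  (forall k, (K <= k)%N -> err (w k.+1) <= C * err (w k) `^ q) ->
  order_at_least A q w ws.
Proof.
move=> q0 C0 cw ew H c' Ac' c'x.
have [D [K' [D0 HK]]] := chart_dist_eventually Ac' c'x cw ew.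
exists (D * C * D `^ q), (maxn K K'); split.
  by rewrite !mulr_ge0 ?powR_ge0 ?ltW.
move=> k; rewrite geq_max => /andP[Kk K'k].
have [_ h2] := HK _ K'k; have [h1 _] := HK k.+1 (leqW K'k).
rewrite (le_trans h1)// -!mulrA ler_pM2l// (le_trans (H k Kk))// ler_pM2l//.
rewrite -powRM ?(ltW D0) ?chart_dist_ge0//.
by apply: ge0_ler_powR; rewrite ?nnegrE ?(ltW q0) ?mulr_ge0 ?(ltW D0) ?chart_dist_ge0.
Qed.

Section Recursion.
Context (nu : nat -> R) (N : nat) (C : R) (w : nat -> pdpoint R M m p).
Hypotheses (nu0 : forall k, 0 < nu k) (nu_cvg : nu k @[k --> \oo] --> 0) (C0 : 0 < C).
Hypothesis H1 : forall k, err (w k) <= C * nu (N + k)%N.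
Hypothesis H2 : forall k, err (w k.+1) <= C * (err (w k) ^+ 2 + bar (nu (N + k).+1)).
Hypothesis H3 : forall k, bar (nu (N + k).+1) <= C * err (w k.+1).

(** Index 0 is left out: the starting point only meets the stopping conditions, which do not bound
    its parameter by its error. The rates are therefore proved from k = 1 on. *)
Let bar_err k : (0 < k)%N -> bar (nu (N + k)%N) <= C * err (w k).
Proof. by case: k => // k _; rewrite addnS. Qed.

Lemma error_eventually (e : R) : 0 < e -> exists K, forall k, (K <= k)%N -> err (w k) <= e.
Proof.
move=> e0; have eC : 0 < e / C by rewrite divr_gt0.
have [K HK] := cvg0_eventually nu_cvg eC.
exists K => k Kk; rewrite (le_trans (H1 k))//.
have := HK (N + k)%N (leq_trans Kk (leq_addl _ _)).
by rewrite ger0_norm ?(ltW (nu0 _))// ler_pdivlMr// mulrC.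
Qed.

Lemma error_cvg : err (w k) @[k --> \oo] --> 0.
Proof.
apply/cvgr0Pnorm_le => e /error_eventually[K HK]; exists K => // k /= /HK.
by rewrite normr_id.
Qed.

Lemma superlinear_error : (nu k.+1 / nu k) @[k --> \oo] --> 0 ->
  forall e : R, 0 < e -> exists K, forall k, (K <= k)%N -> err (w k.+1) <= e * err (w k).
Proof.
move=> ratio e e0.
(* Half of e for each term of the recursion [H2]; the extra C in [e2] pays for [bar_err]. *)
have e1 : 0 < e / 2 / C by rewrite !divr_gt0.
have e2 : 0 < e / 2 / C / C by rewrite !divr_gt0.
have [K1 HK1] := error_eventually e1.
have [K2 HK2] := cvg0_eventually ratio e2.
exists (maxn 1 (maxn K1 K2)) => k; rewrite !geq_max => /andP[k1 /andP[kK1 kK2]].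
have nuE : nu (N + k).+1 = nu (N + k).+1 / nu (N + k)%N * nu (N + k)%N.
  by rewrite divfK// gt_eqF.
have rk := HK2 (N + k)%N (leq_trans kK2 (leq_addl _ _)).
have rk0 : 0 <= nu (N + k).+1 / nu (N + k)%N by rewrite divr_ge0// ltW.
rewrite ger0_norm// in rk.
have b : bar (nu (N + k).+1) <= e / 2 / C * err (w k).
  rewrite nuE barZ// (le_trans (ler_wpM2l rk0 (bar_err k1)))//.
  rewrite mulrA ler_wpM2r// -ler_pdivlMr//.
have sq : err (w k) ^+ 2 <= e / 2 / C * err (w k).
  by rewrite expr2 ler_wpM2r// HK1.
rewrite (le_trans (H2 k))// mulrC -ler_pdivlMr// (le_trans (lerD sq b))//.
rewrite -mulrDl [leRHS]mulrAC ler_wpM2r// -mulrDl ler_wpM2r ?invr_ge0 ?(ltW C0)//.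
by rewrite -splitr.
Qed.

Lemma order_error (a r : R) : 0 < a -> 0 < r < 1 -> (0 < N)%N ->
  (forall k, nu k.+2 = a * nu k.+1 `^ (1 + r)) ->
  exists K, forall k, (K <= k)%N ->
    err (w k.+1) <= C * (1 + a * C `^ (1 + r)) * err (w k) `^ (1 + r).
Proof.
move=> a0 /andP[r0 r1] N1 upd; have q0 : 0 < 1 + r by rewrite addr_gt0.
have [K HK] := error_eventually ltr01.
exists (maxn 1 K) => k; rewrite geq_max => /andP[k1 /HK ek].
(* The update rule starts at [nu 1], and N + k >= 1. *)
have nuE : nu (N + k).+1 = a * nu (N + k)%N `^ (1 + r).
  by have := upd (N + k).-1; rewrite prednK// addn_gt0 N1.
have b : bar (nu (N + k).+1) <= a * C `^ (1 + r) * err (w k) `^ (1 + r).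
  rewrite nuE (le_trans (bar_powR _ (ltW a0) (ltW (nu0 _)) q0))//.
  rewrite -mulrA ler_pM2l// -powRM ?(ltW C0)//.
  by apply: ge0_ler_powR; rewrite ?nnegrE ?(ltW q0) ?mulr_ge0 ?(ltW C0)// bar_err.
(* Errors are at most 1 here and 1 + r < 2, so the barrier update, and not Newton's method, dictates
   the order. *)
have sq : err (w k) ^+ 2 <= err (w k) `^ (1 + r).
  have [e0|e0] := eqVneq (err (w k)) 0; first by rewrite e0 expr0n powR_ge0.
  rewrite -powR_mulrn//; apply: ger_powR; first by rewrite lt_def e0 ek normr_ge0.
  by rewrite (_ : 2%:R = 1 + 1) // lerD2l ltW.
rewrite (le_trans (H2 k))// -mulrA ler_pM2l// (le_trans (lerD sq b))//.
by rewrite mulrDl mul1r.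
Qed.

End Recursion.

End Rates.

(* nu k is the barrier parameter mu_{k-1}.  "Sufficiently close / small" is the
   threshold (delta, neighbourhood of ws).  As (A3), (A4), (A8) are asymptotic,
   the threshold depends on the barrier sequence, and the algorithm may be
   started anywhere along it: with mu_{-1} = nu N below the threshold and then
   mu_k = nu (N + k + 1). *)
Theorem theorem4p2 (R : realType) (n m p : nat) (M : topologicalType)
  (A : manifold R n M) (G : riemannian A) (P : nlp R M m p)
  (Rt : retraction A) (phiL phic phie : R -> R) (ws : pdpoint R M m p)
  (nu : nat -> R) :
  connected [set: M] -> complete_metric G -> C2_nlp A P ->
  forcing phiL -> forcing phic -> forcing phie ->
  (forall k, 0 < nu k) -> nu k @[k --> \oo] --> 0 ->
  KKT G P ws ->
  (* (A1) *)
  strict_complementarity P ws -> LICQ G P ws.1.1 -> SOSC G P ws ->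
  (* (A2) *)
  forcing_comparable phiL (fun k => nu k.+1) ->
  forcing_comparable phic (fun k => nu k.+1) ->
  forcing_comparable phie (fun k => nu k.+1) ->
  (* (A3) *)
  (nu k ^+ 2 / nu k.+1) @[k --> \oo] --> 0 ->
  (* (A4) *)
  (\forall k \near \oo, nu k.+1 <= nu k) ->
  (* (A5) *)
  second_order G Rt ->
  (* (A6) *)
  pullback_hess_lipschitz G Rt (obj P) ws.1.1 ->
  (forall i, pullback_hess_lipschitz G Rt (ineq P i) ws.1.1) ->
  (forall j, pullback_hess_lipschitz G Rt (eqc P j) ws.1.1) ->
  (* (A8) *)
  (nu k.+1 / nu k) @[k --> \oo] --> 0 ->
  exists delta : R, 0 < delta /\
    \forall w0 \near ws, forall N : nat,
      (* (A7) *)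
      nu N < delta -> stopping G P phiL phic phie (nu N) w0 ->
      forall w : nat -> pdpoint R M m p,
        w 0%N = w0 ->
        generated G P Rt phiL phic phie (fun k => nu (N + k).+1) w ->
        [/\ w k @[k --> \oo] --> ws,
            superlinear A w ws &
            forall c r : R, 0 < c < 1 -> 0 < r < 1 -> nu 1%N <= 1 ->
              (forall k, nu k.+2 = c * nu k.+1 `^ (1 + r)) ->
              order_at_least A (1 + r) w ws].
Proof.
case: ws => [[xs ys] ss] _ _ CP _ _ _ nu0 nu_cvg kkt sc licq sosc cL cc ce nu_sqr nu_dec so
  lobj lineq leqc ratio.
have lip k : pullback_hess_lipschitz G Rt (theta P k) xs.
  by case: k => [i|[i|j]]; [exact: lobj|exact: lineq|exact: leqc].
(* The analysis runs in this one chart; [superlinear_of_coord] and [order_of_coord] carry the rates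
   to every chart around x*. *)
have Ac := chart_at_atlas A xs; have cxs := chart_at_dom A xs.
have [r [delta [C [r0 delta0 C0 H]]]] :=
  iteration Ac cxs CP so kkt sc licq sosc lip nu0 cL cc ce nu_sqr nu_dec.
exists delta; split=> //.
apply: filterS (near_hat Ac ys ss cxs r0) => w0 [cx wr] N Nd st w w0E gen.
have {H} [|||N1 H] := H N w Nd _ _ _ gen; rewrite ?w0E//.
have cw k : cdom (chart_at A xs) (w k).1.1 by have [] := H k.
have H1 k := let: And4 _ h _ _ := H k in h.
have H2 k := let: And4 _ _ h _ := H k in h.
have H3 k := let: And4 _ _ _ h := H k in h.
have ew := error_cvg nu0 nu_cvg C0 H1.
split.
- exact: (hat_cvg Ac cxs cw ew).
- apply: (superlinear_of_coord Ac cxs cw ew).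
  exact: (superlinear_error nu0 nu_cvg C0 H1 H2 H3 ratio).
- move=> a q /andP[a0 _] q01 _ upd.
  have [K HK] := order_error nu0 nu_cvg C0 H1 H2 H3 a0 q01 N1 upd.
  have /andP[q0 _] := q01.
  apply: (order_of_coord Ac cxs _ _ cw ew HK); first by rewrite addr_gt0.
  by rewrite mulr_gt0// addr_gt0// mulr_gt0// powR_gt0.
Qed.
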